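(* Let $G$ be a compact connected Lie group with Lie algebra $\mathfrak{g}$, let $M$ be a compact connected smooth manifold, and let $\pi\colon P\to M$ be a (smooth) principal $G$-bundle. Fix a bi-invariant metric $\langle -,-\rangle$ on $G$ and a Riemannian metric $g_M$ on $M$. Let $\theta\in\Omega^1(P,\mathfrak{g})$ be a principal connection and let $u\in P$ be such that the holonomy group $\mathrm{Hol}_u(\theta)\subset G$ is a closed subgroup. Let $g_P:=\pi^*g_M+\langle\theta,\theta\rangle$, a Riemannian metric on $P$, and let $g_T$ be the $G$-invariant Riemannian metric on $G/\mathrm{Hol}_u(\theta)$ induced by $\langle-,-\rangle$ which makes the projection $G\to G/\mathrm{Hol}_u(\theta)$ a Riemannian submersion. Then $$d_{GH}\big((P,d_{g_P}),(G/\mathrm{Hol}_u(\theta),d_{g_T})\big)\le\frac{\mathrm{diam}\big(P_u(\theta),\mathrm{dist}_{\mathcal H}\big)}{2},$$ where $P_u(\theta)$ is the holonomy bundle of $\theta$ through $u$ and $\mathrm{dist}_{\mathcal H}$ is the Carnot-Carathéodory distance on $P_u(\theta)$ induced by the restriction to $P_u(\theta)$ of the sub-Riemannian structure $(\ker\theta,\,g_P|_{\ker\theta})$.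
   Context: $G$ acts smoothly and freely on $P$ on the right, with $R_g(x)=xg$. A principal connection is a $\mathfrak{g}$-valued 1-form $\theta$ on $P$ with $R_g^*\theta=\mathrm{Ad}(g^{-1})\theta$ for all $g\in G$ and $\theta(\xi_* )=\xi$ for all $\xi\in\mathfrak{g}$, where $\xi_*$ is the vector field on $P$ generated by $\xi$. A curve in $P$ is $\theta$-horizontal if its velocity lies in $\ker\theta$. Write $p\sim q$ if $p,q\in P$ can be joined by a piecewise smooth $\theta$-horizontal path. The holonomy group is $\mathrm{Hol}_u(\theta)=\{g\in G: u\sim ug\}$ and the holonomy bundle is $P_u(\theta)=\{x\in P: u\sim x\}$, which is a principal $\mathrm{Hol}_u(\theta)$-bundle over $M$ on which $\theta$ restricts to a principal connection. In $\langle\theta,\theta\rangle$, the symbol $\langle-,-\rangle$ denotes the corresponding $\mathrm{Ad}$-invariant inner product on $\mathfrak{g}$, so $\langle\theta,\theta\rangle(V,W)=\langle\theta(V),\theta(W)\rangle$. For a Riemannian metric $g$, $d_g$ denotes its Riemannian distance. Put $\mathcal H:=\ker(\theta)|_{P_u(\theta)}$, a subbundle of $T(P_u(\theta))$. For $a,b\in P_u(\theta)$, $\mathrm{dist}_{\mathcal H}(a,b)$ is the infimum of the $g_P$-lengths of $\mathcal H$-horizontal curves in $P_u(\theta)$ joining $a$ and $b$. $d_{GH}$ is the Gromov-Hausdorff distance between compact metric spaces: $d_{GH}((X,d_X),(Y,d_Y))=\frac12\inf_{\mathscr R}\mathrm{dis}(\mathscr R)$, where $\mathscr R$ ranges over correspondences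 between $X$ and $Y$ (subsets of $X\times Y$ projecting onto both factors) and $\mathrm{dis}(\mathscr R)=\sup\{|d_X(x,x')-d_Y(y,y')|:(x,y),(x',y')\in\mathscr R\}$. *)

(* Defs.v *)
From HB Require Import structures.
From mathcomp Require Import all_boot all_order all_algebra.
From mathcomp Require Import all_classical all_reals all_analysis.
Set Implicit Arguments.
Unset Strict Implicit.
Unset Printing Implicit Defensive.
Import Order.TTheory GRing.Theory Num.Theory.
Import numFieldNormedType.Exports.
Local Open Scope classical_set_scope.
Local Open Scope ring_scope.

(* [Ck k U f] and [smooth_on U f] are meant for [U] open and a
   finite-dimensional domain [E]: [f] is C^(k+1) iff it is Frechet
   differentiable and all its directional derivatives are C^k. *)
Fixpoint Ck (R : realType) (E W : normedModType R) (k : nat) (U : set E)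
    (f : E -> W) : Prop :=
  match k with
  | 0%N => forall x, U x -> {for x, continuous f}
  | k'.+1 => (forall x, U x -> differentiable f x) /\
             (forall v : E, Ck k' U (fun x => 'd f x v))
  end.

Definition smooth_on (R : realType) (E W : normedModType R) (U : set E)
    (f : E -> W) : Prop :=
  forall k, Ck k U f.

(* A homeomorphism [chart_map] from the open set [chart_dom] onto an open subset
   of R^n; both maps are total, with irrelevant values elsewhere. *)
Record chart (R : realType) (n : nat) (M : topologicalType) := Chart {
  chart_dom : set M ;
  chart_map :> M -> 'rV[R]_n ;
  chart_inv : 'rV[R]_n -> M ;
  chart_dom_open : open chart_dom ;
  chart_cod_open : open (chart_map @` chart_dom) ;
  chart_mapK : forall x, chart_dom x -> chart_inv (chart_map x) = x ;
  chart_map_cts : forall x, chart_dom x -> {for x, continuous chart_map} ;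
  chart_inv_cts :
    forall y, (chart_map @` chart_dom) y -> {for y, continuous chart_inv}
}.

(* The atlas need not be maximal. *)
HB.mixin Record Topological_isManifold (R : realType) (n : nat) M
    & Topological M := {
  manifold_hausdorff : hausdorff_space M ;
  manifold_second_countable : @second_countable M ;
  atlas : set (chart R n M) ;
  atlas_cover : forall x : M, exists2 phi, atlas phi & chart_dom phi x ;
  atlas_compat : forall phi psi, atlas phi -> atlas psi ->
    smooth_on (phi @` (chart_dom phi `&` chart_dom psi))
              (fun y => psi (chart_inv phi y))
}.

#[short(type="manifoldType")]
HB.structure Definition Manifold (R : realType) (n : nat) :=
  {M of Topological M & Topological_isManifold R n M}.

Definition smooth_into (R : realType) (E : normedModType R) n
    (N : manifoldType R n) (U : set E) (c : E -> N) : Prop :=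
  (forall x, U x -> {for x, continuous c}) /\
  (forall psi : chart R n N, atlas psi ->
     smooth_on (U `&` c @^-1` chart_dom psi) (fun x => psi (c x))).

Definition smooth_map_on (R : realType) m n (M : manifoldType R m)
    (N : manifoldType R n) (U : set M) (F : M -> N) : Prop :=
  forall phi : chart R m M, atlas phi ->
    smooth_into (phi @` (chart_dom phi `&` U)) (fun y => F (chart_inv phi y)).

Definition smooth_map (R : realType) m n (M : manifoldType R m)
    (N : manifoldType R n) (F : M -> N) : Prop :=
  smooth_map_on [set: M] F.

(* Smoothness on an open subset [A] of the product manifold [M1 * M2], read in
   the product charts, which take values in R^m1 x R^m2. *)
Definition smooth_map2_on (R : realType) m1 m2 n (M1 : manifoldType R m1)
    (M2 : manifoldType R m2) (N : manifoldType R n) (A : set (M1 * M2))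
    (F : M1 -> M2 -> N) : Prop :=
  forall (phi : chart R m1 M1) (psi : chart R m2 M2), atlas phi -> atlas psi ->
    smooth_into
      ((fun x : M1 * M2 => (phi x.1, psi x.2)) @`
         ((chart_dom phi `*` chart_dom psi) `&` A))
      (fun z : 'rV[R]_m1 * 'rV[R]_m2 => F (chart_inv phi z.1) (chart_inv psi z.2)).

Definition smooth_fun (R : realType) n (M : manifoldType R n) (f : M -> R)
    : Prop :=
  forall phi : chart R n M, atlas phi ->
    smooth_on (phi @` chart_dom phi) (fun y => f (chart_inv phi y)).

(* The tangent space at [p] is the space of derivations at [p] of the algebra
   of smooth functions. A functional on smooth functions is encoded as a
   functional on all functions which vanishes on the non-smooth ones, so that
   equality of tangent vectors is Leibniz equality and the vector space
   operations are those of the function space. *)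
Definition tangent (R : realType) n (M : manifoldType R n) (p : M)
    : set ((M -> R) -> R) :=
  [set v | [/\ forall f, ~ smooth_fun f -> v f = 0,
     forall a f h, smooth_fun f -> smooth_fun h ->
       v (fun x => a * f x + h x) = a * v f + v h &
     forall f h, smooth_fun f -> smooth_fun h ->
       v (fun x => f x * h x) = f p * v h + h p * v f]].

(* The differential of [F], applied to a vector tangent to [M] at some [p];
   the result is tangent to [N] at [F p] if [F] is smooth. *)
Definition tdiff (R : realType) m n (M : manifoldType R m)
    (N : manifoldType R n) (F : M -> N) (v : (M -> R) -> R)
    : (N -> R) -> R :=
  fun f => if `[< smooth_fun f >] then v (f \o F) else 0.

Definition vector_field (R : realType) n (M : manifoldType R n)
    (X : M -> (M -> R) -> R) : Prop :=
  (forall p, tangent p (X p)) /\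
  (forall f, smooth_fun f -> smooth_fun (fun p => X p f)).

Definition velocity (R : realType) n (M : manifoldType R n) (c : R -> M) (t : R)
    : (M -> R) -> R :=
  fun f => if `[< smooth_fun f >] then derive1 (f \o c) t else 0.

(* [g p v w] is relevant only for [v] and [w] tangent at [p]. *)
Definition metric_on (R : realType) n (M : manifoldType R n) : Type :=
  M -> ((M -> R) -> R) -> ((M -> R) -> R) -> R.

Definition riemannian (R : realType) n (M : manifoldType R n)
    (g : metric_on M) : Prop :=
  [/\ forall p a u v w, tangent p u -> tangent p v -> tangent p w ->
        g p (a *: u + v) w = a * g p u w + g p v w,
      forall p v w, tangent p v -> tangent p w -> g p v w = g p w v,
      forall p v, tangent p v -> v <> 0 -> 0 < g p v v &
      forall X Y, vector_field X -> vector_field Y ->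
        smooth_fun (fun p => g p (X p) (Y p))].

Definition pullback (R : realType) m n (M : manifoldType R m)
    (N : manifoldType R n) (F : M -> N) (g : metric_on N) : metric_on M :=
  fun p v w => g (F p) (tdiff F v) (tdiff F w).

Definition preserves (R : realType) n (M : manifoldType R n) (g : metric_on M)
    (F : M -> M) : Prop :=
  forall p v w, tangent p v -> tangent p w -> pullback F g p v w = g p v w.

Definition submersion (R : realType) m n (M : manifoldType R m)
    (N : manifoldType R n) (F : M -> N) : Prop :=
  smooth_map F /\
  (forall p w, tangent (F p) w -> exists2 v, tangent p v & tdiff F v = w).

Definition ker_orthogonal (R : realType) m n (M : manifoldType R m)
    (N : manifoldType R n) (F : M -> N) (g : metric_on M) (p : M)
    (v : (M -> R) -> R) : Prop :=
  tangent p v /\ (forall k, tangent p k -> tdiff F k = 0 -> g p v k = 0).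

Definition riemannian_submersion (R : realType) m n (M : manifoldType R m)
    (N : manifoldType R n) (gM : metric_on M) (gN : metric_on N) (F : M -> N)
    : Prop :=
  submersion F /\
  (forall p v w, ker_orthogonal F gM p v -> ker_orthogonal F gM p w ->
     pullback F gN p v w = gM p v w).

(* A curve is smooth on the compact interval [a, b] if it extends to a smooth
   curve on a neighborhood of it. *)
Definition smooth_arc (R : realType) n (M : manifoldType R n) (a b : R)
    (c : R -> M) : Prop :=
  exists (U : set R) (e : R -> M),
    [/\ open U, `[a, b] `<=` U, smooth_into U e &
        forall s, a <= s <= b -> c s = e s].

Definition subdivision (R : realType) (k : nat) (t : nat -> R) : Prop :=
  [/\ t 0%N = 0, t k = 1 & forall i, (i < k)%N -> t i < t i.+1].

Definition smooth_along (R : realType) n (M : manifoldType R n) (k : nat)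
    (t : nat -> R) (c : R -> M) : Prop :=
  subdivision k t /\
  (forall i, (i < k)%N -> smooth_arc (t i) (t i.+1) c).

Definition piecewise_smooth (R : realType) n (M : manifoldType R n)
    (c : R -> M) : Prop :=
  exists k t, smooth_along k t c.

(* The finitely many break points, where [velocity] is meaningless, do not
   contribute to the integral. *)
Definition curve_length (R : realType) n (M : manifoldType R n)
    (g : metric_on M) (c : R -> M) : \bar R :=
  (\int[lebesgue_measure]_(s in `[0%R, 1%R])
     (Num.sqrt (g (c s) (velocity c s) (velocity c s)))%:E)%E.

Definition riem_dist (R : realType) n (M : manifoldType R n)
    (g : metric_on M) (x y : M) : \bar R :=
  ereal_inf [set curve_length g c | c in
    [set c : R -> M | [/\ piecewise_smooth c, c 0 = x & c 1 = y]]].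

HB.mixin Record Manifold_Group_isLie (R : realType) (n : nat) G
    & Manifold R n G & Group G := {
  lie_mul_smooth : smooth_map2_on [set: G * G] (fun x y : G => (x * y)%g : G) ;
  lie_inv_smooth : smooth_map (fun x : G => (x^-1)%g : G)
}.

#[short(type="lieGroupType")]
HB.structure Definition LieGroup (R : realType) (n : nat) :=
  {G of Manifold R n G & Group G & Manifold_Group_isLie R n G}.

Definition bi_invariant (R : realType) k (G : lieGroupType R k)
    (b : metric_on G) : Prop :=
  forall h : G, preserves b (fun x : G => (h * x)%g : G) /\
                preserves b (fun x : G => (x * h)%g : G).

(* Meant for [xi] tangent at the identity *)
Definition Ad (R : realType) k (G : lieGroupType R k) (a : G)
    (xi : (G -> R) -> R) : (G -> R) -> R :=
  tdiff (fun x : G => (a * x * a^-1)%g : G) xi.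

Definition locally_trivial (R : realType) k m l (G : lieGroupType R k)
    (M : manifoldType R m) (P : manifoldType R l) (pi : P -> M)
    (act : P -> G -> P) : Prop :=
  forall x : M, exists (U : set M) (tau : P -> G) (Psi : M -> G -> P),
    [/\ open U /\ U x,
        smooth_map_on (pi @^-1` U) tau /\
          smooth_map2_on (U `*` [set: G]) Psi,
        forall p, U (pi p) -> Psi (pi p) (tau p) = p,
        forall y a, U y -> pi (Psi y a) = y /\ tau (Psi y a) = a &
        forall p a, U (pi p) -> tau (act p a) = (tau p * a)%g].

Definition principal_bundle (R : realType) k m l (G : lieGroupType R k)
    (M : manifoldType R m) (P : manifoldType R l) (pi : P -> M)
    (act : P -> G -> P) : Prop :=
  [/\ smooth_map pi /\ smooth_map2_on [set: P * G] act,
      (forall p, act p 1%g = p) /\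
        (forall p a b, act (act p a) b = act p (a * b)%g),
      forall p a, act p a = p -> a = 1%g,
      forall p a, pi (act p a) = pi p &
      locally_trivial pi act].

(* [theta p v] is relevant only for [v] tangent at [p]; the Lie algebra of [G]
   is the tangent space of [G] at the identity. *)
Definition form_on (R : realType) k l (G : lieGroupType R k)
    (P : manifoldType R l) : Type :=
  P -> ((P -> R) -> R) -> ((G -> R) -> R).

(* The vector field generated by [xi]: at [p], the image of [xi] under the
   differential at the identity of the orbit map of [p] *)
Definition fundamental (R : realType) k l (G : lieGroupType R k)
    (P : manifoldType R l) (act : P -> G -> P) (xi : (G -> R) -> R) (p : P)
    : (P -> R) -> R :=
  tdiff (act p) xi.

(* Evaluations at smooth functions are exactly the linear forms on the Lie
   algebra, whence the third condition expresses smoothness of [theta]. *)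
Definition principal_connection (R : realType) k l (G : lieGroupType R k)
    (P : manifoldType R l) (act : P -> G -> P) (theta : form_on G P) : Prop :=
  [/\ forall p v, tangent p v -> tangent (1%g : G) (theta p v),
      forall p a v w, tangent p v -> tangent p w ->
        theta p (a *: v + w) = a *: theta p v + theta p w,
      forall X, vector_field X -> forall f : G -> R, smooth_fun f ->
        smooth_fun (fun p => theta p (X p) f),
      forall (a : G) p v, tangent p v ->
        theta (act p a) (tdiff (act^~ a) v) = Ad (a^-1)%g (theta p v) &
      forall xi p, tangent (1%g : G) xi ->
        theta p (fundamental act xi p) = xi].

Definition connection_metric (R : realType) k m l (G : lieGroupType R k)
    (M : manifoldType R m) (P : manifoldType R l) (pi : P -> M)
    (gM : metric_on M) (b : metric_on G) (theta : form_on G P) : metric_on P :=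
  fun p v w => pullback pi gM p v w + b 1%g (theta p v) (theta p w).

Definition horizontal (R : realType) k l (G : lieGroupType R k)
    (P : manifoldType R l) (theta : form_on G P) (c : R -> P) : Prop :=
  exists j t, smooth_along j t c /\
    (forall i s, (i < j)%N -> t i < s < t i.+1 ->
       theta (c s) (velocity c s) = 0).

Definition hjoined (R : realType) k l (G : lieGroupType R k)
    (P : manifoldType R l) (theta : form_on G P) (x y : P) : Prop :=
  exists c : R -> P, [/\ horizontal theta c, c 0 = x & c 1 = y].

Definition Hol (R : realType) k l (G : lieGroupType R k)
    (P : manifoldType R l) (act : P -> G -> P) (theta : form_on G P) (u : P)
    : set G :=
  [set a | hjoined theta u (act u a)].

Definition hol_bundle (R : realType) k l (G : lieGroupType R k)
    (P : manifoldType R l) (theta : form_on G P) (u : P) : set P :=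
  [set x | hjoined theta u x].

(* Infimum over horizontal curves lying in [S]; the curves are required to be
   smooth as curves in [P], which amounts to the same when [S] is a submanifold
   of [P]. *)
Definition cc_dist (R : realType) k l (G : lieGroupType R k)
    (P : manifoldType R l) (theta : form_on G P) (g : metric_on P) (S : set P)
    (x y : P) : \bar R :=
  ereal_inf [set curve_length g c | c in
    [set c : R -> P | [/\ horizontal theta c, c 0 = x, c 1 = y &
                          forall s, 0 <= s <= 1 -> S (c s)]]].

(* [q : G -> Q] is the projection onto the quotient manifold of left cosets:
   [Q] is in bijection with the set of cosets [a H], and carries the unique
   smooth structure for which the projection is a submersion. *)
Definition coset_projection (R : realType) k r (G : lieGroupType R k)
    (Q : manifoldType R r) (H : set G) (q : G -> Q) : Prop :=
  [/\ forall y, exists a, q a = y,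
      forall a b, q a = q b <-> H (a^-1 * b)%g &
      submersion q].

(* [L] is the left translation by [a] of the coset space *)
Definition left_invariant (R : realType) k r (G : lieGroupType R k)
    (Q : manifoldType R r) (q : G -> Q) (g : metric_on Q) : Prop :=
  forall (a : G) (L : Q -> Q), (forall b, L (q b) = q (a * b)%g) ->
    preserves g L.

Definition correspondence (X Y : Type) (C : set (X * Y)) : Prop :=
  (forall x, exists y, C (x, y)) /\ (forall y, exists x, C (x, y)).

Definition distortion (R : realType) (X Y : Type) (dX : X -> X -> \bar R)
    (dY : Y -> Y -> \bar R) (C : set (X * Y)) : \bar R :=
  ereal_sup [set `|dX z.1 z'.1 - dY z.2 z'.2|%E | z in C & z' in C].

Definition gh_dist (R : realType) (X Y : Type) (dX : X -> X -> \bar R)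
    (dY : Y -> Y -> \bar R) : \bar R :=
  ((2^-1)%:E * ereal_inf [set distortion dX dY C | C in
                            [set C | correspondence C]])%E.

Definition diam (R : realType) (X : Type) (S : set X) (d : X -> X -> \bar R)
    : \bar R :=
  ereal_sup [set d x y | x in S & y in S].

(* Main.v *)
Require Import Defs.
From HB Require Import structures.
From mathcomp Require Import all_boot all_order all_algebra.
From mathcomp Require Import all_classical all_reals all_analysis.
From mathcomp Require Import measurable_realfun.
From mathcomp Require Import zify lra ring.

(* Every point of P is y g with y in the holonomy bundle P_u and g in G. The
   relation {(y g, q(g^-1))} is a well-defined map from P onto G / Hol_u, and its
   distortion is at most D = diam(P_u, dist_H). On the one hand it does not
   increase distances: a curve c of P is the product of a horizontal curve by a
   curve e of G with e^-1 e' = theta(c'), and both the bi-invariance of the metric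
   of G and the Pythagorean definition of g_P bound the speed of q(e^-1 g^-1) by that of c.
   On the other hand, a curve of G / Hol_u lifts horizontally to a curve a of G with
   the same speed; multiplying by a^-1 a horizontal curve of P_u of length about
   D at most, with suitable endpoints, gives a curve of P whose length is at most
   the sum of both lengths. *)

Set Implicit Arguments.
Unset Strict Implicit.
Unset Printing Implicit Defensive.
Import Order.TTheory GRing.Theory Num.Theory.
Import numFieldNormedType.Exports.
Local Open Scope classical_set_scope.
Local Open Scope ring_scope.

(** * Calculus of smooth maps *)

(** Tangent vectors are derivations of the algebra of globally defined smooth functions, and the
    regularity of metrics and of [theta] is stated on global vector fields, whereas every estimate
    concerns velocities of curves. Bump functions and Hadamard's lemma bridge the gap: the
    coordinate derivations of a chart extend to global vector fields and span the tangent spaces, so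
    that a velocity is locally a combination of vector fields with smooth coefficients. Both curves
    taken in G, the one solving e^-1 e' = theta(c') and the horizontal lift of a curve of the coset
    space, come from differential equations that are solved only locally. They extend to the whole
    interval because translation in G sends solutions to solutions: a local solution can be started
    at any admissible point, and local solutions then glue without any uniform bound on their time
    of existence. The holonomy bundle is handled purely as an equivalence class of points joined by
    horizontal curves. It meets every fiber because M is connected, and it is compatible with the
    group action because horizontal curves may be reversed, concatenated and translated. *)

Section diff_extra.
Context {R : realType}.
Implicit Types E W : normedModType R.

(** Uniqueness of the differential reduces differentiability with a continuous linear candidate to
    an inequality near 0. Flat functions at 0 and parametric integrals are differentiated in this
    form. *)
Lemma is_diff_epsP E W (f : E -> W) (df : {linear E -> W}) x :
  continuous df ->
  is_diff x f df <->
  (forall e, 0 < e ->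
     \forall h \near 0, `|f (h + x) - f x - df h| <= e * `|h|).
Proof.
move=> cdf; split.
  case=> fx dfE e e0; have /diff_locallyP[_ H] := fx.
  move: H => /eqaddoP /(_ e e0).
  apply: filterS => h; rewrite /= fctE /= dfE.
  by rewrite /cst /= !fctE /= opprD addrA.
move=> H.
have H1 : f \o shift x = cst (f x) + df +o_ 0 id.
  apply/eqaddoP => e e0; apply: filterS (H e e0) => h /=.
  by rewrite !fctE /= opprD addrA.
have dE := diff_unique cdf H1.
apply: DiffDef; last exact: dE.
by apply/diff_locallyP; rewrite dE; split.
Qed.

Lemma near_is_diff E W (f g : E -> W) (df : E -> W) x :
  (\forall y \near x, f y = g y) -> is_diff x f df -> is_diff x g df.
Proof.
move=> fg [fx <-].
apply/is_diff_epsP; first exact: diff_continuous.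
  have /is_diff_epsP : is_diff x f ('d f x) by split.
  move=> /(_ (diff_continuous fx)) H e e0; have gx := nbhs_singleton fg.
  near=> h.
  have -> : g (h + x) = f (h + x).
    apply/esym; near: h; move: fg.
    by rewrite (near_shift 0 x); apply: filterS => z; rewrite /= subr0.
  by rewrite -gx; near: h; exact: H.
Unshelve. all: by end_near. Qed.

Lemma near_differentiable E W (f g : E -> W) x :
  (\forall y \near x, f y = g y) -> differentiable f x -> differentiable g x.
Proof. by move=> fg /differentiableP /(near_is_diff fg) []. Qed.

Lemma near_diff E W (f g : E -> W) x :
  (\forall y \near x, f y = g y) -> differentiable f x ->
  'd g x = 'd f x :> (E -> W).
Proof. by move=> fg /differentiableP /(near_is_diff fg) []. Qed.
End diff_extra.

Section Ck_theory.
Context {R : realType}.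
Implicit Types E W : normedModType R.

Lemma near_for_continuous (S T : topologicalType) (f g : S -> T) x :
  (\forall y \near x, f y = g y) -> {for x, continuous f} ->
  {for x, continuous g}.
Proof.
move=> fg cf; rewrite /prop_for /continuous_at -(nbhs_singleton fg).
by apply: cvg_trans cf; exact: near_eq_cvg.
Qed.

Lemma Ck_congr E W k (U : set E) (f g : E -> W) : open U ->
  (forall x, U x -> f x = g x) -> Ck k U f -> Ck k U g.
Proof.
move=> oU; elim: k f g => [|k IH] f g fg /=.
  move=> cf x Ux; apply: near_for_continuous (cf x Ux).
  by apply: filterS (open_nbhs_nbhs (conj oU Ux)).
have nfg x : U x -> \forall y \near x, f y = g y.
  by move=> Ux; apply: filterS (open_nbhs_nbhs (conj oU Ux)).
move=> [df Df]; split=> [x Ux|v]; first exact: near_differentiable (nfg x Ux) (df x Ux).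
apply: IH (Df v) => x Ux.
by rewrite -(near_diff (nfg x Ux) (df x Ux)).
Qed.

Lemma CkSP E W k (U : set E) (f : E -> W) : Ck k.+1 U f <->
  (forall x, U x -> differentiable f x) /\ (forall v, Ck k U (fun x => 'd f x v)).
Proof. by []. Qed.

Lemma Ck_sub E W k (U V : set E) (f : E -> W) : V `<=` U -> Ck k U f -> Ck k V f.
Proof.
move=> VU; elim: k f => [|k IH] f /= => [cf x /VU|[df Df]]; first exact: cf.
by split=> [x /VU /df //|v]; exact: IH (Df v).
Qed.

Lemma CkW E W k (U : set E) (f : E -> W) : Ck k.+1 U f -> Ck k U f.
Proof.
elim: k f => [|k IH] f [df Df].
  by move=> x /df; exact: differentiable_continuous.
by split=> // v; exact: IH (Df v).
Qed.

Lemma Ck_local E W k (U : set E) (f : E -> W) :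
  (forall x, U x -> exists V, V x /\ Ck k V f) -> Ck k U f.
Proof.
elim: k f => [|k IH] f H /=.
  by move=> x /H[V [Vx /(_ x Vx)]].
split=> [x /H[V [Vx [/(_ x Vx) + _]]]//|v].
by apply: (IH (fun x => 'd f x v)) => x /H[V [Vx [_ DV]]]; exists V; split=> //; exact: DV.
Qed.

Lemma Ck_cst E W k (U : set E) (a : W) : Ck k U (fun=> a).
Proof.
elim: k a => [|k IH] a /=; first by move=> x _; exact: cst_continuous.
split=> [x _|v]; first exact: differentiable_cst.
rewrite (_ : (fun x => _) = fun=> 0); first exact: IH.
by apply/funext => x; rewrite -[fun=> a]/(cst a) diff_cst.
Qed.

Lemma Ck_linear E W k (U : set E) (L : {linear E -> W}) :
  continuous L -> Ck k U L.
Proof.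
move=> cL; case: k => [|k] /=; first by move=> x _; exact: cL.
split=> [x _|v]; first exact: linear_differentiable.
rewrite (_ : (fun x => _) = fun=> L v); first exact: Ck_cst.
by apply/funext => x; rewrite diff_lin.
Qed.

Lemma Ck_id E k (U : set E) : Ck k U (fun x : E => x).
Proof. by apply: (@Ck_linear E E k U idfun) => x; exact: cvg_id. Qed.

Lemma Ck_lincomp E W W' k (U : set E) (L : {linear W -> W'}) (f : E -> W) :
  open U -> continuous L -> Ck k U f -> Ck k U (fun x => L (f x)).
Proof.
move=> oU cL; elim: k f => [|k IH] f /=.
  by move=> cf x Ux; apply: continuous_comp; [exact: cf|exact: cL].
have dL y : differentiable L y by exact: linear_differentiable.
move=> [df Df]; split=> [x Ux|v].
  by apply: (@differentiable_comp _ _ _ _ f L); [exact: df|exact: dL].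
apply: Ck_congr (IH _ (Df v)) => // x Ux.
by rewrite -[fun y => L (f y)]/(L \o f) (diff_comp (df _ Ux) (dL _)) diff_lin.
Qed.

Lemma CkD E W k (U : set E) (f g : E -> W) : open U ->
  Ck k U f -> Ck k U g -> Ck k U (fun x => f x + g x).
Proof.
move=> oU; elim: k f g => [|k IH] f g /=.
  by move=> cf cg x Ux; apply: continuousD; [exact: cf|exact: cg].
move=> [df Df] [dg Dg]; split=> [x Ux|v].
  by apply: differentiableD; [exact: df|exact: dg].
apply: Ck_congr (IH _ _ (Df v) (Dg v)) => // x Ux.
rewrite -[fun x => f x + g x]/(f + g) diffD//; [exact: df|exact: dg].
Qed.

Lemma Ck_sum E W k (U : set E) (I : Type) (s : seq I) (P : pred I)
    (f : I -> E -> W) : open U ->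
  (forall i, P i -> Ck k U (f i)) -> Ck k U (fun x => \sum_(i <- s | P i) f i x).
Proof.
move=> oU H; elim: s => [|i s IH].
  by under eq_fun do rewrite big_nil; exact: Ck_cst.
under eq_fun do rewrite big_cons.
by case Pi : (P i) => //; apply: CkD => //; exact: H.
Qed.

Lemma CkM E k (U : set E) (f g : E -> R) : open U ->
  Ck k U f -> Ck k U g -> Ck k U (fun x => f x * g x).
Proof.
move=> oU; elim: k f g => [|k IH] f g.
  by move=> /= cf cg x Ux; apply: continuousM; [exact: cf|exact: cg].
move=> Cf Cg; have /CkSP[df Df] := Cf; have /CkSP[dg Dg] := Cg.
apply/CkSP; split=> [x Ux|v].
  by apply: differentiableM; [exact: df|exact: dg].
have H : Ck k U (fun x => f x * 'd g x v + g x * 'd f x v).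
  by apply: (CkD oU); apply: IH; [exact: CkW|exact: Dg|exact: CkW|exact: Df].
apply: Ck_congr H => // x Ux.
rewrite -[fun x => f x * g x]/(f * g) diffM//; [exact: df|exact: dg].
Qed.

Lemma Ck_scalel E W k (U : set E) (f : E -> R) (w : W) : open U ->
  Ck k U f -> Ck k U (fun x => f x *: w).
Proof.
move=> oU; elim: k f => [|k IH] f /=.
  by move=> cf x Ux; apply: continuousZr_tmp; exact: cf.
move=> [df Df]; split=> [x Ux|v].
  by apply: differentiableZl; exact: df.
apply: Ck_congr (IH _ (Df v)) => // x Ux.
by rewrite diffZl//; exact: df.
Qed.

Definition coordmx_lin m n (i : 'I_m) (j : 'I_n) : {linear 'M[R]_(m, n) -> R}.
Proof.
have @f : {linear 'M[R]_(m, n) -> R}.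
  by exists (fun N : 'M[R]_(_, _) => N i j); do 2![eexists]; do ?[constructor];
     rewrite ?mxE// => ? *; rewrite ?mxE//; move=> ?; rewrite !mxE.
exact: f.
Defined.

Lemma coordmx_linE m n i j (N : 'M[R]_(m, n)) : coordmx_lin i j N = N i j.
Proof. by []. Qed.

Lemma coordmx_lin_continuous m n i j : continuous (@coordmx_lin m n i j).
Proof. exact: coord_continuous. Qed.

Lemma Ck_rowP E n k (U : set E) (f : E -> 'rV[R]_n) : open U ->
  Ck k U f <-> forall i, Ck k U (fun x => f x ord0 i).
Proof.
move=> oU; split=> [Cf i|H].
  exact: (Ck_lincomp oU (@coordmx_lin_continuous 1 n ord0 i) Cf).
rewrite (_ : f = fun x => \sum_i f x ord0 i *: delta_mx ord0 i); last first.
  by apply/funext => x; rewrite {1}(row_sum_delta (f x)).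
by apply: Ck_sum => // i _; exact: Ck_scalel.
Qed.

Lemma Ck_pair E W W' k (U : set E) (f : E -> W) (g : E -> W') : open U ->
  Ck k U f -> Ck k U g -> Ck k U (fun x => (f x, g x)).
Proof.
move=> oU; elim: k f g => [|k IH] f g /=.
  by move=> cf cg x Ux; apply: cvg_pair; [exact: cf|exact: cg].
move=> [df Df] [dg Dg]; split=> [x Ux|v].
  by apply: differentiable_pair; [exact: df|exact: dg].
apply: Ck_congr (IH _ _ (Df v) (Dg v)) => // x Ux.
by rewrite diff_pair//; [exact: df|exact: dg].
Qed.

(** A finite generating family with continuous coordinate forms: the data needed to expand a varying
    direction along fixed vectors. *)
Definition finite_dim E := exists (I : finType) (e : I -> E)
  (lam : I -> {linear E -> R}),
  (forall i, continuous (lam i)) /\ forall w, w = \sum_i lam i w *: e i.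

Lemma finite_dimR : finite_dim R.
Proof.
exists unit, (fun=> 1), (fun=> idfun); split=> [_ x|w]; first exact: cvg_id.
by rewrite (big_pred1 tt)/= ?[_ *: _]mulr1// => -[].
Qed.

Lemma finite_dim_row n : finite_dim 'rV[R]_n.
Proof.
exists 'I_n, (fun i => delta_mx ord0 i), (fun i => coordmx_lin ord0 i).
split=> [i|w]; first exact: coordmx_lin_continuous.
exact: row_sum_delta.
Qed.

Lemma finite_dim_pair E W : finite_dim E -> finite_dim W ->
  finite_dim (E * W)%type.
Proof.
move=> [I [e [l [cl le]]]] [J [f [m [cm mf]]]].
exists (I + J)%type, (fun i => match i with inl i => (e i, 0) | inr j => (0, f j) end),
  (fun i => match i return {linear (E * W)%type -> R} with
    | inl i => (l i \o fst)%FUN | inr j => (m j \o snd)%FUN end).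
split=> [[i|j] x|[x y]].
- by apply: continuous_comp; [exact: cvg_fst|exact: cl].
- by apply: continuous_comp; [exact: cvg_snd|exact: cm].
rewrite big_sumType/=; apply/pair_equal_spec; split.
  rewrite !raddf_sum/= [X in _ + X]big1 ?addr0 => [|j _]; last by rewrite scaler0.
  exact: le.
rewrite !raddf_sum/= [X in X + _]big1 ?add0r => [|j _]; last by rewrite scaler0.
exact: mf.
Qed.

(** The chain rule differentiates [F] in the direction ['d G x v], which depends on [x], while [Ck]
    speaks of fixed directions only. Expanding it along the generating family turns the derivative
    into a sum of products to which the induction hypothesis applies. *)
Lemma Ck_comp_real E E1 k (U : set E) (V : set E1) (G : E -> E1) (F : E1 -> R) :
  finite_dim E1 -> open U -> (forall x, U x -> V (G x)) ->
  Ck k U G -> Ck k V F -> Ck k U (fun x => F (G x)).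
Proof.
move=> [I [e [l [cl le]]]] oU UV; elim: k F => [|k IH] F.
  by move=> /= cG cF x Ux; apply: continuous_comp; [exact: cG|exact: cF (UV _ Ux)].
move=> CG; have /CkSP[dG DG] := CG => /CkSP[dF DF].
apply/CkSP; split=> [x Ux|v].
  by apply: (@differentiable_comp _ _ _ _ G F); [exact: dG|exact: dF (UV _ Ux)].
have H : Ck k U (fun x => \sum_i l i ('d G x v) * 'd F (G x) (e i)).
  apply: Ck_sum => [|i _]; first exact: oU.
  apply: (CkM oU).
    by apply: (Ck_lincomp oU (cl i)); exact: DG.
  by apply: (IH (fun y => 'd F y (e i))); [exact: CkW|exact: DF].
apply: Ck_congr H => // x Ux.
rewrite -[fun x => F (G x)]/(F \o G) (diff_comp (dG _ Ux) (dF _ (UV _ Ux))).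
rewrite /= {2}(le ('d G x v)) linear_sum; apply: eq_bigr => i _.
by rewrite linearZ.
Qed.

Lemma Ck_comp E E1 n k (U : set E) (V : set E1) (G : E -> E1) (F : E1 -> 'rV[R]_n) :
  finite_dim E1 -> open U -> open V -> (forall x, U x -> V (G x)) ->
  Ck k U G -> Ck k V F -> Ck k U (fun x => F (G x)).
Proof.
move=> fE oU oV UV CG /(Ck_rowP _ _ oV) CF; apply/(Ck_rowP _ _ oU) => i.
exact: (@Ck_comp_real _ _ k U V G (fun y => F y ord0 i) fE oU UV CG (CF i)).
Qed.

Lemma CkV E k (U : set E) (f : E -> R) : open U -> (forall x, U x -> f x != 0) ->
  Ck k U f -> Ck k U (fun x => (f x)^-1).
Proof.
move=> oU f0; elim: k => [|k IH].
  by move=> /= cf x Ux; apply: continuousV; [exact: f0|exact: cf].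
move=> Cf; have /CkSP[df Df] := Cf; apply/CkSP; split=> [x Ux|v].
  by apply: differentiableV; [exact: df|exact: f0].
have H : Ck k U (fun x => (f x)^-1 * (f x)^-1 * (-1 * 'd f x v)).
  have C1 := IH (CkW Cf).
  apply: (CkM oU); first exact: CkM.
  by apply: (CkM oU); [exact: Ck_cst|exact: Df].
apply: Ck_congr H => // x Ux.
rewrite -[fun x => (f x)^-1]/(GRing.inv \o f) diffV; [|exact: df|exact: f0].
by rewrite /= -[RHS]/((- (f x) ^- 2) * 'd f x v) expr2 invfM; ring.
Qed.

End Ck_theory.

Section smooth_on_theory.
Context {R : realType}.
Implicit Types E W : normedModType R.

Lemma smooth_on_congr E W (U : set E) (f g : E -> W) : open U ->
  (forall x, U x -> f x = g x) -> smooth_on U f -> smooth_on U g.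
Proof. by move=> oU fg sf k; exact: Ck_congr fg (sf k). Qed.

Lemma smooth_on_sub E W (U V : set E) (f : E -> W) :
  V `<=` U -> smooth_on U f -> smooth_on V f.
Proof. by move=> VU sf k; exact: Ck_sub VU (sf k). Qed.

Lemma smooth_on_local E W (U : set E) (f : E -> W) :
  (forall x, U x -> exists V, V x /\ smooth_on V f) -> smooth_on U f.
Proof.
by move=> H k; apply: Ck_local => x /H[V [Vx sf]]; exists V.
Qed.

Lemma smooth_on_diff E W (U : set E) (f : E -> W) x :
  smooth_on U f -> U x -> differentiable f x.
Proof. by move=> /(_ 1%N) /CkSP[df _] /df. Qed.

Lemma smooth_on_cont E W (U : set E) (f : E -> W) x :
  smooth_on U f -> U x -> {for x, continuous f}.
Proof. by move=> /(_ 0%N) /(_ x) h /h. Qed.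

Lemma smooth_on_dd E W (U : set E) (f : E -> W) v :
  smooth_on U f -> smooth_on U (fun x => 'd f x v).
Proof. by move=> sf k; have /CkSP[_] := sf k.+1; exact. Qed.

Lemma smooth_on_cst E W (U : set E) (a : W) : smooth_on U (fun=> a).
Proof. by move=> k; exact: Ck_cst. Qed.

Lemma smooth_on_id E (U : set E) : smooth_on U (fun x => x).
Proof. by move=> k; exact: Ck_id. Qed.

Lemma smooth_on_fst E W (U : set (E * W)) : smooth_on U (fun z => z.1).
Proof. by move=> k; apply: (@Ck_linear _ _ _ k U (@fst E W : {linear _ -> _})) => x; exact: cvg_fst. Qed.

Lemma smooth_on_snd E W (U : set (E * W)) : smooth_on U (fun z => z.2).
Proof. by move=> k; apply: (@Ck_linear _ _ _ k U (@snd E W : {linear _ -> _})) => x; exact: cvg_snd. Qed.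

Lemma smooth_onD E W (U : set E) (f g : E -> W) : open U ->
  smooth_on U f -> smooth_on U g -> smooth_on U (fun x => f x + g x).
Proof. by move=> oU sf sg k; exact: CkD. Qed.

Lemma smooth_onM E (U : set E) (f g : E -> R) : open U ->
  smooth_on U f -> smooth_on U g -> smooth_on U (fun x => f x * g x).
Proof. by move=> oU sf sg k; exact: CkM. Qed.

Lemma smooth_onV E (U : set E) (f : E -> R) : open U ->
  (forall x, U x -> f x != 0) ->
  smooth_on U f -> smooth_on U (fun x => (f x)^-1).
Proof. by move=> oU f0 sf k; exact: CkV. Qed.

Lemma smooth_on_sum E W (U : set E) (I : Type) (s : seq I) (P : pred I)
    (f : I -> E -> W) : open U -> (forall i, P i -> smooth_on U (f i)) ->
  smooth_on U (fun x => \sum_(i <- s | P i) f i x).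
Proof. by move=> oU sf k; apply: Ck_sum => // i /sf; exact. Qed.

Lemma smooth_on_rowP E n (U : set E) (f : E -> 'rV[R]_n) : open U ->
  smooth_on U f <-> forall i, smooth_on U (fun x => f x ord0 i).
Proof.
move=> oU; split=> [sf i k|sf k].
  exact: ((Ck_rowP k f oU).1 (sf k)).
by apply/(Ck_rowP k f oU) => i; exact: sf.
Qed.

Lemma smooth_on_pair E W W' (U : set E) (f : E -> W) (g : E -> W') : open U ->
  smooth_on U f -> smooth_on U g -> smooth_on U (fun x => (f x, g x)).
Proof. by move=> oU sf sg k; exact: Ck_pair. Qed.

Lemma smooth_on_comp_real E E1 (U : set E) (V : set E1) (G : E -> E1)
    (F : E1 -> R) :
  finite_dim E1 -> open U -> (forall x, U x -> V (G x)) ->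
  smooth_on U G -> smooth_on V F -> smooth_on U (fun x => F (G x)).
Proof. by move=> fE oU UV sG sF k; exact: Ck_comp_real (sG k) (sF k). Qed.

Lemma smooth_on_comp E E1 n (U : set E) (V : set E1) (G : E -> E1)
    (F : E1 -> 'rV[R]_n) :
  finite_dim E1 -> open U -> open V -> (forall x, U x -> V (G x)) ->
  smooth_on U G -> smooth_on V F -> smooth_on U (fun x => F (G x)).
Proof. by move=> fE oU oV UV sG sF k; exact: Ck_comp (sG k) (sF k). Qed.

End smooth_on_theory.

(** * Smooth maps between manifolds, read in charts *)

Section topology_extra.
Context {S T : topologicalType}.

Lemma open_capl_preimage (U : set S) (c : S -> T) (V : set T) : open U ->
  (forall x, U x -> {for x, continuous c}) -> open V -> open (U `&` c @^-1` V).
Proof.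
move=> oU cc oV; rewrite openE => x [Ux Vx]; apply: filterI.
  exact: (open_nbhs_nbhs (conj oU Ux)).
exact: (cc x Ux V (open_nbhs_nbhs (conj oV Vx))).
Qed.

Lemma openX (A : set S) (B : set T) : open A -> open B -> open (A `*` B).
Proof.
move=> oA oB; rewrite openE => -[x y] [/= Ax By].
by exists (A, B) => //=; split; exact: open_nbhs_nbhs.
Qed.

End topology_extra.

Arguments chart_dom_open {R n M} c.
Arguments chart_cod_open {R n M} c.

Section charts.
Context {R : realType} {n : nat} {M : manifoldType R n}.
Implicit Type phi : chart R n M.

Lemma chart_invK phi y : (phi @` chart_dom phi) y ->
  phi (chart_inv phi y) = y /\ chart_dom phi (chart_inv phi y).
Proof. by move=> [x dx <-]; rewrite chart_mapK. Qed.

Lemma chart_image phi x : chart_dom phi x -> (phi @` chart_dom phi) (phi x).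
Proof. by exists x. Qed.

Lemma chart_image_capE phi (A : set M) :
  phi @` (chart_dom phi `&` A) =
  (phi @` chart_dom phi) `&` (chart_inv phi @^-1` A).
Proof.
apply/seteqP; split=> [_ [x [dx Ax] <-]|_ [[x dx <-] /=]].
  by split; [exact: chart_image|rewrite /= chart_mapK].
by rewrite chart_mapK// => Ax; exists x.
Qed.

Lemma open_chart_image phi (A : set M) : open A ->
  open (phi @` (chart_dom phi `&` A)).
Proof.
move=> oA; rewrite chart_image_capE; apply: open_capl_preimage => //.
- exact: chart_cod_open.
- exact: chart_inv_cts.
Qed.

End charts.

Section smooth_into_theory.
Context {R : realType}.
Implicit Types E : normedModType R.

Lemma smooth_into_congr E n (N : manifoldType R n) (U : set E) (c d : E -> N) :
  open U -> (forall x, U x -> c x = d x) -> smooth_into U c -> smooth_into U d.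
Proof.
move=> oU cd [cc sc]; split=> [x Ux|psi apsi].
  apply: near_for_continuous (cc x Ux).
  by apply: filterS (open_nbhs_nbhs (conj oU Ux)).
have Ed : U `&` d @^-1` chart_dom psi = U `&` c @^-1` chart_dom psi.
  by apply/seteqP; split=> x [Ux] /=; rewrite cd.
rewrite Ed; apply: smooth_on_congr (sc _ apsi).
  exact: open_capl_preimage (chart_dom_open psi).
by move=> x [Ux _]; rewrite cd.
Qed.

Lemma smooth_into_sub E n (N : manifoldType R n) (U V : set E) (c : E -> N) :
  V `<=` U -> smooth_into U c -> smooth_into V c.
Proof.
move=> VU [cc sc]; split=> [x /VU/cc//|psi apsi].
by apply: smooth_on_sub (sc _ apsi) => x [/VU].
Qed.

Lemma smooth_into_local E n (N : manifoldType R n) (U : set E) (c : E -> N) :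
  (forall x, U x -> exists V, V x /\ smooth_into V c) -> smooth_into U c.
Proof.
move=> H; split=> [x /H[V [Vx [+ _]]]|psi apsi]; first exact.
apply: smooth_on_local => x [/H[V [Vx [_ sc]]] dx].
by exists (V `&` c @^-1` chart_dom psi); split=> //; exact: sc.
Qed.

Lemma smooth_into_cst E n (N : manifoldType R n) (U : set E) (a : N) :
  smooth_into U (fun=> a).
Proof.
by split=> [x _|psi _]; [exact: cst_continuous|exact: smooth_on_cst].
Qed.

Lemma smooth_into_open E n (N : manifoldType R n) (U : set E) (c : E -> N)
  (V : set N) : open U -> smooth_into U c -> open V -> open (U `&` c @^-1` V).
Proof. by move=> oU [cc _]; exact: open_capl_preimage. Qed.

Lemma smooth_into_chart E n (N : manifoldType R n) (psi : chart R n N)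
    (U : set E) (c : E -> N) : smooth_into U c -> atlas psi ->
  (forall x, U x -> chart_dom psi (c x)) -> smooth_on U (fun x => psi (c x)).
Proof.
move=> [_ sc] apsi Uc; apply: smooth_on_sub (sc _ apsi) => x Ux.
by split=> //=; exact: Uc.
Qed.

Lemma smooth_into_comp E E1 n (N : manifoldType R n) (U : set E) (V : set E1)
    (G : E -> E1) (h : E1 -> N) : finite_dim E1 -> smooth_into V h ->
  smooth_on U G -> (forall x, U x -> V (G x)) -> open U -> open V ->
  smooth_into U (fun x => h (G x)).
Proof.
move=> fE sh sG UV oU oV; split=> [x Ux|psi apsi].
  apply: continuous_comp; first exact: smooth_on_cont Ux.
  exact: sh.1 (UV _ Ux).
have oVh := smooth_into_open oV sh (chart_dom_open psi).
have sG' : smooth_on (U `&` (fun x => h (G x)) @^-1` chart_dom psi) G.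
  by apply: smooth_on_sub sG => x [].
apply: (smooth_on_comp fE _ oVh _ sG' (sh.2 _ apsi)).
  have -> : U `&` (fun x => h (G x)) @^-1` chart_dom psi =
     U `&` G @^-1` (V `&` h @^-1` chart_dom psi).
    apply/seteqP; split=> x [Ux] /=; last by case.
    by split=> //; split=> //; exact: UV.
  by apply: open_capl_preimage => // x; exact: smooth_on_cont.
by move=> x [Ux dx]; split=> //; exact: UV.
Qed.

Lemma smooth_into_chart_inv n (N : manifoldType R n) (psi : chart R n N) :
  atlas psi -> smooth_into (psi @` chart_dom psi) (chart_inv psi).
Proof.
move=> apsi; split=> [y|psi' apsi']; first exact: chart_inv_cts.
by rewrite -chart_image_capE; exact: atlas_compat.
Qed.

Lemma smooth_into_inv E n (N : manifoldType R n) (psi : chart R n N) (U : set E)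
    (g : E -> 'rV[R]_n) : open U -> atlas psi -> smooth_on U g ->
  (forall x, U x -> (psi @` chart_dom psi) (g x)) ->
  smooth_into U (fun x => chart_inv psi (g x)).
Proof.
move=> oU apsi sg Ug.
exact: smooth_into_comp (finite_dim_row n) (smooth_into_chart_inv apsi) sg Ug oU
  (chart_cod_open psi).
Qed.

(** Locally [c] equals [chart_inv phi] applied to [phi (c x)], which factors [F (c x)] through a
    smooth map of normed spaces and the local expression of [F], whose smoothness is the definition.
    The variants below follow the same pattern. *)
Lemma smooth_map_on_comp E m n (M : manifoldType R m) (N : manifoldType R n)
    (U : set E) (A : set M) (c : E -> M) (F : M -> N) : smooth_into U c -> smooth_map_on A F ->
  (forall x, U x -> A (c x)) -> open U -> open A ->
  smooth_into U (fun x => F (c x)).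
Proof.
move=> sc sF UA oU oA; apply: smooth_into_local => x Ux.
have [phi aphi dx] := atlas_cover (c x).
pose V := U `&` c @^-1` chart_dom phi.
have oV : open V by exact: smooth_into_open sc (chart_dom_open phi).
exists V; split=> //.
have sc' : smooth_on V (fun x => phi (c x)) := sc.2 _ aphi.
apply: (@smooth_into_congr _ _ _ _ (fun x => F (chart_inv phi (phi (c x))))) => //.
  by move=> y [_ dy]; rewrite chart_mapK.
apply: (smooth_into_comp (finite_dim_row m) (sF _ aphi) sc' _ oV (open_chart_image oA)).
by move=> y [Uy dy]; exists (c y) => //; split=> //; exact: UA.
Qed.

Lemma smooth_map_comp E m n (M : manifoldType R m) (N : manifoldType R n)
    (U : set E) (c : E -> M) (F : M -> N) :
  smooth_into U c -> smooth_map F -> open U -> smooth_into U (fun x => F (c x)).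
Proof. by move=> sc sF oU; exact: smooth_map_on_comp sc sF _ oU openT. Qed.

Lemma smooth_fun_comp E n (N : manifoldType R n) (U : set E) (c : E -> N)
    (f : N -> R) : smooth_into U c -> smooth_fun f -> open U ->
  smooth_on U (fun x => f (c x)).
Proof.
move=> sc sf oU; apply: smooth_on_local => x Ux.
have [phi aphi dx] := atlas_cover (c x).
pose V := U `&` c @^-1` chart_dom phi.
have oV : open V by exact: smooth_into_open sc (chart_dom_open phi).
exists V; split=> //.
have sc' : smooth_on V (fun x => phi (c x)) := sc.2 _ aphi.
apply: (@smooth_on_congr _ _ _ _ (fun x => f (chart_inv phi (phi (c x))))) => //.
  by move=> y [_ dy]; rewrite chart_mapK.
apply: (smooth_on_comp_real (finite_dim_row n) oV _ sc' (sf _ aphi)).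
by move=> y [Uy dy]; exact: chart_image.
Qed.

Lemma smooth_map2_on_comp E m1 m2 n (M1 : manifoldType R m1)
    (M2 : manifoldType R m2) (N : manifoldType R n) (U : set E)
    (A : set (M1 * M2)) (F : M1 -> M2 -> N) (c1 : E -> M1) (c2 : E -> M2) :
  smooth_into U c1 -> smooth_into U c2 -> smooth_map2_on A F ->
  (forall x, U x -> A (c1 x, c2 x)) -> open U -> open A ->
  smooth_into U (fun x => F (c1 x) (c2 x)).
Proof.
move=> s1 s2 sF UA oU oA; apply: smooth_into_local => x Ux.
have [phi aphi dx] := atlas_cover (c1 x).
have [psi apsi ex] := atlas_cover (c2 x).
pose V := U `&` (fun x => (c1 x, c2 x)) @^-1` (chart_dom phi `*` chart_dom psi).
have oV : open V.
  apply: open_capl_preimage => //.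
    by move=> y Uy; apply: cvg_pair; [exact: s1.1|exact: s2.1].
  by apply: openX; exact: chart_dom_open.
exists V; split=> //.
have s1' : smooth_on V (fun x => phi (c1 x)).
  by apply: smooth_on_sub (s1.2 _ aphi) => y [Uy [] ].
have s2' : smooth_on V (fun x => psi (c2 x)).
  by apply: smooth_on_sub (s2.2 _ apsi) => y [Uy [] ].
apply: (@smooth_into_congr _ _ _ _ (fun x =>
    F (chart_inv phi (phi (c1 x))) (chart_inv psi (psi (c2 x))))) => //.
  by move=> y [_ [/= dy ey]]; rewrite !chart_mapK.
have := smooth_into_comp (finite_dim_pair (finite_dim_row m1) (finite_dim_row m2))
  (sF _ _ aphi apsi) (smooth_on_pair oV s1' s2') _ oV _.
apply=> [y [Uy [/= dy ey]]|].
  by exists (c1 y, c2 y) => //; split=> //; exact: UA.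
  rewrite (_ : _ @` _ = (phi @` chart_dom phi `*` psi @` chart_dom psi) `&`
     (fun z => (chart_inv phi z.1, chart_inv psi z.2)) @^-1` A).
    apply: open_capl_preimage => //.
      by apply: openX; exact: chart_cod_open.
    move=> [y z] [/= dy dz]; apply: cvg_pair.
      by apply: continuous_comp; [exact: cvg_fst|exact: chart_inv_cts].
    by apply: continuous_comp; [exact: cvg_snd|exact: chart_inv_cts].
  apply/seteqP; split=> [_ [[y z] [[/= dy dz] Ayz] <-]|].
    by split=> /=; [split; exact: chart_image|rewrite !chart_mapK].
  move=> [_ _] [[/= [y dy <-] [z dz <-]]]; rewrite !chart_mapK// => Ayz.
  by exists (y, z).
Qed.

Lemma smooth_map2_comp E m1 m2 n (M1 : manifoldType R m1)
    (M2 : manifoldType R m2) (N : manifoldType R n) (U : set E)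
    (F : M1 -> M2 -> N) (c1 : E -> M1) (c2 : E -> M2) :
  smooth_into U c1 -> smooth_into U c2 -> smooth_map2_on [set: M1 * M2] F ->
  open U -> smooth_into U (fun x => F (c1 x) (c2 x)).
Proof. by move=> s1 s2 sF oU; exact: smooth_map2_on_comp s1 s2 sF _ oU openT. Qed.

Lemma smooth_mapI m n (M : manifoldType R m) (N : manifoldType R n)
    (F : M -> N) :
  (forall phi : chart R m M, atlas phi ->
     smooth_into (phi @` chart_dom phi) (fun y => F (chart_inv phi y))) ->
  smooth_map F.
Proof. by move=> H phi aphi; rewrite setIT; exact: H. Qed.

Lemma smooth_mapE m n (M : manifoldType R m) (N : manifoldType R n)
    (F : M -> N) phi : smooth_map F -> atlas phi ->
  smooth_into (phi @` chart_dom phi) (fun y => F (chart_inv phi y)).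
Proof. by move=> sF /sF; rewrite setIT. Qed.

Lemma smooth_map_compose m n p (M : manifoldType R m) (N : manifoldType R n)
    (P : manifoldType R p) (F : M -> N) (H : N -> P) :
  smooth_map F -> smooth_map H -> smooth_map (fun x => H (F x)).
Proof.
move=> sF sH; apply: smooth_mapI => phi aphi.
exact: smooth_map_comp (smooth_mapE sF aphi) sH (chart_cod_open phi).
Qed.

Lemma smooth_fun_compose m n (M : manifoldType R m) (N : manifoldType R n)
    (F : M -> N) (f : N -> R) :
  smooth_map F -> smooth_fun f -> smooth_fun (f \o F).
Proof.
move=> sF sf phi aphi.
exact: smooth_fun_comp (smooth_mapE sF aphi) sf (chart_cod_open phi).
Qed.

Lemma smooth_map_id m (M : manifoldType R m) : smooth_map (fun x : M => x).
Proof. by apply: smooth_mapI; exact: smooth_into_chart_inv. Qed.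

Lemma smooth_map_cst m n (M : manifoldType R m) (N : manifoldType R n) (a : N) :
  smooth_map (fun _ : M => a).
Proof. by apply: smooth_mapI => phi _; exact: smooth_into_cst. Qed.

Lemma smooth_map2_compose l m1 m2 n (L : manifoldType R l)
    (M1 : manifoldType R m1) (M2 : manifoldType R m2) (N : manifoldType R n)
    (F : M1 -> M2 -> N) (g : L -> M1) (h : L -> M2) :
  smooth_map g -> smooth_map h -> smooth_map2_on [set: M1 * M2] F ->
  smooth_map (fun x => F (g x) (h x)).
Proof.
move=> sg sh sF; apply: smooth_mapI => phi aphi.
exact: smooth_map2_comp (smooth_mapE sg aphi) (smooth_mapE sh aphi) sF
  (chart_cod_open phi).
Qed.

Lemma smooth_fun_cst m (M : manifoldType R m) (a : R) : smooth_fun (fun _ : M => a).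
Proof. by move=> phi _; exact: smooth_on_cst. Qed.

Lemma smooth_funD m (M : manifoldType R m) (f h : M -> R) :
  smooth_fun f -> smooth_fun h -> smooth_fun (fun x => f x + h x).
Proof.
move=> sf sh phi aphi.
by apply: smooth_onD; [exact: chart_cod_open|exact: sf|exact: sh].
Qed.

Lemma smooth_funM m (M : manifoldType R m) (f h : M -> R) :
  smooth_fun f -> smooth_fun h -> smooth_fun (fun x => f x * h x).
Proof.
move=> sf sh phi aphi.
by apply: smooth_onM; [exact: chart_cod_open|exact: sf|exact: sh].
Qed.

Lemma smooth_fun_sum m (M : manifoldType R m) (I : Type) (s : seq I)
  (P : pred I) (f : I -> M -> R) : (forall i, P i -> smooth_fun (f i)) ->
  smooth_fun (fun x => \sum_(i <- s | P i) f i x).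
Proof.
move=> sf phi aphi; apply: smooth_on_sum; first exact: chart_cod_open.
by move=> i Pi; exact: sf.
Qed.

End smooth_into_theory.

(** * Bump functions *)

Section bump.
Context {R : realType}.
Implicit Types (p : {poly R}) (x y : R).

(* These functions are stable under differentiation, see [is_derive_flat_exp]. *)
Definition flat_exp p x : R := if 0 < x then p.[x^-1] * expR (- x^-1) else 0.

Lemma horner_bound p y : 1 <= y ->
  `|p.[y]| <= (\sum_(i < size p) `|p`_i|) * y ^+ (size p).
Proof.
move=> y1; rewrite horner_coef (le_trans (ler_norm_sum _ _ _))//.
rewrite mulr_suml; apply: ler_sum => i _; rewrite normrM ler_wpM2l//.
rewrite normrX ger0_norm; last by rewrite (le_trans ler01).
by rewrite ler_weXn2l// ltnW.
Qed.

(** With y = 1/x and d the size of [p], the exponential series gives y^(d+2) / (d+2)! <= exp y. This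
    absorbs the growth of [p] at y and leaves the factor y^-2 = x^2, enough for a zero derivative at
    0. The summand 1 in the constant keeps it positive for [p = 0]. *)
Lemma flat_exp_bound p :
  exists2 C, 0 < C & forall x, x <= 1 -> `|flat_exp p x| <= C * x ^+ 2.
Proof.
pose d := size p; pose A := \sum_(i < d) `|p`_i|.
have A0 : 0 <= A by apply: sumr_ge0 => i _.
exists (A * (d.+2)`!%:R + 1).
  by rewrite ltr_wpDl// mulr_ge0.
move=> x x1; rewrite /flat_exp; case: ifPn => [x0|_]; last first.
  rewrite normr0 mulr_ge0 ?sqr_ge0// addr_ge0// mulr_ge0//.
set y := x^-1; have y0 : 0 < y by rewrite invr_gt0.
have y1 : 1 <= y by rewrite /y -[leLHS]invr1 lef_pV2// posrE.
have xy : x = y^-1 by rewrite invrK.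
rewrite normrM (ger0_norm (expR_ge0 _)) expRN.
have ey : y ^+ d.+2 / (d.+2)`!%:R <= expR y.
  by apply: le_trans (expR_ge1Dxn d.+1 (ltW y0)); rewrite lerDr.
have f0 : 0 < (d.+2)`!%:R :> R by rewrite ltr0n fact_gt0.
have yd0 : 0 < y ^+ d.+2 by rewrite exprn_gt0.
have E1 : (expR y)^-1 <= (d.+2)`!%:R / y ^+ d.+2.
  rewrite -[leRHS]invrK invf_div lef_pV2// posrE ?expR_gt0//.
  by rewrite divr_gt0.
apply: (@le_trans _ _ (A * y ^+ d * ((d.+2)`!%:R / y ^+ d.+2))).
  by apply: ler_pM => //; exact: horner_bound.
have -> : x ^+ 2 = (y ^+ 2)^-1 by rewrite xy exprVn.
have -> : A * y ^+ d * ((d.+2)`!%:R / y ^+ d.+2) = A * (d.+2)`!%:R / y ^+ 2.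
  rewrite -[d.+2]addn2 exprD; field.
  by rewrite !expf_neq0 ?gt_eqF.
apply: ler_wpM2r; first by rewrite invr_ge0 exprn_ge0// ltW.
by rewrite lerDl.
Qed.

Lemma is_diff_derive1 (W : normedModType R) (f : R -> W) x (df : R -> W) :
  is_diff x f df -> is_derive x (1 : R) f (df 1).
Proof.
move=> [fx <-]; apply: DeriveDef; first exact: diff_derivable.
exact: deriveE.
Qed.

(** For y = 1/x the derivation in x is -y^2 times the derivation in y, and the latter sends p(y)
    exp(-y) to (p'(y) - p(y)) exp(-y), whence the polynomial X^2 (p - p'). At 0 the quadratic bound
    applies. *)
Lemma is_derive_flat_exp p x :
  is_derive x 1 (flat_exp p) (flat_exp ('X^2 * (p - p^`())) x).
Proof.
have [x0|x0|->] := ltgtP x 0.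
- rewrite {2}/flat_exp ltNge (ltW x0)/=.
  apply: (near_eq_is_derive _ (is_derive_cst (0 : R) x 1)).
  near=> z; rewrite /flat_exp ltNge ifF//; apply/negbTE; rewrite negbK.
  by near: z; apply: filterS (lt_nbhsl x0) => z /ltW.
- have nE : \forall z \near x, p.[z^-1] * expR (- z^-1) = flat_exp p z.
    near=> z; rewrite /flat_exp ifT//.
    by near: z; exact: lt_nbhsr.
  apply: (near_eq_is_derive nE).
  rewrite /flat_exp x0.
  have xn0 : x != 0 by rewrite gt_eqF.
  have dV : is_derive x 1 (fun z : R => z^-1) (- x ^- 2).
    by have := @is_deriveV R (fun z : R => z) x 1 1 xn0 (is_derive_id x 1);
      rewrite /GRing.scale/= mulr1.
  have d1 : is_derive x 1 (fun z : R => p.[z^-1]) (p^`().[x^-1] * (- x ^- 2)).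
    have := @is_derive1_comp _ (horner p) (fun z : R => z^-1) x _ _ _ dV.
    apply; exact: is_derive_poly.
  have dN : is_derive x 1 (fun z : R => - z^-1) (x ^- 2).
    by have := is_deriveN dV; rewrite opprK.
  have d2 : is_derive x 1 (fun z : R => expR (- z^-1)) (expR (- x^-1) * x ^- 2).
    exact: (@is_derive1_comp _ expR (fun z : R => - z^-1) x _ _ _ dN).
  apply: is_derive_eq (is_deriveM d1 d2) _.
  rewrite -![_ *: _]/(_ * _) hornerM hornerXn hornerD hornerN exprVn.
  by move: (p.[_]) (p^`().[_]) (expR _) (x ^- 2) => A B C D; ring.
- rewrite {2}/flat_exp ltxx.
  have [C C0 HC] := flat_exp_bound p.
  have : is_diff (0:R) (flat_exp p) (\0 : {linear R -> R}).
    apply/is_diff_epsP; first by move=> ?; exact: cst_continuous.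
    move=> e e0; near=> h; rewrite addr0 {2}/flat_exp ltxx /= !subr0.
    apply: le_trans (HC h _) _.
      by near: h; apply: filterS (lt_nbhsl ltr01) => z /ltW.
    rewrite -(real_normK (num_real h)) expr2 mulrA ler_wpM2r// mulrC -ler_pdivlMr//.
    near: h; have eC : 0 < e / C by rewrite divr_gt0.
    by exists (e / C) => // z /=; rewrite sub0r normrN => /ltW.
  exact: is_diff_derive1.
Unshelve. all: by end_near. Qed.

Lemma is_derive_diffR (f : R -> R) x l : is_derive x 1 f l ->
  differentiable f x /\ forall v, 'd f x v = v * l.
Proof.
move=> [dx dl]; have df : differentiable f x by apply/derivable1_diffP.
by split=> // v; rewrite deriv1E// derive1E dl.
Qed.

Lemma smooth_on_flat_exp p (U : set R) : open U -> smooth_on U (flat_exp p).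
Proof.
move=> oU k; elim: k p => [|k IH] p.
  move=> x _; have [dx _] := is_derive_diffR (is_derive_flat_exp p x).
  exact: differentiable_continuous.
apply/CkSP; split=> [x _|v]; first by have [] := is_derive_diffR (is_derive_flat_exp p x).
rewrite (_ : (fun _ => _) = fun x => v * flat_exp ('X^2 * (p - p^`())) x).
  by apply: CkM => //; exact: Ck_cst.
by apply/funext => x; have [_ ->] := is_derive_diffR (is_derive_flat_exp p x).
Qed.

(** The quotient h(b - x) / (h(b - x) + h(x - a)), where h(x) is exp(-1/x) for x > 0 and 0
    otherwise. Since a < b, one of the two summands of the denominator is always positive. *)
Lemma smooth_step (a b : R) : a < b -> exists s : R -> R,
  [/\ smooth_on setT s, forall x, x <= a -> s x = 1 & forall x, b <= x -> s x = 0].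
Proof.
move=> ab; pose h := flat_exp 1.
have h0 x : x <= 0 -> h x = 0 by move=> x0; rewrite /h /flat_exp ltNge x0.
have hp x : 0 < x -> 0 < h x.
  by move=> x0; rewrite /h /flat_exp x0 hornerE mul1r expR_gt0.
have hge x : 0 <= h x by case: (leP x 0) => [/h0 ->//|/hp/ltW].
have den x : 0 < h (b - x) + h (x - a).
  have [xb|bx] := ltP x b.
    by rewrite ltr_pwDl// hp// subr_gt0.
  by rewrite ltr_wpDl// hp// subr_gt0 (lt_le_trans ab).
have sh : smooth_on setT h by apply: smooth_on_flat_exp; exact: openT.
have s1 : smooth_on setT (fun x => h (b - x)).
  apply: (@smooth_on_comp_real _ _ _ setT setT (fun x => b - x)) => //.
  - exact: finite_dimR.
  - exact: openT.
  - apply: smooth_onD; [exact: openT|exact: smooth_on_cst|] => k.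
    rewrite (_ : -%R = (fun x : R => (-1) * x)); last by apply/funext => x; rewrite mulN1r.
    by apply: CkM; [exact: openT|exact: Ck_cst|exact: Ck_id].
have s2 : smooth_on setT (fun x => h (x - a)).
  apply: (@smooth_on_comp_real _ _ _ setT setT (fun x => x - a)) => //.
  - exact: finite_dimR.
  - exact: openT.
  - by apply: smooth_onD; [exact: openT|exact: smooth_on_id|exact: smooth_on_cst].
exists (fun x => h (b - x) * (h (b - x) + h (x - a))^-1); split.
- apply: smooth_onM => //; first exact: openT.
  apply: smooth_onV => //; first exact: openT.
  + by move=> x _; rewrite gt_eqF.
  + by apply: smooth_onD => //; exact: openT.
- move=> x xa; have := den x; rewrite (h0 (x - a)) ?subr_le0// addr0 => bx.
  by rewrite divff// gt_eqF.
- by move=> x xb; rewrite (h0 (b - x)) ?subr_le0// mul0r.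
Qed.

Lemma row_norm_leP n (v : 'rV[R]_n) (c : R) : 0 <= c ->
  (`|v| <= c) <-> (forall i, `|v ord0 i| <= c).
Proof.
move=> c0; have -> : `|v| = mx_norm v by []. 
rewrite mx_normrE; split=> [H i|H].
  by apply: le_trans H; exact: (le_bigmax _ (fun ij => `|v ij.1 ij.2|) (ord0, i)).
apply: bigmax_le => // -[i j] _ /=; rewrite (ord1 i); exact: H.
Qed.

Lemma row_norm_ge n (v : 'rV[R]_n) i : `|v ord0 i| <= `|v|.
Proof. exact: (row_norm_leP v (normr_ge0 v)).1. Qed.

Lemma smooth_on_coord n (U : set 'rV[R]_n) i :
  smooth_on U (fun x : 'rV[R]_n => x ord0 i).
Proof. by move=> k; exact: (Ck_linear k U (@coordmx_lin_continuous R 1 n ord0 i)). Qed.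

(** A smooth step applied to the squared Euclidean distance [q], which is smooth, unlike the sup
    norm of row vectors. The sup norm is at most the Euclidean one, so [q] is at least r^2 outside
    the sup-norm ball, and [q] is below r^2 / 2 near [a]. *)
Lemma smooth_bump n (a : 'rV[R]_n) (r : R) : 0 < r -> exists B : 'rV[R]_n -> R,
  [/\ smooth_on setT B, \forall x \near a, B x = 1 &
      forall x : 'rV[R]_n, r <= `|x - a| -> B x = 0].
Proof.
move=> r0; have rr : r ^+ 2 / 2 < r ^+ 2.
  by rewrite ltr_pdivrMr// ltr_pMr ?exprn_gt0// ltr1n.
have [s [ss s1 s0]] := smooth_step rr.
pose q (x : 'rV[R]_n) := \sum_i (x ord0 i - a ord0 i) * (x ord0 i - a ord0 i).
have sq : smooth_on setT q.
  apply: smooth_on_sum; first exact: openT.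
  have C i : smooth_on setT (fun x : 'rV[R]_n => x ord0 i - a ord0 i).
    by apply: smooth_onD; [exact: openT|exact: smooth_on_coord|exact: smooth_on_cst].
  by move=> i _; apply: smooth_onM => //; exact: openT.
exists (fun z => s (q z)); split.
- by apply: (@smooth_on_comp_real _ _ _ setT setT q) => //; [exact: finite_dimR|exact: openT].
- have qa : q a = 0 by rewrite /q big1// => i _; rewrite subrr mul0r.
  have r2 : q a < r ^+ 2 / 2 by rewrite qa divr_gt0// exprn_gt0.
  have cq : {for a, continuous q} by exact: smooth_on_cont sq _.
  have nq : \forall z \near a, q z < r ^+ 2 / 2 by exact: (cq _ (lt_nbhsl r2)).
  by apply: filterS nq => z /ltW; exact: s1.
- move=> x rx; apply: s0.
  have [//|qr] := leP (r ^+ 2) (q x).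
  have : `|x - a| < r; last by rewrite ltNge rx.
  have q0 : 0 <= q x by apply: sumr_ge0 => i _; rewrite -expr2 sqr_ge0.
  have : `|x - a| <= Num.sqrt (q x).
    apply/row_norm_leP; first exact: sqrtr_ge0.
    move=> i; rewrite !mxE -sqrtr_sqr ler_wsqrtr// /q (bigD1 i)//= -expr2 lerDl.
    by apply: sumr_ge0 => j _; rewrite -expr2 sqr_ge0.
  move=> H; apply: (le_lt_trans H).
  by rewrite -[ltRHS](ger0_norm (ltW r0)) -sqrtr_sqr ltr_sqrt// exprn_gt0.
Qed.

End bump.

(** * Parametric integrals and Hadamard's lemma *)

Section integral01.
Context {R : realType}.
Let mu := @lebesgue_measure R.

Definition I01 (f : R -> R) : R := \int[mu]_(s in `[0, 1]) f s.

(** Continuity is two-sided at 0 and 1 as well, the form in which smoothness on an open set provides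
    it. *)
Definition cont01 (f : R -> R) := forall s : R, 0 <= s <= 1 -> {for s, continuous f}.

Lemma cont01_within f : cont01 f -> {within `[0, 1], continuous f}.
Proof.
move=> cf; apply: continuous_in_subspaceT => s.
by rewrite inE /= in_itv/= => /cf.
Qed.

Lemma I01_integrable f : cont01 f -> mu.-integrable `[0, 1] (EFin \o f).
Proof.
move=> cf; apply: continuous_compact_integrable; first exact: segment_compact.
exact: cont01_within.
Qed.

Lemma I01_cst (c : R) : I01 (fun=> c) = c.
Proof.
have m01 : fine (mu `[0, 1]) = 1.
  by rewrite [mu _]lebesgue_measure_itv/= lte_fin ltr01 oppr0 adde0.
by rewrite /I01 Rintegral_cst// m01 mulr1.
Qed.

Lemma cont01_cst c : cont01 (fun=> c).
Proof. by move=> s _; exact: cst_continuous. Qed.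

Lemma I01_bound f (M : R) : cont01 f -> (forall s : R, 0 <= s <= 1 -> `|f s| <= M) ->
  `|I01 f| <= M.
Proof.
move=> cf fM; apply: le_trans (le_normr_Rintegral _ (I01_integrable cf)) _ => //.
rewrite -[leRHS]I01_cst; apply: le_Rintegral => //.
- apply: (@I01_integrable (fun s => `|f s|)) => s /cf h.
  exact: (@continuous_comp _ _ _ f Num.norm) h (@norm_continuous _ _ _).
- by apply: (@I01_integrable (fun=> M)); exact: cont01_cst.
Qed.

Lemma I01D f g : cont01 f -> cont01 g ->
  I01 (fun s => f s + g s) = I01 f + I01 g.
Proof. by move=> cf cg; apply: RintegralD => //; exact: I01_integrable. Qed.

Lemma I01B f g : cont01 f -> cont01 g ->
  I01 (fun s => f s - g s) = I01 f - I01 g.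
Proof. by move=> cf cg; apply: RintegralB => //; exact: I01_integrable. Qed.

Lemma I01Z f a : cont01 f -> I01 (fun s => a * f s) = a * I01 f.
Proof. by move=> cf; apply: RintegralZl => //; exact: I01_integrable. Qed.

Lemma cont01D f g : cont01 f -> cont01 g -> cont01 (fun s => f s + g s).
Proof. by move=> cf cg s s01; apply: continuousD; [exact: cf|exact: cg]. Qed.

Lemma cont01M f g : cont01 f -> cont01 g -> cont01 (fun s => f s * g s).
Proof. by move=> cf cg s s01; apply: continuousM; [exact: cf|exact: cg]. Qed.

Lemma cont01B f g : cont01 f -> cont01 g -> cont01 (fun s => f s - g s).
Proof. by move=> cf cg s s01; apply: continuousB; [exact: cf|exact: cg]. Qed.

Lemma I01_lincomb (I : Type) (r : seq I) (a : I -> R) (f : I -> R -> R) :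
  (forall i, cont01 (f i)) ->
  cont01 (fun s => \sum_(i <- r) a i * f i s) /\
  I01 (fun s => \sum_(i <- r) a i * f i s) = \sum_(i <- r) a i * I01 (f i).
Proof.
move=> cf; elim: r => [|i r [IH1 IH2]].
  split; last by rewrite big_nil; under eq_fun do rewrite big_nil; exact: I01_cst.
  by under eq_fun do rewrite big_nil; exact: cont01_cst.
have H : cont01 (fun s => a i * f i s) by apply: cont01M => //; exact: cont01_cst.
split; first by under eq_fun do rewrite big_cons; exact: cont01D.
under eq_fun do rewrite big_cons.
by rewrite big_cons I01D// I01Z// IH2.
Qed.

Lemma I01_FTC (F f : R -> R) : cont01 f -> cont01 F ->
  (forall s : R, 0 < s < 1 -> is_derive s 1 F (f s)) -> I01 f = F 1 - F 0.
Proof.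
move=> cf cF dF; rewrite /I01 /Rintegral.
rewrite (@continuous_FTC2 R f F 0 1)//.
- exact: cont01_within.
- split=> [s||].
  + by rewrite in_itv/= => /dF [].
  + by apply: cvg_at_right_filter; apply: cF; rewrite lexx ler01.
  + by apply: cvg_at_left_filter; apply: cF; rewrite lexx ler01.
- by move=> s; rewrite in_itv/= => /dF ds; rewrite derive1E derive_val.
Qed.

End integral01.

Section parametric_integral.
Context {R : realType}.
Implicit Types E : normedModType R.

(** Compactness of [0, 1] makes continuity at the points (s, x0) uniform in s. For s' near s, both
    F(s', x) and F(s', x0) are compared with F(s, x0), hence the e / 2. *)
Lemma tube01 E (F : R * E -> R) (x0 : E) (e : R) :
  (forall s : R, 0 <= s <= 1 -> {for (s, x0), continuous F}) -> 0 < e ->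
  \forall x \near x0, forall s : R, 0 <= s <= 1 -> `|F (s, x) - F (s, x0)| <= e.
Proof.
move=> cF e0.
have /compact_near_coveringP := @segment_compact R 0 1.
move=> /(_ E (nbhs x0) (fun x s => `|F (s, x) - F (s, x0)| <= e) _).
have H (s : R) : `[0, 1]%classic s -> \forall s' \near s & x \near x0,
    `|F (s', x) - F (s', x0)| <= e.
  rewrite /= in_itv/= => /cF /cvgrPdist_lt /(_ (e / 2)).
  rewrite divr_gt0// => /(_ isT) [[A B] [/= As Bx0] AB].
  exists (A, B) => // -[s' x] [/= As' Bx].
  have := AB (s', x) (conj As' Bx); have := AB (s', x0) (conj As' (nbhs_singleton Bx0)).
  rewrite /= => h1 h2.
  rewrite -(subrKA (F (s, x0))) (splitr e) (le_trans (ler_normD _ _))//.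
  by rewrite lerD// ?ltW// distrC.
move=> /(_ H); apply: filterS => x Hx s s01; apply: (Hx s).
by rewrite /= in_itv.
Qed.

Lemma tube01_sum E (I : finType) (F : I -> R * E -> R) (x0 : E) (e : R) :
  (forall i (s : R), 0 <= s <= 1 -> {for (s, x0), continuous (F i)}) -> 0 < e ->
  \forall x \near x0, forall i (s : R), 0 <= s <= 1 ->
    `|F i (s, x) - F i (s, x0)| <= e.
Proof.
by move=> cF e0; apply: filter_forall => i; exact: (tube01 (cF i) e0).
Qed.

Lemma cont01_slice E (F : R * E -> R) x :
  (forall s : R, 0 <= s <= 1 -> {for (s, x), continuous F}) ->
  cont01 (fun s => F (s, x)).
Proof.
move=> cF s s01; apply: (@continuous_comp _ _ _ (fun s => (s, x)) F); last exact: cF.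
exact: (@Ck_pair R R R E 0 setT (fun s => s) (fun=> x) openT (Ck_id _ _) (Ck_cst _ _ _) s I).
Qed.

Lemma Ck0_param E (W : set (R * E)) (U : set E) (F : R * E -> R) : open U ->
  (forall s x, 0 <= s <= 1 -> U x -> W (s, x)) -> Ck 0 W F ->
  Ck 0 U (fun x => I01 (fun s => F (s, x))).
Proof.
move=> oU UW cF x0 Ux0; apply/cvgrPdist_le => /= e e0.
have cs x : U x -> cont01 (fun s => F (s, x)).
  by move=> Ux; apply: cont01_slice => s s01; apply: cF; exact: UW.
have := @tube01 _ F x0 e (fun s s01 => cF _ (UW s x0 s01 Ux0)) e0.
apply: filterS2 (open_nbhs_nbhs (conj oU Ux0)) => x Ux H.
rewrite distrC -I01B; [|exact: cs|exact: cs].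
by apply: I01_bound => //; apply: cont01B; exact: cs.
Qed.

Lemma segment_diff E (F : E -> R) (x h : E) :
  (forall t : R, 0 <= t <= 1 -> differentiable F (x + t *: h)) ->
  exists2 c : R, 0 <= c <= 1 & F (x + h) - F x = 'd F (x + c *: h) h.
Proof.
move=> dF; pose g (t : R) := F (x + t *: h).
have dg (t : R) : 0 <= t <= 1 -> is_diff t g (fun v => 'd F (x + t *: h) (v *: h)).
  move=> t01.
  have dl : is_diff t (fun t : R => x + t *: h) (fun v : R => v *: h).
    apply: is_diff_eq.
    by apply/funext => v; rewrite !fctE add0r.
  exact: (is_diff_comp dl (differentiableP (dF t t01))).
have [| |c] := @MVT_segment R g (fun t => 'd F (x + t *: h) h) 0 1 ler01.
- move=> t; rewrite in_itv/= => /andP[t0 t1].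
  have := is_diff_derive1 (dg t _); rewrite scale1r; apply.
  by rewrite !ltW.
- apply: continuous_in_subspaceT => t; rewrite inE/= in_itv/= => t01.
  by apply: differentiable_continuous; case: (dg t t01).
- rewrite in_itv/= => c01; rewrite /g scale1r scale0r addr0 subr0 mulr1 => H.
  by exists c.
Qed.

(** Differentiation under the integral sign. By the mean value theorem the increment of [F] is its
    differential at an intermediate point; expanding [h] along [b], the error involves finitely many
    partial derivatives, close to their values at [x0] uniformly in s by [tube01_sum]. *)
Lemma is_diff_param E (W : set (R * E)) (U : set E) (F : R * E -> R)
    (I : finType) (b : I -> E) (lam : I -> {linear E -> R}) (x0 : E) :
  (forall i, continuous (lam i)) -> (forall w, w = \sum_i lam i w *: b i) ->
  open U -> (forall s x, 0 <= s <= 1 -> U x -> W (s, x)) -> Ck 1 W F -> U x0 ->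
  is_diff x0 (fun x => I01 (fun s => F (s, x)))
    (fun h => \sum_i lam i h * I01 (fun s => 'd F (s, x0) (0, b i))).
Proof.
move=> cl lb oU UW CF Ux0; have /CkSP[dF CdF] := CF.
pose G i (z : R * E) := 'd F z (0, b i).
have cG i s : 0 <= s <= 1 -> {for (s, x0), continuous (G i)}.
  by move=> s01; apply: (CdF (0, b i)); exact: UW.
have cGs i x : U x -> cont01 (fun s => G i (s, x)).
  by move=> Ux; apply: cont01_slice => s s01; apply: (CdF (0, b i)); exact: UW.
have cF x : U x -> cont01 (fun s => F (s, x)).
  by move=> Ux; apply: cont01_slice => s s01; apply: (CkW CF); exact: UW.
pose df h := \sum_i lam i h * I01 (fun s => G i (s, x0)).
have dflin : linear df.
  move=> a u v; rewrite /df scaler_sumr -big_split/=; apply: eq_bigr => i _.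
  by rewrite linearP mulrDl /GRing.scale/= mulrA.
pose dfM := GRing.isLinear.Build _ _ _ _ _ dflin.
pose dfL : {linear E -> R} := HB.pack df dfM.
have cdf : continuous dfL.
  suff H : Ck 0 setT df by move=> x; exact: (H x Logic.I).
  apply: Ck_sum => [|i _]; first exact: openT.
  by apply: CkM; [exact: openT|exact: Ck_linear|exact: Ck_cst].
suff : is_diff x0 (fun x => I01 (fun s => F (s, x))) dfL by [].
apply/is_diff_epsP => // e e0.
(* [K] bounds the sum of the coordinates of [h] by K |h|, so partial derivatives within e / K of
   their values at [x0] contribute an error of at most e |h|. *)
have [K K0 HK] : exists2 K : R, 0 < K & forall h, \sum_i `|lam i h| <= K * `|h|.
  have /choice[k Hk] : forall i, exists k : R, 0 < k /\ forall x, `|lam i x| <= k * `|x|.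
    by move=> i; have [k k0 H] := linear_lipschitz (cl i); exists k.
  exists (\sum_i k i + 1).
    by rewrite ltr_wpDl// sumr_ge0// => i _; rewrite ltW// (Hk i).1.
  move=> h; rewrite mulrDl mul1r (@le_trans _ _ (\sum_i k i * `|h|))//.
    by apply: ler_sum => i _; exact: (Hk i).2.
  by rewrite mulr_suml lerDl.
have eK : 0 < e / K by rewrite divr_gt0.
have T := tube01_sum cG eK.
have [d d0 Hd] : exists2 d : R, 0 < d & forall x, `|x0 - x| < d ->
    U x /\ forall i s, 0 <= s <= 1 -> `|G i (s, x) - G i (s, x0)| <= e / K.
  have : \forall x \near x0, U x /\ forall i s, 0 <= s <= 1 -> `|G i (s, x) - G i (s, x0)| <= e / K.
    by apply: filterS2 (open_nbhs_nbhs (conj oU Ux0)) T.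
  move=> /nbhs_ballP [d d0 Hd]; exists d => // x xd; apply: Hd.
  by rewrite -ball_normE.
near=> h.
have hd : `|h| < d.
  by near: h; exact: nbhs0_lt.
have Ut (t : R) : 0 <= t <= 1 -> `|x0 - (x0 + t *: h)| < d.
  move=> /andP[t0 t1]; rewrite opprD addrA subrr add0r normrN normrZ.
  by rewrite (le_lt_trans _ hd)// ger0_norm// ler_piMl.
have Uxh : U (h + x0).
  have := (Hd _ (Ut 1 _)).1; rewrite scale1r addrC; apply.
  by rewrite ler01 lexx.
have [cs Is] := I01_lincomb (index_enum I) (fun i => lam i h) (fun i => cGs i x0 Ux0).
have -> : dfL h = I01 (fun s => \sum_i lam i h * G i (s, x0)) by rewrite Is.
rewrite -I01B; [|exact: cF|exact: cF].
rewrite -I01B; [|by apply: cont01B; exact: cF|exact: cs].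
apply: I01_bound.
  by apply: cont01B => //; apply: cont01B; exact: cF.
move=> s s01.
have [|c c01] := @segment_diff _ F (s, x0) (0, h).
  move=> t t01; apply: dF.
  rewrite (_ : (s, x0) + _ = (s, x0 + t *: h)).
    by apply: UW => //; exact: (Hd _ (Ut t t01)).1.
  by apply/pair_equal_spec; rewrite /= scaler0 addr0.
rewrite (_ : (s, x0) + (0, h) = (s, h + x0)); last first.
  by apply/pair_equal_spec; rewrite /= addr0 addrC.
rewrite (_ : (s, x0) + c *: (0, h) = (s, x0 + c *: h)); last first.
  by apply/pair_equal_spec; rewrite /= scaler0 addr0.
move=> ->.
rewrite (_ : 'd F _ (0, h) = \sum_i lam i h * G i (s, x0 + c *: h)); last first.
  rewrite (_ : (0, h) = \sum_i lam i h *: ((0 : R), b i)); last first.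
    rewrite [RHS]surjective_pairing !raddf_sum/=; congr (_, _); last exact: lb.
    by rewrite big1// => i _; rewrite scaler0.
  by rewrite linear_sum; apply: eq_bigr => i _; rewrite linearZ.
rewrite -sumrB (le_trans (ler_norm_sum _ _ _))//.
apply: (@le_trans _ _ (\sum_i `|lam i h| * (e / K))).
  apply: ler_sum => i _; rewrite -mulrBr normrM ler_wpM2l//.
  exact: (Hd _ (Ut c c01)).2.
rewrite -mulr_suml (le_trans (ler_wpM2r (ltW eK) (HK h)))//.
by rewrite mulrAC mulrCA divff ?gt_eqF// mulr1.
Unshelve. all: by end_near. Qed.

Lemma Ck_param E k (W : set (R * E)) (U : set E) (F : R * E -> R) :
  finite_dim E -> open U ->
  (forall s x, 0 <= s <= 1 -> U x -> W (s, x)) -> Ck k W F ->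
  Ck k U (fun x => I01 (fun s => F (s, x))).
Proof.
move=> [I [b [lam [cl lb]]]] oU UW; elim: k F => [|k IH] F CF.
  exact: (Ck0_param oU UW CF).
have C1 : Ck 1 W F.
  by elim: k CF {IH} => // k IHk /CkW.
have H x0 : U x0 -> _ := is_diff_param cl lb oU UW C1.
have /CkSP[dF CdF] := CF.
apply/CkSP; split=> [x /H[]//|v].
have HC : Ck k U (fun x => \sum_i lam i v * I01 (fun s => 'd F (s, x) (0, b i))).
  apply: Ck_sum => // i _; apply: CkM => //; first exact: Ck_cst.
  exact: (IH (fun z => 'd F z (0, b i)) (CdF _)).
by apply: Ck_congr HC => // x /H[_ ->].
Qed.

Lemma smooth_on_affine n (a : 'rV[R]_n) (U : set (R * 'rV[R]_n)) : open U ->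
  smooth_on U (fun z : R * 'rV[R]_n => a + z.1 *: (z.2 - a)).
Proof.
move=> oU; apply/smooth_on_rowP => // i.
have s1 : smooth_on U (fun z : R * 'rV[R]_n => z.1).
  exact: smooth_on_fst.
have s2 : smooth_on U (fun z : R * 'rV[R]_n => z.2 ord0 i).
  move=> k; apply: (@Ck_linear _ _ _ k U (coordmx_lin ord0 i \o (@snd R 'rV[R]_n : {linear _ -> _}))).
  by move=> x; apply: continuous_comp; [exact: cvg_snd|exact: coordmx_lin_continuous].
have H : smooth_on U (fun z : R * 'rV[R]_n => a ord0 i + z.1 * (z.2 ord0 i - a ord0 i)).
  apply: smooth_onD => //; first exact: smooth_on_cst.
  apply: smooth_onM => //; apply: smooth_onD => //; exact: smooth_on_cst.
by apply: smooth_on_congr H => // z _; rewrite !mxE.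
Qed.

Lemma linear_row n (L : {linear 'rV[R]_n -> R}) v :
  L v = \sum_i v ord0 i * L (delta_mx ord0 i).
Proof.
rewrite {1}(row_sum_delta v) linear_sum; apply: eq_bigr => i _.
by rewrite linearZ.
Qed.

(** [g i] x is the integral over s in [0, 1] of the i-th partial derivative of [f] at a + s (x - a).
    The expansion is the fundamental theorem of calculus along the segment from [a] to x, and
    smoothness is differentiation under the integral sign. *)
Lemma hadamard n (a : 'rV[R]_n) (r : R) (f : 'rV[R]_n -> R) : 0 < r ->
  smooth_on (ball a r) f -> exists g : 'I_n -> 'rV[R]_n -> R,
  [/\ forall i, smooth_on (ball a r) (g i),
      forall x, ball a r x -> f x = f a + \sum_i (x ord0 i - a ord0 i) * g i x &
      forall i, g i a = 'd f a (delta_mx ord0 i)].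
Proof.
move=> r0 sf; pose e i : 'rV[R]_n := delta_mx ord0 i.
pose A (z : R * 'rV[R]_n) := a + z.1 *: (z.2 - a).
pose F i z := 'd f (A z) (e i).
pose W := A @^-1` ball a r.
have ob : open (ball a r) by exact: ball_open.
have oW : open W.
  have cA : continuous A.
    by move=> z; exact: (smooth_on_cont (smooth_on_affine a openT) I).
  by apply: (continuousP A).1 => //; exact: ball_open.
have sF i : smooth_on W (F i).
  apply: (@smooth_on_comp_real _ _ _ W (ball a r) A (fun x => 'd f x (e i))) => //.
  - exact: finite_dim_row.
  - exact: smooth_on_affine.
  - exact: smooth_on_dd.
have UW s x : 0 <= s <= 1 -> ball a r x -> W (s, x).
  move=> /andP[s0 s1]; rewrite /W /A -ball_normE/= opprD addrA subrr add0r.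
  rewrite normrN normrZ distrC => xr.
  by rewrite (le_lt_trans _ xr)// ger0_norm// ler_piMl.
exists (fun i x => I01 (fun s => F i (s, x))); split.
- move=> i k; apply: (Ck_param (finite_dim_row n) ob UW); exact: sF.
- move=> x xr; apply/eqP; rewrite addrC -subr_eq; apply/eqP.
  have cs i : cont01 (fun s => F i (s, x)).
    by apply: cont01_slice => s s01; apply: (smooth_on_cont (sF i)); exact: UW.
  have [cI <-] := I01_lincomb (index_enum 'I_n) (fun i => x ord0 i - a ord0 i) cs.
  pose g (s : R) := f (a + s *: (x - a)).
  have dl (s : R) : is_diff s (fun t : R => a + t *: (x - a)) (fun v : R => v *: (x - a)).
    by apply: is_diff_eq; apply/funext => v; rewrite !fctE add0r.
  have dg (s : R) : 0 <= s <= 1 -> is_diff s g (fun v => 'd f (a + s *: (x - a)) (v *: (x - a))).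
    move=> s01; have dfs := smooth_on_diff sf (UW s x s01 xr).
    exact: (is_diff_comp (dl s) (differentiableP dfs)).
  have cg : cont01 g.
    by move=> s /dg[dgs _]; exact: differentiable_continuous.
  have dgd (s : R) : 0 < s < 1 ->
      is_derive s 1 g (\sum_i (x ord0 i - a ord0 i) * F i (s, x)).
    move=> /andP[s0 s1]; have s01 : 0 <= s <= 1 by rewrite !ltW.
    apply: is_derive_eq (is_diff_derive1 (dg s s01)) _.
    by rewrite scale1r linear_row; apply: eq_bigr => i _; rewrite !mxE.
  rewrite (I01_FTC cI cg dgd).
  by rewrite /g scale1r scale0r addr0 addrCA subrr addr0.
- move=> i.
  have AE (s : R) : A (s, a) = a by rewrite /A /= subrr scaler0 addr0.
  have FE : (fun s => F i (s, a)) = fun=> 'd f a (e i).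
    by apply/funext => s; rewrite /F AE.
  exact: (etrans (congr1 I01 FE) (I01_cst _)).
Qed.

End parametric_integral.

(** * Ordinary differential equations *)

Section real_tools.
Context {R : realType}.

Lemma mvt_bound (f df : R -> R) (a b M : R) : a <= b ->
  (forall t, a <= t <= b -> is_derive t 1 f (df t)) ->
  (forall t, a <= t <= b -> `|df t| <= M) -> `|f b - f a| <= M * (b - a).
Proof.
move=> ab fd dM.
have [| |c] := @MVT_segment R f df a b ab.
- by move=> t; rewrite in_itv/= => /andP[at_ tb]; apply: fd; rewrite !ltW.
- apply: continuous_in_subspaceT => t; rewrite inE/= in_itv/= => tab.
  have [dt _] := fd t tab.
  by apply: differentiable_continuous; exact/derivable1_diffP.
- rewrite in_itv/= => cab ->.
  by rewrite normrM (ger0_norm (_ : 0 <= b - a)) ?subr_ge0// ler_wpM2r ?subr_ge0// dM.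
Qed.

Lemma compact_bounded_fun (T : topologicalType) (A : set T) (f : T -> R) :
  compact A -> (forall x, A x -> {for x, continuous f}) ->
  exists2 K, 0 < K & forall x, A x -> `|f x| <= K.
Proof.
move=> cA cf; have [A0|/nonemptyPn A0] := pselect (A !=set0); last first.
  by exists 1 => // x; rewrite A0.
have [|c _ Hc] := @compact_EVT_max _ R (fun x => `|f x|) A A0 cA.
  apply: continuous_in_subspaceT => x; rewrite inE => Ax.
  exact: (@continuous_comp _ _ _ f Num.norm) (cf x Ax) (@norm_continuous _ _ _).
exists (`|f c| + 1); first by rewrite ltr_wpDl.
move=> x Ax; rewrite (le_trans (Hc x _)) ?inE//.
by rewrite lerDl.
Qed.

(* The retraction of R onto [t0 - d, t0 + d]: composing a vector field with it
   makes the field globally bounded and Lipschitz. *)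
Definition clamp (t0 d t : R) := t0 + Num.max (- d) (Num.min d (t - t0)).

Lemma clamp_id t0 d t : `|t - t0| <= d -> clamp t0 d t = t.
Proof.
rewrite ler_norml => /andP[h1 h2]; rewrite /clamp min_r// max_r//.
by rewrite addrCA subrr addr0.
Qed.

Lemma clamp_in t0 d t : 0 <= d -> `|clamp t0 d t - t0| <= d.
Proof.
move=> d0; rewrite /clamp addrAC subrr add0r ler_norml le_max lexx/=.
by rewrite ge_max ge_min lexx/= andbT (le_trans _ d0)// oppr_le0.
Qed.

Lemma max_lip (a u v : R) : `|Num.max a u - Num.max a v| <= `|u - v|.
Proof.
have h1 := ler_norm (u - v); have h2 := ler_norm (v - u); rewrite distrC in h2.
by have [au|ua] := leP a u; have [av|va] := leP a v; rewrite ler_norml;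
  apply/andP; split; lra.
Qed.

Lemma min_lip (a u v : R) : `|Num.min a u - Num.min a v| <= `|u - v|.
Proof.
have h1 := ler_norm (u - v); have h2 := ler_norm (v - u); rewrite distrC in h2.
by have [au|ua] := leP a u; have [av|va] := leP a v; rewrite ler_norml;
  apply/andP; split; lra.
Qed.

Lemma clamp_lip t0 d t s : `|clamp t0 d t - clamp t0 d s| <= `|t - s|.
Proof.
rewrite /clamp opprD addrACA subrr add0r.
rewrite (_ : t - s = (t - t0) - (s - t0)); last by ring.
exact: le_trans (max_lip _ _ _) (min_lip _ _ _).
Qed.

Lemma geom_small (C e : R) : 0 < e -> exists m : nat, C * 2^-1 ^+ m <= e.
Proof.
move=> e0; have [m mC] : exists m : nat, `|C| / e < m%:R.
  by exists (Num.bound (`|C| / e)); apply: archi_boundP; rewrite divr_ge0// ltW.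
exists m; rewrite exprVn ler_pdivrMr ?exprn_gt0//.
rewrite (le_trans (ler_norm _))// -ler_pdivrMl// mulrC.
rewrite (le_trans (ltW mC))// -natrX ler_nat ltnW//.
exact: ltn_expl.
Qed.

Lemma geom_le (a b C : R) : (forall m : nat, a <= b + C * 2^-1 ^+ m) -> a <= b.
Proof.
move=> H; apply/ler_addgt0Pr => e /(geom_small C)[m Hm].
by rewrite (le_trans (H m))// lerD2l.
Qed.

(** Every u p - q p lies below every u m + q m, where q m = C 2^-m; the supremum of the former
    numbers is therefore within q m of u m for all m. *)
Lemma geom_limit (u : nat -> R) (C : R) :
  (forall m p : nat, `|u (m + p)%N - u m| <= C * 2^-1 ^+ m) ->
  exists l, forall m, `|l - u m| <= C * 2^-1 ^+ m.
Proof.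
move=> H; pose q m := C * 2^-1 ^+ m.
have Hq m p : u p - q p <= u m + q m.
  have [mp|/ltnW pm] := leqP m p.
    have := H m (p - m)%N; rewrite subnKC// -/(q m) ler_norml => /andP[_ h].
    have := H p 0%N; rewrite addn0 subrr normr0 -/(q p) => h2; lra.
  have := H p (m - p)%N; rewrite subnKC// -/(q p) ler_norml => /andP[h _].
  have := H m 0%N; rewrite addn0 subrr normr0 -/(q m) => h2; lra.
pose S := [set u p - q p | p in [set: nat]].
have S0 : S !=set0 by exists (u 0%N - q 0%N), 0%N.
exists (sup S) => m; rewrite ler_norml -/(q m); apply/andP; split.
  have : u m - q m <= sup S.
    apply: ub_le_sup; last by exists m.
    by exists (u m + q m) => _ [p _ <-].
  lra.
have : sup S <= u m + q m by apply: ge_sup => // _ [p _ <-].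
lra.
Qed.

(** Integrating from t0 - 1 puts both sides of [t0] in the interior of an interval on which the
    fundamental theorem applies. This is the origin of the radius 1, hence of the requirement d < 1
    in the Picard iteration. *)
Lemma primitive_exists (f : R -> R) (t0 : R) :
  (forall t, {for t, continuous f}) ->
  exists F : R -> R, F t0 = 0 /\
    forall t, `|t - t0| < 1 -> is_derive t 1 F (f t).
Proof.
move=> cf; pose mu := @lebesgue_measure R; pose a := t0 - 1.
pose G (x : R) := \int[mu]_(t in [set` `[a, x]]) f t.
exists (fun t => G t - G t0); split; first by rewrite subrr.
move=> t; rewrite ltr_norml => /andP[h1 h2].
have int : mu.-integrable `[a, t0 + 1] (EFin \o f).
  apply: continuous_compact_integrable; first exact: segment_compact.
  exact: continuous_subspaceT.
have [||dG GE] := @continuous_FTC1_closed R f a t (t0 + 1) _ int _ (cf t).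
- lra.
- rewrite /a; lra.
have : is_derive t 1 (G - cst (G t0)) (f t - 0).
  apply: is_deriveB; apply: DeriveDef; first exact: dG.
  by rewrite -derive1E; exact: GE.
by rewrite subr0.
Qed.

End real_tools.

Section picard.
Context {R : realType} (n : nat).
Variables (F : R -> 'rV[R]_n -> 'rV[R]_n) (L B t0 : R) (x0 : 'rV[R]_n).
Hypothesis Fc : forall x : R -> 'rV[R]_n, (forall t, {for t, continuous x}) ->
  forall i t, {for t, continuous (fun t => F t (x t) ord0 i)}.
Hypothesis L0 : 0 <= L.
Hypothesis FL : forall t x y, `|F t x - F t y| <= L * `|x - y|.
Hypothesis B0 : 0 <= B.
Hypothesis FB : forall t x, `|F t x| <= B.

(** Chosen so that L d <= 1/2, which makes the Picard operator a contraction of ratio 1/2, and d <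
    1, which keeps within reach of the primitives. *)
Let d := (2 * (L + 1))^-1.

Let d_gt0 : 0 < d.
Proof. by rewrite invr_gt0 mulr_gt0// ltr_wpDl. Qed.

Let d_lt1 : d < 1.
Proof.
have h : 1 < 2 * (L + 1) by have := L0; lra.
by rewrite invf_lt1// (lt_trans ltr01).
Qed.

Let dL : L * d <= 2^-1.
Proof.
have h : 0 < 2 * (L + 1) by have := L0; lra.
by rewrite /d ler_pdivrMr// mulrA mulVf// mul1r lerDl.
Qed.

Let prim (f : R -> R) : R -> R :=
  xget (fun=> 0) [set P | P t0 = 0 /\ forall t, `|t - t0| < 1 -> is_derive t 1 P (f t)].

Let primP f : (forall t, {for t, continuous f}) ->
  prim f t0 = 0 /\ forall t, `|t - t0| < 1 -> is_derive t 1 (prim f) (f t).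
Proof.
move=> /(primitive_exists t0)[P HP]; rewrite /prim.
by case: xgetP => [Q _ []//|/(_ P)].
Qed.

(** The Picard operator. Clamping the time freezes the image outside [t0 - d, t0 + d], so that all
    estimates on iterates hold for every real time. *)
Let T (y : R -> 'rV[R]_n) (t : R) : 'rV[R]_n :=
  \row_i (x0 ord0 i + prim (fun s => F s (y s) ord0 i) (clamp t0 d t)).

Let lip_cont (y : R -> 'rV[R]_n) : (forall t s, `|y t - y s| <= B * `|t - s|) ->
  forall t, {for t, continuous y}.
Proof.
move=> yB t; apply/cvgrPdist_le => e e0.
have : \forall s \near t, `|t - s| < e / (B + 1).
  by apply: nbhsx_ballx; rewrite divr_gt0// ltr_wpDl.
apply: filterS => s /ltW; rewrite ler_pdivlMr ?ltr_wpDl// => H.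
rewrite (le_trans (yB _ _))// (le_trans _ H)// mulrC ler_wpM2l// lerDl//.
Qed.

Let prim_bound f g M t s : (forall t, {for t, continuous f}) ->
  (forall t, {for t, continuous g}) ->
  (forall t, `|t - t0| <= d -> `|f t - g t| <= M) ->
  `|t - t0| <= d -> `|s - t0| <= d ->
  `|(prim f t - prim g t) - (prim f s - prim g s)| <= M * `|t - s|.
Proof.
move=> cf cg fM.
have [_ Df] := primP cf; have [_ Dg] := primP cg.
have DD u : `|u - t0| <= d -> is_derive u 1 (prim f - prim g) (f u - g u).
  move=> ud; have u1 : `|u - t0| < 1 by rewrite (le_lt_trans ud).
  by apply: is_deriveB; [exact: Df|exact: Dg].
wlog st : t s / s <= t.
  move=> H td sd; have [st|/ltW ts] := leP s t; first exact: H.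
  by rewrite distrC (distrC t); exact: H.
rewrite !ler_norml => /andP[h1 h2] /andP[h3 h4].
have inside u : s <= u <= t -> `|u - t0| <= d.
  by move=> /andP[h5 h6]; rewrite ler_norml; apply/andP; split; lra.
have := @mvt_bound _ (prim f - prim g) (fun u => f u - g u) s t M st.
rewrite (ger0_norm (_ : 0 <= t - s)) ?subr_ge0// -ler_norml; apply.
  by move=> u /inside; exact: DD.
by move=> u /inside; exact: fM.
Qed.

Let T_t0 y : (forall t, {for t, continuous y}) -> T y t0 = x0.
Proof.
move=> cy; apply/rowP => i; rewrite mxE clamp_id ?subrr ?normr0 ?ltW//.
by have [-> _] := primP (@Fc _ cy i); rewrite addr0.
Qed.

Let zc : forall t : R, {for t, continuous (fun _ : R => 0 : R)}.
Proof. by move=> t; exact: cst_continuous. Qed.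

(** [prim_bound] compares two primitives. Comparison with the chosen primitive of 0, which is
    constant on the window, turns it into a bound for a single one. *)
Let prim0 t s : `|t - t0| <= d -> `|s - t0| <= d ->
  prim (fun=> 0) t = prim (fun=> 0) s.
Proof.
have [_ D] := primP zc.
wlog st : t s / s <= t.
  by move=> H td sd; have [st|/ltW ts] := leP s t; [exact: H|apply/esym/H].
rewrite !ler_norml => /andP[h1 h2] /andP[h3 h4].
have := @mvt_bound _ (prim (fun=> 0)) (fun=> 0) s t 0 st.
move=> H; apply/eqP; rewrite -subr_eq0 -normr_le0.
rewrite (le_trans (H _ _)) ?mul0r// => u; last by rewrite normr0.
move=> /andP[su ut]; apply: D; rewrite (le_lt_trans _ d_lt1)//.
by rewrite ler_norml; apply/andP; split; lra.
Qed.

Let T_lip0 y t s : (forall t, {for t, continuous y}) ->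
  `|T y t - T y s| <= B * `|clamp t0 d t - clamp t0 d s|.
Proof.
move=> cy; apply/row_norm_leP; first by rewrite mulr_ge0.
move=> i; rewrite !mxE opprD addrACA subrr add0r.
have ct := clamp_in t0 t (ltW d_gt0); have cs := clamp_in t0 s (ltW d_gt0).
have := prim_bound (M := B) (@Fc _ cy i) zc _ ct cs.
rewrite (prim0 ct cs) opprB addrA subrK; apply => u _.
by rewrite subr0 (le_trans (row_norm_ge _ _)).
Qed.

Let T_lip y t s : (forall t, {for t, continuous y}) ->
  `|T y t - T y s| <= B * `|t - s|.
Proof.
move=> cy; rewrite (le_trans (T_lip0 _ _ cy))// ler_wpM2l//.
exact: clamp_lip.
Qed.

Let T_contr y z c t : (forall t, {for t, continuous y}) ->
  (forall t, {for t, continuous z}) -> 0 <= c ->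
  (forall t, `|y t - z t| <= c) -> `|T y t - T z t| <= c / 2.
Proof.
move=> cy cz c0 yz; apply/row_norm_leP; first by rewrite divr_ge0.
move=> i; rewrite !mxE opprD addrACA subrr add0r.
have ct := clamp_in t0 t (ltW d_gt0).
have c00 : `|t0 - t0| <= d by rewrite subrr normr0 ltW.
have := prim_bound (M := L * c) (@Fc _ cy i) (@Fc _ cz i) _ ct c00.
have [-> _] := primP (@Fc _ cy i); have [-> _] := primP (@Fc _ cz i).
rewrite !subr0 => H.
apply: le_trans (H _) _ => [u _|].
  have -> : F u (y u) ord0 i - F u (z u) ord0 i = (F u (y u) - F u (z u)) ord0 i.
    by rewrite !mxE.
  rewrite (le_trans (row_norm_ge _ _))// (le_trans (FL _ _ _))//.
  by rewrite ler_wpM2l.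
rewrite mulrAC mulrC ler_wpM2l// (le_trans _ dL)// ler_wpM2l//.
Qed.

Let X m := iter m T (fun=> x0).

Let X_lip m t s : `|X m t - X m s| <= B * `|t - s|.
Proof.
elim: m t s => [|m IH] t s; first by rewrite /X/= subrr normr0 mulr_ge0.
by rewrite /X iterS; apply: T_lip; exact: lip_cont.
Qed.

Let X_cont m t : {for t, continuous (X m)}.
Proof. by apply: lip_cont; exact: X_lip. Qed.

Let X_step m t : `|X m.+1 t - X m t| <= B * 2^-1 ^+ m.
Proof.
elim: m t => [|m IH] t.
  rewrite expr0 mulr1 /X/= -[x0 in X in _ - X](T_t0 (@X_cont 0)).
  rewrite (le_trans (T_lip0 _ _ (@X_cont 0)))// -[leRHS]mulr1 ler_wpM2l//.
  rewrite (clamp_id (_ : `|t0 - t0| <= d)) ?subrr ?normr0 ?ltW//.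
  by rewrite (le_lt_trans (clamp_in _ _ _)) ?ltW.
rewrite exprSr mulrA; apply: (T_contr t (@X_cont m.+1) (@X_cont m) _ IH).
by rewrite mulr_ge0// exprn_ge0.
Qed.

Let X_tail m p t : `|X (m + p)%N t - X m t| <= (2 * B) * 2^-1 ^+ m.
Proof.
(* The telescoped geometric sum is kept exact, so that the induction on [p] closes. *)
suff : `|X (m + p)%N t - X m t| <= (2 * B) * (2^-1 ^+ m - 2^-1 ^+ (m + p)).
  move=> /le_trans; apply; rewrite ler_wpM2l ?mulr_ge0// gerBl exprn_ge0//.
elim: p => [|p IH]; first by rewrite addn0 !subrr normr0 mulr0.
rewrite -(subrKA (X (m + p)%N t)) (le_trans (ler_normD _ _))//.
have := X_step (m + p) t; rewrite addnS => h.
rewrite (le_trans (lerD h IH))// exprS.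
by rewrite le_eqVlt; apply/orP; left; apply/eqP; field.
Qed.

(** The iterates converge geometrically, uniformly in time. By contraction [T x] is close to
    [T (X m)], that is to [X m.+1], so the limit is a fixed point; differentiating [x = T x] where
    the clamp is the identity gives the equation. *)
Lemma picard_global : exists2 d, 0 < d & exists x : R -> 'rV[R]_n,
  x t0 = x0 /\ forall t, `|t - t0| < d ->
    `|x t - x0| <= B * `|t - t0| /\
    forall i, is_derive t 1 (fun t => x t ord0 i) (F t (x t) ord0 i).
Proof.
exists d => //.
have /choice[x Hx] : forall t, exists x : 'rV[R]_n,
    forall m, `|x - X m t| <= (2 * B) * 2^-1 ^+ m.
  move=> t.
  have /choice[l Hl] : forall i, exists l : R,
      forall m, `|l - X m t ord0 i| <= (2 * B) * 2^-1 ^+ m.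
    move=> i; apply: geom_limit => m p.
    have -> : X (m + p)%N t ord0 i - X m t ord0 i = (X (m + p)%N t - X m t) ord0 i.
      by rewrite !mxE.
    exact: le_trans (row_norm_ge _ _) (X_tail _ _ _).
  exists (\row_i l i) => m; apply/row_norm_leP => [|i].
    by rewrite !mulr_ge0// exprn_ge0.
  by rewrite !mxE.
have x_lip t s : `|x t - x s| <= B * `|t - s|.
  apply: (@geom_le _ _ _ (4 * B)) => m.
  have -> : x t - x s = (x t - X m t) + (X m t - X m s) + (X m s - x s).
    by rewrite !addrA !subrK.
  have h1 := Hx t m; have h2 := Hx s m; have h3 := X_lip m t s.
  have h4 := ler_normD (x t - X m t + (X m t - X m s)) (X m s - x s).
  have h5 := ler_normD (x t - X m t) (X m t - X m s).
  rewrite distrC in h2; lra.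
have xc t : {for t, continuous x} by apply: lip_cont.
have xT t : T x t = x t.
  apply/eqP; rewrite -subr_eq0 -normr_le0; apply: (@geom_le _ _ _ (4 * B)) => m.
  rewrite add0r; have q0 : 0 <= (2^-1 : R) ^+ m by rewrite exprn_ge0.
  have h1 : `|T x t - T (X m) t| <= (2 * B) * 2^-1 ^+ m / 2.
    apply: T_contr => //; first by rewrite !mulr_ge0.
  have h2 := Hx t m.+1.
  have h4 := ler_normD (T x t - T (X m) t) (X m.+1 t - x t).
  rewrite distrC in h2; rewrite -(subrKA (X m.+1 t)) (le_trans h4)//.
  have h5 : (2 * B) * 2^-1 ^+ m.+1 <= (2 * B) * 2^-1 ^+ m.
    rewrite ler_wpM2l ?mulr_ge0// exprS ler_piMl//.
    by rewrite invf_le1// ler1n.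
  have h6 : 0 <= B * 2^-1 ^+ m by rewrite mulr_ge0.
  lra.
have xt0 : x t0 = x0 by rewrite -xT T_t0.
exists x; split=> // t td; split; first by rewrite -{1}xt0.
move=> i; have [_ D] := primP (@Fc _ xc i).
have Dt : is_derive t 1 (prim (fun s => F s (x s) ord0 i)) (F t (x t) ord0 i).
  by apply: D; exact: lt_trans td d_lt1.
have Dt2 : is_derive t 1 (cst (x0 ord0 i) + prim (fun s => F s (x s) ord0 i))
   (0 + F t (x t) ord0 i) by apply: is_deriveD.
rewrite add0r in Dt2; apply: near_eq_is_derive Dt2.
have : \forall s \near t, `|s - t0| < d.
  pose e := d - `|t - t0|; have e0 : 0 < e by rewrite subr_gt0.
  have : \forall s \near t, `|t - s| < e by exact: nbhsx_ballx.
  apply: filterS => s; rewrite /e ltrBrDr => H.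
  by rewrite -(subrKA t) (le_lt_trans (ler_normD _ _))// distrC.
apply: filterS => s sd; rewrite -[in RHS]xT mxE clamp_id//.
exact: ltW.
Qed.

End picard.

Lemma for_continuous_pair (S T U : topologicalType) (f : S -> T) (g : S -> U) x :
  {for x, continuous f} -> {for x, continuous g} ->
  {for x, continuous (fun y => (f y, g y))}.
Proof. by move=> cf cg; rewrite /prop_for /continuous_at; exact: cvg_pair. Qed.

Section local_ode.
Context {R : realType}.

Lemma lip1_continuous (V W : normedModType R) (f : V -> W) :
  (forall x y, `|f x - f y| <= `|x - y|) -> forall x, {for x, continuous f}.
Proof.
move=> fl x; apply/cvgrPdist_lt => e e0.
have : \forall y \near x, ball x e y by exact: nbhsx_ballx.
apply: filterS => y; rewrite -ball_normE/=.
exact: le_lt_trans.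
Qed.

Definition clampV n (x0 : 'rV[R]_n) (d : R) (x : 'rV[R]_n) : 'rV[R]_n :=
  \row_i clamp (x0 ord0 i) d (x ord0 i).

Lemma clampV_id n (x0 x : 'rV[R]_n) d : `|x - x0| <= d -> clampV x0 d x = x.
Proof.
move=> H; apply/rowP => i; rewrite mxE clamp_id//.
have -> : x ord0 i - x0 ord0 i = (x - x0) ord0 i by rewrite !mxE.
exact: le_trans (row_norm_ge _ _) H.
Qed.

Lemma clampV_in n (x0 x : 'rV[R]_n) d : 0 <= d -> `|clampV x0 d x - x0| <= d.
Proof.
by move=> d0; apply/row_norm_leP => // i; rewrite !mxE; exact: clamp_in.
Qed.

Lemma clampV_lip n (x0 x y : 'rV[R]_n) d :
  `|clampV x0 d x - clampV x0 d y| <= `|x - y|.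
Proof.
apply/row_norm_leP => // i; rewrite !mxE (le_trans (clamp_lip _ _ _ _))//.
have -> : x ord0 i - y ord0 i = (x - y) ord0 i by rewrite !mxE.
exact: row_norm_ge.
Qed.

Lemma compact_closed_cube n (x0 : 'rV[R]_n) (d : R) : 0 <= d ->
  compact [set x | `|x - x0| <= d].
Proof.
move=> d0; rewrite (_ : [set _ | _] = [set x : 'rV[R]_n |
    forall i, [set` `[x0 ord0 i - d, x0 ord0 i + d]] (x ord0 i)]).
  apply: (@rV_compact _ _ (fun i => `[x0 ord0 i - d, x0 ord0 i + d]%classic)) => i.
  exact: segment_compact.
apply/seteqP; split=> x /=.
  by move=> /(row_norm_leP _ d0) H i; have := H i; rewrite !mxE in_itv/= -ler_distl.
move=> H; apply/row_norm_leP => // i; have := H i.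
by rewrite !mxE in_itv/= -ler_distl.
Qed.

Lemma linear_pair_row n (L : {linear (R * 'rV[R]_n)%type -> R}) v :
  L (0, v) = \sum_j v ord0 j * L (0, delta_mx ord0 j).
Proof.
have -> : (0, v) = \sum_j v ord0 j *: ((0 : R), delta_mx ord0 j : 'rV[R]_n).
  rewrite [RHS]surjective_pairing !raddf_sum/=; congr (_, _); last exact: row_sum_delta.
  by rewrite big1// => i _; rewrite scaler0.
by rewrite linear_sum; apply: eq_bigr => i _; rewrite linearZ.
Qed.

(** Composing the field with the retractions onto a closed cube [Q] inside [W] makes it globally
    bounded by compactness, and globally Lipschitz by the mean value theorem, since [Q] is convex.
    As long as the solution stays in [Q] it solves the original equation. *)
Lemma ode_local n (W : set (R * 'rV[R]_n)) (F : R * 'rV[R]_n -> 'rV[R]_n)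
    (t0 : R) (x0 : 'rV[R]_n) : open W -> W (t0, x0) -> smooth_on W F ->
  exists2 d, 0 < d & exists x : R -> 'rV[R]_n,
  [/\ x t0 = x0, smooth_on (ball t0 d) x &
      forall t, ball t0 d t -> W (t, x t) /\
        forall i, is_derive t 1 (fun t => x t ord0 i) (F (t, x t) ord0 i)].
Proof.
move=> oW W0 sF.
have sFi i : smooth_on W (fun z => F z ord0 i) by apply: (smooth_on_rowP F oW).1.
have /nbhs_ballP[e /= e0 eW] := open_nbhs_nbhs (conj oW W0).
pose r := e / 2; have r0 : 0 < r by rewrite divr_gt0.
pose Q := [set z : R * 'rV[R]_n | `|z.1 - t0| <= r /\ `|z.2 - x0| <= r].
have re : r < e by rewrite ltr_pdivrMr// ltr_pMr// ltr1n.
have QW : Q `<=` W.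
  move=> [s x] [/= h1 h2]; apply: eW; split; rewrite -ball_normE/= distrC.
    exact: le_lt_trans h1 re.
  exact: le_lt_trans h2 re.
have cQ : compact Q.
  rewrite (_ : Q = `[t0 - r, t0 + r]%classic `*` [set x | `|x - x0| <= r]).
    by apply: compact_setX; [exact: segment_compact|exact: compact_closed_cube (ltW r0)].
  apply/seteqP; split=> -[s x] [/= h1 h2]; split=> //=; move: h1;
    by rewrite in_itv/= -ler_distl.
have /choice[Bi HBi] i : exists K, 0 < K /\ forall z, Q z -> `|F z ord0 i| <= K.
  have [K K0 HK] := @compact_bounded_fun R _ Q (fun z => F z ord0 i) cQ
    (fun z Qz => smooth_on_cont (sFi i) (QW z Qz)).
  by exists K.
pose D i j (z : R * 'rV[R]_n) := 'd (fun z => F z ord0 i) z (0, delta_mx ord0 j).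
have /choice[Ki HKi] (ij : 'I_n * 'I_n) :
    exists K, 0 < K /\ forall z, Q z -> `|D ij.1 ij.2 z| <= K.
  have [K K0 HK] := @compact_bounded_fun R _ Q (D ij.1 ij.2) cQ
    (fun z Qz => smooth_on_cont (smooth_on_dd (0, delta_mx ord0 ij.2) (sFi ij.1)) (QW z Qz)).
  by exists K.
pose B := \sum_i Bi i; pose L := \sum_i \sum_j Ki (i, j).
have B0 : 0 <= B by apply: sumr_ge0 => i _; rewrite ltW// (HBi i).1.
have Kij0 i j : 0 <= Ki (i, j) by rewrite ltW// (HKi (i, j)).1.
have L0 : 0 <= L by apply: sumr_ge0 => i _; apply: sumr_ge0.
pose c (t : R) (x : 'rV[R]_n) := (clamp t0 r t, clampV x0 r x).
have cQ' t x : Q (c t x) by split; [exact: clamp_in (ltW r0)|exact: clampV_in (ltW r0)].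
pose G t x := F (c t x).
have Gc (x : R -> 'rV[R]_n) : (forall t, {for t, continuous x}) ->
    forall i t, {for t, continuous (fun t => G t (x t) ord0 i)}.
  move=> cx i t.
  have c1 : {for t, continuous (clamp t0 r)} by apply: lip1_continuous => u v; exact: clamp_lip.
  have c2 : {for t, continuous (fun t => clampV x0 r (x t))}.
    apply: (@continuous_comp _ _ _ x (clampV x0 r)); first exact: cx.
    by apply: lip1_continuous => u v; exact: clampV_lip.
  apply: (@continuous_comp _ _ _ (fun t => c t (x t)) (fun z => F z ord0 i)).
    exact: for_continuous_pair.
  by apply: (smooth_on_cont (sFi i)); exact/QW.
have GL t x y : `|G t x - G t y| <= L * `|x - y|.
  rewrite -normrN opprB.
  have xy := clampV_lip x0 y x r; rewrite (distrC y x) in xy.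
  apply/row_norm_leP => [|i]; first by rewrite mulr_ge0.
  rewrite !mxE; set s := clamp t0 r t.
  have inQ (u : R) : 0 <= u <= 1 ->
      Q ((s, clampV x0 r x) + u *: (0, clampV x0 r y - clampV x0 r x)).
    move=> /andP[u0 u1].
    have [_ /= h1] := cQ' t x; have [h0 /= h2] := cQ' t y.
    split; rewrite /= ?scaler0 ?addr0//.
    rewrite (_ : _ - x0 = (1 - u) *: (clampV x0 r x - x0) + u *: (clampV x0 r y - x0)).
      rewrite (le_trans (ler_normD _ _))// !normrZ (ger0_norm u0) ger0_norm ?subr_ge0//.
      have h3 : (1 - u) * `|clampV x0 r x - x0| <= (1 - u) * r by rewrite ler_wpM2l ?subr_ge0.
      have h4 : u * `|clampV x0 r y - x0| <= u * r by rewrite ler_wpM2l.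
      by rewrite (le_trans (lerD h3 h4))// -mulrDl subrK mul1r.
    by apply/rowP => j; rewrite !mxE; ring.
  have [|cc c01] := @segment_diff R _ (fun z => F z ord0 i) (s, clampV x0 r x)
    (0, clampV x0 r y - clampV x0 r x).
    move=> u u01; apply: (smooth_on_diff (sFi i)); apply: QW; exact: inQ.
  rewrite (_ : (s, clampV x0 r x) + (0, clampV x0 r y - clampV x0 r x) =
     (s, clampV x0 r y)); last first.
    by apply/pair_equal_spec; rewrite /= addr0 addrC subrK.
  rewrite /G /c -/s => ->; rewrite linear_pair_row.
  rewrite (le_trans (ler_norm_sum _ _ _))//.
  apply: (@le_trans _ _ (\sum_j `|x - y| * Ki (i, j))).
    apply: ler_sum => j _; rewrite normrM ler_pM//.
      rewrite (le_trans _ xy)// (le_trans _ (row_norm_ge _ j))// !mxE//.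
    apply: (HKi (i, j)).2; exact: inQ.
  rewrite -mulr_sumr mulrC ler_wpM2r// /L [leRHS](bigD1 i)//= lerDl sumr_ge0// => i' _.
  exact: sumr_ge0.
have GB t x : `|G t x| <= B.
  apply/row_norm_leP => // i; rewrite (le_trans ((HBi i).2 _ (cQ' t x)))//.
  by rewrite /B (bigD1 i)//= lerDl sumr_ge0// => i' _; rewrite ltW// (HBi i').1.
have [d d0 [x [xt0 Hx]]] := picard_global t0 x0 Gc L0 GL B0 GB.
(* The speed is at most [B], so the solution cannot leave the cube of radius [r] within time r / (B
   + 1). *)
pose d' := Num.min d (Num.min r (r / (B + 1))).
have B1 : 0 < B + 1 by rewrite ltr_wpDl.
have d'0 : 0 < d' by rewrite !lt_min d0 r0 divr_gt0.
have inside t : ball t0 d' t -> Q (t, x t) /\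
    forall i, is_derive t 1 (fun t => x t ord0 i) (F (t, x t) ord0 i).
  rewrite -ball_normE/= distrC !lt_min => /and3P[td tr trB].
  have [xB Dx] := Hx t td.
  have Qt : Q (t, x t).
    split=> /=; first exact: ltW.
    rewrite (le_trans xB)//; move/ltW: trB; rewrite ler_pdivlMr// => /(le_trans _); apply.
    by rewrite mulrC ler_wpM2l// lerDl.
  split=> // i; have := Dx i; rewrite /G /c clamp_id ?clampV_id//; first exact: Qt.2.
  exact: Qt.1.
exists d' => //; exists x; split=> //; last first.
  by move=> t /inside[/QW].
have ob : open (ball t0 d') by exact: ball_open.
move=> k; apply/(Ck_rowP _ _ ob) => i.
(* Bootstrap: if [x] is C^k, the right-hand side of the equation is C^k, so [x] is C^(k+1). *)
elim: k i => [|k IH] i.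
  move=> t /inside[_ /(_ i) /is_derive_diffR[+ _]].
  exact: differentiable_continuous.
apply/CkSP; split=> [t /inside[_ /(_ i) /is_derive_diffR[]]//|v].
have Cx : Ck k (ball t0 d') x by apply/(Ck_rowP _ _ ob).
have CF : Ck k (ball t0 d') (fun t => v * F (t, x t) ord0 i).
  apply: CkM => //; first exact: Ck_cst.
  apply: (@Ck_comp_real _ _ _ k _ W (fun t => (t, x t)) (fun z => F z ord0 i)) => //.
  - by apply: finite_dim_pair; [exact: finite_dimR|exact: finite_dim_row].
  - by move=> t /inside[/QW].
  - by apply: Ck_pair => //; exact: Ck_id.
  - exact: sFi.
by apply: Ck_congr CF => // t /inside[_ /(_ i) /is_derive_diffR[_ ->]].
Qed.

End local_ode.

(** * Tangent vectors and velocities *)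

Section tangent_vectors.
Context {R : realType} {n : nat} {M : manifoldType R n}.
Implicit Types (p : M) (u v : (M -> R) -> R) (f h : M -> R).

Lemma tangent_nonsmooth p v f : tangent p v -> ~ smooth_fun f -> v f = 0.
Proof. by move=> [H _ _]; exact: H. Qed.

Lemma lincombE a u v f : (a *: u + v) f = a * u f + v f.
Proof. by []. Qed.

Lemma tangent_lin p a u v : tangent p u -> tangent p v -> tangent p (a *: u + v).
Proof.
move=> [u0 ul um] [v0 vl vm]; split => [f nf|b f h sf sh|f h sf sh].
- by rewrite lincombE u0// v0// mulr0 addr0.
- by rewrite !lincombE ul// vl//; ring.
- by rewrite !lincombE um// vm//; ring.
Qed.

Lemma tangent0 p : tangent p 0.
Proof.
by split=> [//|a f h _ _|f h _ _]; rewrite -[_ (fun x => _)]/(0 : R) -[0 f]/(0 : R) -[0 h]/(0 : R) ?mulr0 ?addr0.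
Qed.

Lemma tangentD p u v : tangent p u -> tangent p v -> tangent p (u + v).
Proof. by move=> tu tv; rewrite -[u]scale1r; exact: tangent_lin. Qed.

Lemma tangentZ p a u : tangent p u -> tangent p (a *: u).
Proof. by move=> tu; rewrite -[_ *: _]addr0; apply: tangent_lin => //; exact: tangent0. Qed.

Lemma tangentN p u : tangent p u -> tangent p (- u).
Proof. by move=> tu; rewrite -scaleN1r; exact: tangentZ. Qed.

Lemma tangentB p u v : tangent p u -> tangent p v -> tangent p (u - v).
Proof. by move=> tu tv; apply: tangentD => //; exact: tangentN. Qed.

Lemma tangent_sum p (I : Type) (r : seq I) (P : pred I) (F : I -> (M -> R) -> R) :
  (forall i, P i -> tangent p (F i)) -> tangent p (\sum_(i <- r | P i) F i).
Proof.
move=> H; elim/big_ind : _ => //; first exact: tangent0.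
by move=> x y; exact: tangentD.
Qed.

Lemma tangent_cst p v a : tangent p v -> v (fun=> a) = 0.
Proof.
move=> [_ vl vm]; have s1 := @smooth_fun_cst R n M 1; have s0 := @smooth_fun_cst R n M 0.
have v1 : v (fun=> 1) = 0.
  have := vm _ _ s1 s1; rewrite mulr1 mul1r => E.
  by apply/eqP; rewrite -[eqbLHS](addrK (v (fun=> 1))) -E subrr.
have v0 : v (fun=> 0) = 0.
  have := vl 1 _ _ s0 s0; rewrite mulr0 addr0 mul1r => E.
  by apply/eqP; rewrite -[eqbLHS](addrK (v (fun=> 0))) -E subrr.
have -> : (fun=> a) = (fun x : M => a * 1 + 0).
  by apply/funext => x; rewrite mulr1 addr0.
by rewrite (vl a _ _ s1 s0) v1 v0 mulr0 addr0.
Qed.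

Lemma tangent_linE p v a f h : tangent p v -> smooth_fun f -> smooth_fun h ->
  v (fun x => a * f x + h x) = a * v f + v h.
Proof. by move=> [_ H _]; exact: H. Qed.

Lemma tangent_addE p v f h : tangent p v -> smooth_fun f -> smooth_fun h ->
  v (fun x => f x + h x) = v f + v h.
Proof.
move=> tv sf sh; rewrite -[v f]mul1r -(tangent_linE 1 tv sf sh).
by congr v; apply/funext => x; rewrite mul1r.
Qed.

Lemma tangent_mulE p v f h : tangent p v -> smooth_fun f -> smooth_fun h ->
  v (fun x => f x * h x) = f p * v h + h p * v f.
Proof. by move=> [_ _]; exact. Qed.

Lemma tangent_sumE p v (I : Type) (r : seq I) (F : I -> M -> R) : tangent p v ->
  (forall i, smooth_fun (F i)) ->
  v (fun x => \sum_(i <- r) F i x) = \sum_(i <- r) v (F i).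
Proof.
move=> tv sF; elim: r => [|i r IH].
  by rewrite big_nil; under eq_fun do rewrite big_nil; exact: tangent_cst tv.
rewrite big_cons -IH; under eq_fun do rewrite big_cons.
apply: (tangent_addE tv (sF i)).
by apply: smooth_fun_sum => j _; exact: sF.
Qed.

End tangent_vectors.

Section differentials.
Context {R : realType}.

Lemma tdiffE m n (M : manifoldType R m) (N : manifoldType R n) (F : M -> N) v f :
  smooth_fun f -> tdiff F v f = v (f \o F).
Proof. by move=> sf; rewrite /tdiff asboolT. Qed.

Lemma tdiff_tangent m n (M : manifoldType R m) (N : manifoldType R n)
    (F : M -> N) p v : smooth_map F -> tangent p v -> tangent (F p) (tdiff F v).
Proof.
move=> sF tv; split=> [f nf|a f h sf sh|f h sf sh].
- by rewrite /tdiff asboolF.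
- have slin : smooth_fun (fun x => a * f x + h x).
    by apply: smooth_funD => //; apply: smooth_funM => //; exact: smooth_fun_cst.
  rewrite !tdiffE//; apply: (tangent_linE a tv); exact: smooth_fun_compose.
- have smul : smooth_fun (fun x => f x * h x) by exact: smooth_funM.
  rewrite !tdiffE//; apply: (tangent_mulE tv); exact: smooth_fun_compose.
Qed.

Lemma tdiff_lin m n (M : manifoldType R m) (N : manifoldType R n)
    (F : M -> N) a u v : tdiff F (a *: u + v) = a *: tdiff F u + tdiff F v.
Proof.
apply/funext => f; rewrite lincombE /tdiff; case: asboolP => // _.
by rewrite mulr0 addr0.
Qed.

Lemma tdiff0 m n (M : manifoldType R m) (N : manifoldType R n)
    (F : M -> N) : tdiff F 0 = 0.
Proof. by apply/funext => f; rewrite /tdiff; case: asboolP. Qed.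

Lemma tdiffB m n (M : manifoldType R m) (N : manifoldType R n)
    (F : M -> N) u v : tdiff F (u - v) = tdiff F u - tdiff F v.
Proof. by rewrite -scaleN1r addrC tdiff_lin scaleN1r addrC. Qed.

Lemma tdiff_comp m n q (M : manifoldType R m) (N : manifoldType R n)
    (Q : manifoldType R q) (F : M -> N) (H : N -> Q) v :
  smooth_map H -> tdiff H (tdiff F v) = tdiff (fun x => H (F x)) v.
Proof.
move=> sH; apply/funext => f; rewrite /tdiff; case: asboolP => // sf.
by rewrite asboolT//; exact: smooth_fun_compose.
Qed.

End differentials.

Section velocities.
Context {R : realType}.

Lemma velocityE n (M : manifoldType R n) (c : R -> M) t f :
  smooth_fun f -> velocity c t f = derive1 (f \o c) t.
Proof. by move=> sf; rewrite /velocity asboolT. Qed.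

Lemma smooth_curve_diff n (M : manifoldType R n) (U : set R) (c : R -> M) t f :
  smooth_into U c -> open U -> U t -> smooth_fun f -> differentiable (f \o c) t.
Proof.
by move=> sc oU Ut sf; apply: smooth_on_diff (smooth_fun_comp sc sf oU) Ut.
Qed.

Lemma velocity_diff n (M : manifoldType R n) (U : set R) (c : R -> M) t f :
  smooth_into U c -> open U -> U t -> smooth_fun f ->
  velocity c t f = 'd (f \o c) t 1.
Proof.
move=> sc oU Ut sf; rewrite velocityE// derive1E'//.
exact: smooth_curve_diff sc oU Ut sf.
Qed.

Lemma velocity_is_derive n (M : manifoldType R n) (U : set R) (c : R -> M) t f :
  smooth_into U c -> open U -> U t -> smooth_fun f ->
  is_derive t 1 (fun s => f (c s)) (velocity c t f).
Proof.
move=> sc oU Ut sf; rewrite (velocity_diff sc oU Ut sf).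
exact: is_diff_derive1 (differentiableP (smooth_curve_diff sc oU Ut sf)).
Qed.

Lemma velocity_derive n (M : manifoldType R n) (c : R -> M) (t : R) (f : M -> R) l :
  smooth_fun f -> is_derive t 1 (fun s => f (c s)) l -> velocity c t f = l.
Proof. by move=> sf dl; rewrite velocityE// derive1E; case: dl. Qed.

Lemma tangent_velocity n (M : manifoldType R n) (U : set R) (c : R -> M) t :
  smooth_into U c -> open U -> U t -> tangent (c t) (velocity c t).
Proof.
move=> sc oU Ut; split=> [f nf|a f h sf sh|f h sf sh].
- by rewrite /velocity asboolF.
- have slin : smooth_fun (fun x => a * f x + h x).
    by apply: smooth_funD => //; apply: smooth_funM => //; exact: smooth_fun_cst.
  have df := velocity_is_derive sc oU Ut sf.
  have dh := velocity_is_derive sc oU Ut sh.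
  by apply: velocity_derive => //; exact: (is_deriveD (is_deriveZ a df) dh).
- have smul : smooth_fun (fun x => f x * h x) by exact: smooth_funM.
  have df := velocity_is_derive sc oU Ut sf.
  have dh := velocity_is_derive sc oU Ut sh.
  by apply: velocity_derive => //; exact: (is_deriveM df dh).
Qed.

Lemma velocity_near n (M : manifoldType R n) (c d : R -> M) t :
  (\forall s \near t, c s = d s) -> velocity c t = velocity d t.
Proof.
move=> cd; apply/funext => f; rewrite /velocity; case: asboolP => // _.
rewrite !derive1E; apply: near_eq_derive.
by apply: filterS cd => s /= ->.
Qed.

Lemma tdiff_velocity m n (M : manifoldType R m) (N : manifoldType R n)
    (F : M -> N) (c : R -> M) t : smooth_map F ->
  tdiff F (velocity c t) = velocity (fun s => F (c s)) t.
Proof.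
move=> sF; apply/funext => f; rewrite /tdiff /velocity; case: asboolP => // sf.
by rewrite asboolT//; exact: smooth_fun_compose.
Qed.

Lemma velocity_cst n (M : manifoldType R n) (a : M) t : velocity (fun _ : R => a) t = 0.
Proof.
apply/funext => f; rewrite /velocity; case: asboolP => // sf.
exact: derive1_cst.
Qed.

Lemma smooth_into_fst (E W : normedModType R) n (M : manifoldType R n) (U : set E) (V : set W)
    (c : E -> M) : finite_dim E -> open U -> open V -> smooth_into U c ->
  smooth_into (U `*` V) (fun z : E * W => c z.1).
Proof.
move=> fE oU oV sc.
apply: (smooth_into_comp fE sc) => //; last exact: openX.
- exact: smooth_on_fst.
- by move=> [x y] [].
Qed.

Lemma smooth_into_snd (E W : normedModType R) n (M : manifoldType R n) (U : set E) (V : set W)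
    (c : W -> M) : finite_dim W -> open U -> open V -> smooth_into V c ->
  smooth_into (U `*` V) (fun z : E * W => c z.2).
Proof.
move=> fE oU oV sc.
apply: (smooth_into_comp fE sc) => //; last exact: openX.
- exact: smooth_on_snd.
- by move=> [x y] [].
Qed.

(** The Leibniz rule for curves: the function (s, s') |-> f (F (c1 s) (c2 s')) has a linear
    differential at (t, t), and (1, 1) = (1, 0) + (0, 1). *)
Lemma velocity_map2 m1 m2 n (M1 : manifoldType R m1) (M2 : manifoldType R m2)
    (N : manifoldType R n) (F : M1 -> M2 -> N) (U : set R) (c1 : R -> M1)
    (c2 : R -> M2) t : smooth_map2_on [set: M1 * M2] F -> smooth_into U c1 ->
  smooth_into U c2 -> open U -> U t ->
  velocity (fun s => F (c1 s) (c2 s)) t =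
  velocity (fun s => F (c1 s) (c2 t)) t + velocity (fun s => F (c1 t) (c2 s)) t.
Proof.
move=> sF s1 s2 oU Ut; apply/funext => f; rewrite fctE /velocity.
case: asboolP => sf; last by rewrite addr0.
have oUU : open (U `*` U) by exact: openX.
have sG : smooth_into (U `*` U) (fun z : R * R => F (c1 z.1) (c2 z.2)).
  apply: (smooth_map2_comp _ _ sF oUU).
    exact: smooth_into_fst finite_dimR _ _ s1.
  exact: smooth_into_snd finite_dimR _ _ s2.
pose H (z : R * R) := f (F (c1 z.1) (c2 z.2)).
have dH : differentiable H (t, t).
  by apply: (smooth_on_diff (smooth_fun_comp sG sf oUU)).
have did : is_diff t (fun s : R => s) (fun s : R => s) by exact: is_diff_id.
have dc : is_diff t (fun _ : R => t) (fun _ : R => 0 : R) by exact: is_diff_cst.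
have dp (a b : R -> R) da db : differentiable H (a t, b t) ->
    is_diff t a da -> is_diff t b db ->
    derive1 (fun s => H (a s, b s)) t = 'd H (a t, b t) (da 1, db 1).
  move=> dHab ha hb.
  have hab : is_diff t (fun s => (a s, b s)) (fun s => (da s, db s)) by exact: is_diff_pair.
  have [_ d2] := is_diff_derive1 (is_diff_comp hab (differentiableP dHab)).
  by rewrite derive1E; exact: d2.
have E1 : derive1 (fun s => H (s, s)) t = 'd H (t, t) (1, 1) := dp _ _ _ _ dH did did.
have E2 : derive1 (fun s => H (s, t)) t = 'd H (t, t) (1, 0) := dp _ _ _ _ dH did dc.
have E3 : derive1 (fun s => H (t, s)) t = 'd H (t, t) (0, 1) := dp _ _ _ _ dH dc did.
apply: (etrans E1); apply/esym; apply: (etrans (congr2 +%R E2 E3)).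
rewrite -linearD; congr ('d H (t, t) _).
by apply/pair_equal_spec; rewrite /= addr0 add0r.
Qed.

End velocities.

Section diff_rules.
Context {R : realType} {E : normedModType R}.
Implicit Types (f h : E -> R) (x v : E).

Lemma diff_lincomb a f h x : differentiable f x -> differentiable h x ->
  forall v, 'd (fun y => a * f y + h y) x v = a * 'd f x v + 'd h x v.
Proof.
move=> df dh v; rewrite -[fun y => _]/(a *: f + h).
rewrite (diffD (differentiableZ a df) dh).
exact: (congr1 (fun z => z + 'd h x v) (congr1 (fun k => k v) (diffZ a df))).
Qed.

Lemma diff_prod f h x : differentiable f x -> differentiable h x ->
  forall v, 'd (fun y => f y * h y) x v = f x * 'd h x v + h x * 'd f x v.
Proof. by move=> df dh v; exact: (congr1 (fun k => k v) (diffM df dh)). Qed.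

End diff_rules.

Section local_coordinates.
Context {R : realType} {n : nat} {M : manifoldType R n}.
Implicit Types (phi psi : chart R n M) (p : M).

Lemma smooth_in_chart phi psi (V : set 'rV[R]_n) (h : 'rV[R]_n -> R) :
  atlas phi -> atlas psi -> smooth_on V h -> open V ->
  smooth_on (psi @` (chart_dom psi `&` (chart_dom phi `&` phi @^-1` V)))
    (fun y => h (phi (chart_inv psi y))).
Proof.
move=> aphi apsi sh oV.
have oD : open (chart_dom phi `&` phi @^-1` V).
  by apply: open_capl_preimage => //; [exact: chart_dom_open|exact: chart_map_cts].
apply: (@smooth_on_comp_real _ _ _ _ V (fun y => phi (chart_inv psi y))) => //.
- exact: finite_dim_row.
- exact: open_chart_image.
- by move=> _ [x [dx [ex Vx]] <-]; rewrite chart_mapK.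
- have H : smooth_on (psi @` (chart_dom psi `&` chart_dom phi))
      (fun y => phi (chart_inv psi y)) by exact: atlas_compat.
  apply: smooth_on_sub H.
  by move=> _ [x [dx [ex Vx]] <-]; exists x.
Qed.

(* Cutting off in a chart: [B] is a bump function which turns functions defined
   near [phi p] into globally smooth functions on [M]. *)
Lemma chart_extension phi p : atlas phi -> chart_dom phi p ->
  exists r : R, exists B : 'rV[R]_n -> R,
  [/\ 0 < r, ball (phi p) r `<=` phi @` chart_dom phi,
      smooth_on setT B /\ (forall y, ~ ball (phi p) r y -> B y = 0),
      \forall y \near phi p, B y = 1 &
      forall h, smooth_on (ball (phi p) r) h ->
        smooth_fun (fun x => if `[< chart_dom phi x >] then B (phi x) * h (phi x) else 0)].
Proof.
move=> aphi dp.
have /nbhs_ballP[r /= r0 rW] := open_nbhs_nbhs (conj (chart_cod_open phi) (chart_image dp)).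
have r20 : 0 < r / 2 by rewrite divr_gt0.
have r2r : r / 2 < r by rewrite ltr_pdivrMr// ltr_pMr// ltr1n.
have [B [sB B1 B0]] := smooth_bump (phi p) r20.
have B0' y : ~ ball (phi p) r y -> B y = 0.
  move=> ny; apply: B0; rewrite leNgt; apply/negP => yr; apply: ny.
  by rewrite -ball_normE/= distrC (lt_trans yr).
exists r, B; split=> // h sh psi apsi.
pose C := [set y : 'rV[R]_n | `|y - phi p| <= r / 2].
have Cr y : C y -> ball (phi p) r y.
  by move=> Cy; rewrite -ball_normE/= distrC; exact: le_lt_trans Cy r2r.
pose K := chart_inv phi @` C.
(* The extension vanishes outside [K]. Being compact in a Hausdorff space, [K] is closed, so the
   open set where the extension is 0 and the chart domain together leave no boundary point at which
   smoothness could fail. *)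
have cK : closed K.
  apply: compact_closed; first exact: manifold_hausdorff.
  apply: continuous_compact; last exact: compact_closed_cube (ltW r20).
  apply: continuous_in_subspaceT => y; rewrite inE => Cy.
  by apply: chart_inv_cts; apply: rW; exact: Cr.
have Kd x : K x -> chart_dom phi x /\ C (phi x).
  by move=> [y Cy <-]; have [-> ?] := chart_invK (rW _ (Cr _ Cy)).
have ob : open (ball (phi p) r) by exact: ball_open.
apply: smooth_on_local => _ [x dx <-].
have [Kx|nKx] := pselect (K x).
  have [ex Cx] := Kd x Kx.
  exists (psi @` (chart_dom psi `&` (chart_dom phi `&` phi @^-1` ball (phi p) r))).
  split; first by exists x => //; split=> //; split=> //; exact: Cr.
  have oD : open (chart_dom phi `&` phi @^-1` ball (phi p) r).
    by apply: open_capl_preimage => //; [exact: chart_dom_open|exact: chart_map_cts].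
  have sBh : smooth_on (ball (phi p) r) (fun y => B y * h y).
    by apply: smooth_onM => //; apply: smooth_on_sub sB.
  apply: smooth_on_congr (smooth_in_chart aphi apsi sBh ob); first exact: open_chart_image.
  move=> _ [y [dy [ey _]] <-]; rewrite chart_mapK//.
  by case: asboolP.
exists (psi @` (chart_dom psi `&` ~` K)); split; first by exists x.
have oK : open (~` K) by exact: closed_openC.
apply: smooth_on_congr (@smooth_on_cst _ _ _ _ 0); first exact: open_chart_image.
move=> _ [y [dy nKy] <-]; rewrite chart_mapK//; case: asboolP => // ey.
rewrite B0 ?mul0r// leNgt; apply/negP => /ltW Cy; apply: nKy.
by exists (phi y) => //; rewrite chart_mapK.
Qed.

Lemma near_chart phi p (P : 'rV[R]_n -> Prop) : chart_dom phi p ->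
  (\forall y \near phi p, P y) -> \forall x \near p, chart_dom phi x /\ P (phi x).
Proof.
move=> dp HP; near=> x; split.
  by near: x; exact: (open_nbhs_nbhs (conj (chart_dom_open phi) dp)).
by near: x; exact: (chart_map_cts dp HP).
Unshelve. all: by end_near. Qed.

(** Hadamard's lemma in the chart writes f near [p] as f p plus the sum of the z_i g_i, where g_i
    takes at [p] the value of the i-th partial derivative. In v (z_i g_i) the Leibniz rule leaves
    only g_i(p) v(z_i), because z_i vanishes at [p]. *)
Lemma derivation_coordinates phi p : atlas phi -> chart_dom phi p ->
  exists z : 'I_n -> M -> R,
  [/\ forall i, smooth_fun (z i),
      \forall x \near p, forall i, z i x = phi x ord0 i - phi p ord0 i &
      forall v f, tangent p v -> smooth_fun f ->
        v f = \sum_i 'd (f \o chart_inv phi) (phi p) (delta_mx ord0 i) * v (z i)].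
Proof.
move=> aphi dp; have [r [B [r0 rW [sB B0] B1 ext]]] := chart_extension aphi dp.
pose e h x := if `[< chart_dom phi x >] then B (phi x) * h (phi x) else 0 : R.
have sco i : smooth_on (ball (phi p) r) (fun y : 'rV[R]_n => y ord0 i - phi p ord0 i).
  apply: smooth_onD; [exact: ball_open|exact: smooth_on_coord|exact: smooth_on_cst].
exists (fun i => e (fun y => y ord0 i - phi p ord0 i)); split.
- by move=> i; apply: ext; exact: sco.
- have := near_chart dp B1; apply: filterS => x [dx Bx] i.
  by rewrite /e asboolT// Bx mul1r.
move=> v f tv sf.
have sfi : smooth_on (ball (phi p) r) (f \o chart_inv phi).
  by apply: smooth_on_sub (sf _ aphi).
have [g [sg fg gp]] := hadamard r0 sfi.
pose chi := e (fun=> 1).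
have schi : smooth_fun chi by apply: ext; exact: smooth_on_cst.
have chip : chi p = 1.
  by rewrite /chi /e asboolT// (nbhs_singleton B1) mulr1.
have sz i := ext _ (sco i); have sgi i := ext _ (sg i).
(* The factor [chi ^ 2] localizes Hadamard's expansion; [v] ignores it since
   [chi p = 1] and [f - f p] vanishes at [p]. *)
have E : (fun x => (chi x * chi x) * (-1 * f p + f x)) =
         (fun x => \sum_i e (fun y => y ord0 i - phi p ord0 i) x * e (g i) x).
  apply/funext => x; rewrite /chi /e.
  case: asboolP => dx; last by rewrite !mul0r big1// => i _; rewrite mulr0.
  have [xr|/B0->] := pselect (ball (phi p) r (phi x)); last first.
    by rewrite !mul0r big1// => i _; rewrite !mul0r.
  have := fg _ xr; rewrite /= !chart_mapK// => ->.
  by rewrite mulN1r addrA addNr add0r mulr_sumr; apply: eq_bigr => i _; ring.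
have sf1 : smooth_fun (fun x => -1 * f p + f x).
  by apply: smooth_funD => //; exact: smooth_fun_cst.
have := congr1 v E.
rewrite (tangent_mulE tv (smooth_funM schi schi) sf1) chip.
rewrite mulN1r addNr mul0r addr0 !mul1r.
rewrite (tangent_addE tv (smooth_fun_cst _) sf) (tangent_cst _ tv) add0r => ->.
rewrite (tangent_sumE _ tv) => [|i]; last exact: smooth_funM (sz i) (sgi i).
apply: eq_bigr => i _; rewrite (tangent_mulE tv (sz i) (sgi i)).
rewrite {1}/e asboolT// subrr mulr0 mul0r add0r.
by rewrite (nbhs_singleton B1) mul1r gp.
Qed.

(** Smoothness of metrics and connections is tested on global vector fields only. The coordinate
    derivations become such fields after multiplication by a bump function, and are unchanged on the
    neighborhood [U] where it equals 1. *)
Lemma coordinate_frame phi p : atlas phi -> chart_dom phi p ->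
  exists X : 'I_n -> M -> (M -> R) -> R, exists U : set M,
  [/\ forall i, vector_field (X i), open U, U p, U `<=` chart_dom phi &
      forall i x f, U x -> smooth_fun f ->
        X i x f = 'd (f \o chart_inv phi) (phi x) (delta_mx ord0 i)].
Proof.
move=> aphi dp; have [r [B [r0 rW [sB B0] B1 ext]]] := chart_extension aphi dp.
pose X i x f := if `[< smooth_fun f >] then
  if `[< chart_dom phi x >] then
    B (phi x) * 'd (f \o chart_inv phi) (phi x) (delta_mx ord0 i) else 0 else 0 : R.
have : nbhs p [set x | chart_dom phi x /\ B (phi x) = 1] := near_chart dp B1.
rewrite nbhsE => -[U [oU Up] UB].
exists X, U; split=> //.
- move=> i; split=> [x|f sf]; last first.
    rewrite /X; under eq_fun do rewrite asboolT//.
    apply: (ext (fun y => 'd (f \o chart_inv phi) y (delta_mx ord0 i))).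
    by apply: smooth_on_dd; apply: smooth_on_sub (sf _ aphi).
  have df f : smooth_fun f -> chart_dom phi x ->
      differentiable (f \o chart_inv phi) (phi x).
    by move=> sf dx; apply: (smooth_on_diff (sf _ aphi)); exact: chart_image.
  have XT f : smooth_fun f -> X i x f = if `[< chart_dom phi x >] then
      B (phi x) * 'd (f \o chart_inv phi) (phi x) (delta_mx ord0 i) else 0.
    by move=> sf; rewrite /X asboolT.
  split=> [f nf|a f h sf sh|f h sf sh].
  + by rewrite /X asboolF.
  + have slin : smooth_fun (fun x => a * f x + h x).
      by apply: smooth_funD => //; apply: smooth_funM => //; exact: smooth_fun_cst.
    rewrite !XT//; case: asboolP => dx; last by rewrite mulr0 addr0.
    have E := diff_lincomb a (df f sf dx) (df h sh dx) (delta_mx ord0 i).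
    apply: (etrans (congr1 (fun z => B (phi x) * z) E)).
    by move: ('d (f \o _) _ _) ('d (h \o _) _ _) (B _) => D1 D2 b; ring.
  + have smul : smooth_fun (fun x => f x * h x) by exact: smooth_funM.
    rewrite !XT//; case: asboolP => dx; last by rewrite !mulr0 addr0.
    have E := diff_prod (df f sf dx) (df h sh dx) (delta_mx ord0 i).
    rewrite /= (chart_mapK dx) in E.
    apply: (etrans (congr1 (fun z => B (phi x) * z) E)).
    by move: ('d (f \o _) _ _) ('d (h \o _) _ _) (B _) => D1 D2 b; ring.
- by move=> x /UB[].
- move=> i x f /UB[dx Bx] sf; rewrite /X !asboolT// Bx mul1r//.
Qed.

Lemma velocity_frame phi (X : 'I_n -> M -> (M -> R) -> R) (U : set M)
    (J : set R) (c : R -> M) t : atlas phi -> U `<=` chart_dom phi ->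
  (forall i, vector_field (X i)) ->
  (forall i x f, U x -> smooth_fun f ->
        X i x f = 'd (f \o chart_inv phi) (phi x) (delta_mx ord0 i)) ->
  smooth_into J c -> open J -> J t -> U (c t) ->
  velocity c t = \sum_i 'd (fun s => phi (c s) ord0 i) t 1 *: X i (c t).
Proof.
move=> aphi Ud vX XE sc oJ Jt Ut; apply/funext => f.
rewrite fct_sumE.
have [sf|nf] := pselect (smooth_fun f); last first.
  rewrite /velocity asboolF// big1// => i _.
  by rewrite -[(_ *: _) f]/(_ * _) (tangent_nonsmooth ((vX i).1 (c t)))// mulr0.
have dc : chart_dom phi (c t) by exact: Ud.
have oV := smooth_into_open oJ sc (chart_dom_open phi).
have sV := sc.2 _ aphi.
have Vt : (J `&` c @^-1` chart_dom phi) t by [].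
have dphi : differentiable (fun s => phi (c s)) t := smooth_on_diff sV Vt.
have df : differentiable (f \o chart_inv phi) (phi (c t)).
  by apply: (smooth_on_diff (sf _ aphi)); exact: chart_image.
rewrite (velocity_diff sc oJ Jt sf).
have nE : \forall s \near t, ((f \o chart_inv phi) \o (fun s => phi (c s))) s = (f \o c) s.
  apply: filterS (open_nbhs_nbhs (conj oV Vt)) => s [_ ds] /=.
  by rewrite chart_mapK.
rewrite (near_diff nE (differentiable_comp dphi df)) (diff_comp dphi df) /=.
rewrite linear_row; apply: eq_bigr => i _.
rewrite -[RHS]/('d (fun s => phi (c s) ord0 i) t 1 * X i (c t) f) XE//; congr (_ * _).
have H := is_diff_comp (differentiableP dphi)
  (differentiableP (linear_differentiable (phi (c t)) (@coordmx_lin_continuous R 1 n ord0 i))).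
have [_ E] := H; have E1 := congr1 (fun h => h 1) E.
rewrite /= (diff_lin _ (@coordmx_lin_continuous R 1 n ord0 i)) in E1.
exact: esym E1.
Qed.

End local_coordinates.

(** * Metrics and connections along curves *)

Section metrics.
Context {R : realType} {n : nat} {M : manifoldType R n} (g : metric_on M).
Hypothesis gR : riemannian g.
Implicit Types (p : M) (u v w : (M -> R) -> R).

Lemma riem_linl p a u v w : tangent p u -> tangent p v -> tangent p w ->
  g p (a *: u + v) w = a * g p u w + g p v w.
Proof. by case: gR => H _ _ _; exact: H. Qed.

Lemma riem_sym p v w : tangent p v -> tangent p w -> g p v w = g p w v.
Proof. by case: gR => _ H _ _; exact: H. Qed.

Lemma riem_0l p w : tangent p w -> g p 0 w = 0.
Proof.
move=> tw; have t0 := tangent0 p; have := riem_linl 1 t0 t0 tw.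
rewrite scaler0 addr0 mul1r => E.
by apply/eqP; rewrite -[eqbLHS](addrK (g p 0 w)) -E subrr.
Qed.

Lemma riem_ge0 p v : tangent p v -> 0 <= g p v v.
Proof.
move=> tv; have [->|/eqP v0] := eqVneq v 0; first by rewrite riem_0l//; exact: tangent0.
by rewrite ltW//; case: gR => _ _ H _; exact: H.
Qed.

Lemma riem_gt0 p v : tangent p v -> v <> 0 -> 0 < g p v v.
Proof. by case: gR => _ _ H _; exact: H. Qed.

Lemma riem_suml p (I : Type) (r : seq I) (a : I -> R) (X : I -> (M -> R) -> R) w :
  (forall i, tangent p (X i)) -> tangent p w ->
  g p (\sum_(i <- r) a i *: X i) w = \sum_(i <- r) a i * g p (X i) w.
Proof.
move=> tX tw; elim: r => [|i r IH]; first by rewrite !big_nil riem_0l.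
rewrite !big_cons riem_linl// ?IH//.
by apply: tangent_sum => j _; exact: tangentZ.
Qed.

Lemma riem_sumr p (I : Type) (r : seq I) (a : I -> R) (X : I -> (M -> R) -> R) w :
  (forall i, tangent p (X i)) -> tangent p w ->
  g p w (\sum_(i <- r) a i *: X i) = \sum_(i <- r) a i * g p w (X i).
Proof.
move=> tX tw; rewrite riem_sym//; last first.
  by apply: tangent_sum => j _; exact: tangentZ.
by rewrite riem_suml//; apply: eq_bigr => i _; rewrite riem_sym.
Qed.

Lemma riem_addl p u v w : tangent p u -> tangent p v -> tangent p w ->
  g p (u + v) w = g p u w + g p v w.
Proof. by move=> tu tv tw; have := riem_linl 1 tu tv tw; rewrite scale1r mul1r. Qed.

Lemma riem_addr p u v w : tangent p u -> tangent p v -> tangent p w ->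
  g p w (u + v) = g p w u + g p w v.
Proof.
move=> tu tv tw; rewrite riem_sym//; last exact: tangentD.
by rewrite riem_addl// (riem_sym tu tw) (riem_sym tv tw).
Qed.

Lemma riem_opp p v : tangent p v -> g p (- v) (- v) = g p v v.
Proof.
move=> tv; have tNv := tangentN tv.
have t0 := tangent0 p.
have E w : tangent p w -> g p (- v) w = - g p v w.
  by move=> tw; rewrite -scaleN1r -[_ *: _]addr0 riem_linl// riem_0l// addr0 mulN1r.
by rewrite E// riem_sym// E// opprK.
Qed.

(** A velocity is defined along the curve only, so the regularity of [g] does not apply to it
    directly. In a coordinate frame it is a combination of vector fields with smooth coefficients,
    and the squared speed becomes a quadratic expression in them. *)
Lemma metric_speed_smooth (U : set R) (c : R -> M) : smooth_into U c -> open U ->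
  smooth_on U (fun s => g (c s) (velocity c s) (velocity c s)).
Proof.
move=> sc oU; apply: smooth_on_local => t Ut.
have [phi aphi dt] := atlas_cover (c t).
have [X [V [vX oV Vt Vd XE]]] := coordinate_frame aphi dt.
pose J := U `&` c @^-1` V.
have oJ : open J by exact: smooth_into_open sc oV.
have scJ : smooth_into J c by apply: smooth_into_sub sc => s [].
exists J; split=> //.
pose a i s := 'd (fun s => phi (c s) ord0 i) s 1.
have sa i : smooth_on J (a i).
  apply: smooth_on_dd.
  have := smooth_into_chart scJ aphi (fun s Js => Vd _ Js.2).
  by move=> /(smooth_on_rowP _ oJ).
have sg i j : smooth_on J (fun s => g (c s) (X i (c s)) (X j (c s))).
  apply: (smooth_fun_comp scJ _ oJ (f := fun p => g p (X i p) (X j p))).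
  by case: gR => _ _ _ H; exact: H.
have H : smooth_on J (fun s => \sum_i a i s *
    \sum_j a j s * g (c s) (X i (c s)) (X j (c s))).
  apply: smooth_on_sum => // i _; apply: smooth_onM => //.
  by apply: smooth_on_sum => // j _; exact: smooth_onM.
apply: smooth_on_congr H => // s Js.
rewrite (velocity_frame aphi Vd vX XE scJ oJ Js Js.2).
have tX i : tangent (c s) (X i (c s)) := (vX i).1 (c s).
rewrite riem_suml//; last by apply: tangent_sum => j _; exact: tangentZ.
by apply: eq_bigr => i _; rewrite riem_sumr.
Qed.

End metrics.

Section tangent_basis.
Context {R : realType} {n : nat} {M : manifoldType R n}.

(** The functions [z] are dual to the basis [E]: evaluating a tangent vector at them gives its
    components, and the last clause serves to compare components in place of linear independence. *)
Lemma tangent_basis (phi : chart R n M) (p : M) : atlas phi -> chart_dom phi p ->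
  exists z : 'I_n -> M -> R, exists E : 'I_n -> (M -> R) -> R,
  [/\ forall i, smooth_fun (z i), forall i, tangent p (E i),
      forall i f, smooth_fun f ->
        E i f = 'd (f \o chart_inv phi) (phi p) (delta_mx ord0 i),
      forall v, tangent p v -> v = \sum_i v (z i) *: E i &
      forall i j, E i (z j) = (i == j)%:R].
Proof.
move=> aphi dp; have [z [sz zp Hz]] := derivation_coordinates aphi dp.
have [X [V [vX oV Vt Vd XE]]] := coordinate_frame aphi dp.
exists z, (fun i => X i p); split=> //.
- by move=> i; exact: (vX i).1.
- by move=> i f sf; exact: XE.
- move=> v tv; apply/funext => f; rewrite fct_sumE.
  have [sf|nf] := pselect (smooth_fun f); last first.
    rewrite (tangent_nonsmooth tv)// big1// => i _.
    by rewrite -[(_ *: _) f]/(_ * _) (tangent_nonsmooth ((vX i).1 p))// mulr0.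
  rewrite (Hz _ _ tv sf); apply: eq_bigr => i _.
  by rewrite -[(_ *: _) f]/(_ * _) XE// mulrC.
- move=> i j; rewrite XE//.
  pose h (y : 'rV[R]_n) := coordmx_lin ord0 j y + (- phi p ord0 j).
  have nE : \forall y \near phi p, h y = (z j \o chart_inv phi) y.
    have H1 := open_nbhs_nbhs (conj (chart_cod_open phi) (chart_image dp)).
    have H2 : {for phi p, continuous (chart_inv phi)}.
      by apply: chart_inv_cts; exact: chart_image.
    have zp' : nbhs (chart_inv phi (phi p))
        (fun x => forall i, z i x = phi x ord0 i - phi p ord0 i).
      by rewrite chart_mapK.
    apply: filterS2 H1 (H2 _ zp') => y cy /= ->.
    by rewrite (chart_invK cy).1.
  have cl := @coordmx_lin_continuous R 1 n ord0 j.
  have d1 : is_diff (phi p) (coordmx_lin ord0 j) (coordmx_lin ord0 j).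
    by apply: DiffDef; [exact: linear_differentiable|rewrite diff_lin].
  have [_ E] := near_is_diff nE (is_diffD d1 (is_diff_cst (- phi p ord0 j) (phi p))).
  apply: (etrans (congr1 (fun k => k (delta_mx ord0 i)) E)).
  rewrite -[LHS]/(coordmx_lin ord0 j (delta_mx ord0 i) + 0) addr0 coordmx_linE.
  by rewrite mxE eqxx/= eq_sym.
Qed.

(** The equation in [ode_local] is stated coordinatewise; here the coordinates are reassembled into
    the derivative [w] of [x], to which the chain rule applies. *)
Lemma chart_curve_derive (x : R -> 'rV[R]_n) (w : 'rV[R]_n) (f : 'rV[R]_n -> R) (t : R) :
  differentiable x t -> (forall i, is_derive t 1 (fun s => x s ord0 i) (w ord0 i)) ->
  differentiable f (x t) -> is_derive t 1 (fun s => f (x s)) ('d f (x t) w).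
Proof.
move=> dx dw df.
have xw : 'd x t 1 = w.
  apply/rowP => i; have [_ <-] := dw i.
  have cl := @coordmx_lin_continuous R 1 n ord0 i.
  have dl := linear_differentiable (x t) cl.
  have [_ E] := is_diff_derive1 (is_diff_comp (differentiableP dx) (differentiableP dl)).
  have E3 := diff_lin (x t) cl.
  apply: (etrans _ (esym E)); exact: (esym (congr1 (fun k => k ('d x t 1)) E3)).
by rewrite -xw; exact: is_diff_derive1 (is_diff_comp (differentiableP dx) (differentiableP df)).
Qed.

End tangent_basis.

Section connections.
Context {R : realType} {k l : nat} {G : lieGroupType R k} {P : manifoldType R l}.
Variables (act : P -> G -> P) (theta : form_on G P).
Hypothesis th : principal_connection act theta.

Lemma connection_tangent p v : tangent p v -> tangent (1%g : G) (theta p v).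
Proof. by case: th => H _ _ _ _; exact: H. Qed.

Lemma connection_lin p a v w : tangent p v -> tangent p w ->
  theta p (a *: v + w) = a *: theta p v + theta p w.
Proof. by case: th => _ H _ _ _; exact: H. Qed.

Lemma connection0 p : theta p 0 = 0.
Proof.
have t0 := tangent0 p; have := connection_lin 1 t0 t0.
rewrite scaler0 addr0 scale1r => E.
by apply/eqP; rewrite -[eqbLHS](addrK (theta p 0)) -E subrr.
Qed.

Lemma connection_add p v w : tangent p v -> tangent p w ->
  theta p (v + w) = theta p v + theta p w.
Proof. by move=> tv tw; have := connection_lin 1 tv tw; rewrite !scale1r. Qed.

Lemma connection_sum p (I : Type) (r : seq I) (a : I -> R) (X : I -> (P -> R) -> R) :
  (forall i, tangent p (X i)) ->
  theta p (\sum_(i <- r) a i *: X i) = \sum_(i <- r) a i *: theta p (X i).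
Proof.
move=> tX; elim: r => [|i r IH]; first by rewrite !big_nil connection0.
rewrite !big_cons connection_lin// ?IH//.
by apply: tangent_sum => j _; exact: tangentZ.
Qed.

Lemma connection_velocity_smooth (U : set R) (c : R -> P) f :
  smooth_into U c -> open U -> smooth_fun f ->
  smooth_on U (fun s => theta (c s) (velocity c s) f).
Proof.
move=> sc oU sf; apply: smooth_on_local => t Ut.
have [phi aphi dt] := atlas_cover (c t).
have [X [V [vX oV Vt Vd XE]]] := coordinate_frame aphi dt.
pose J := U `&` c @^-1` V.
have oJ : open J by exact: smooth_into_open sc oV.
have scJ : smooth_into J c by apply: smooth_into_sub sc => s [].
exists J; split=> //.
pose a i s := 'd (fun s => phi (c s) ord0 i) s 1.
have sa i : smooth_on J (a i).
  apply: smooth_on_dd.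
  have := smooth_into_chart scJ aphi (fun s Js => Vd _ Js.2).
  by move=> /(smooth_on_rowP _ oJ).
have sg i : smooth_on J (fun s => theta (c s) (X i (c s)) f).
  apply: (smooth_fun_comp scJ _ oJ (f := fun p => theta p (X i p) f)).
  by case: th => _ _ H _ _; exact: H.
have H : smooth_on J (fun s => \sum_i a i s * theta (c s) (X i (c s)) f).
  by apply: smooth_on_sum => // i _; exact: smooth_onM.
apply: smooth_on_congr H => // s Js.
rewrite (velocity_frame aphi Vd vX XE scJ oJ Js Js.2).
by rewrite connection_sum ?fct_sumE// => i; exact: (vX i).1.
Qed.

End connections.

(** * The equation e' = e xi on a Lie group *)

Section left_ode.
Context {R : realType} {k : nat} {G : lieGroupType R k}.

(** In a chart at 1 with a = phi 1, the differential of the left translation by the point of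
    coordinates x is the partial differential of the multiplication [m] at (x, a) in its second
    variable, so the equation has a smooth right-hand side. Solutions with other initial values are
    left translates of this one. *)
Lemma left_ode (J : set R) (t0 : R) (xi : R -> (G -> R) -> R) : open J -> J t0 ->
  (forall t, J t -> tangent (1%g : G) (xi t)) ->
  (forall f, smooth_fun f -> smooth_on J (fun t => xi t f)) ->
  exists2 d, 0 < d & exists e : R -> G,
  [/\ smooth_into (ball t0 d) e, ball t0 d `<=` J, e t0 = 1%g &
      forall t, ball t0 d t ->
        velocity e t = tdiff (fun y => (e t * y)%g) (xi t)].
Proof.
move=> oJ Jt0 txi sxi.
have [phi aphi d1] := atlas_cover (1%g : G).
have [z [E [sz tE EE zE _]]] := tangent_basis aphi d1.
pose a := phi 1%g.
pose D := ([set (phi x.1, phi x.2) | x in (chart_dom phi `*` chart_dom phi) `&` [set: G * G]]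
  `&` (fun z : 'rV[R]_k * 'rV[R]_k => (chart_inv phi z.1 * chart_inv phi z.2)%g) @^-1` chart_dom phi).
pose m (z : 'rV[R]_k * 'rV[R]_k) := phi (chart_inv phi z.1 * chart_inv phi z.2)%g.
have sm := @lie_mul_smooth R k G phi phi aphi aphi.
have oD : open D.
  apply: smooth_into_open sm (chart_dom_open phi).
  rewrite (_ : _ @` _ = (phi @` chart_dom phi) `*` (phi @` chart_dom phi)).
    by apply: openX; exact: chart_cod_open.
  apply/seteqP; split=> [_ [[x y] [[/= dx dy] _] <-]|[_ _] [/= [x dx <-] [y dy <-]]].
    by split; exact: chart_image.
  by exists (x, y).
have smD : smooth_on D m := sm.2 _ aphi.
have Da x : (phi @` chart_dom phi) x -> D (x, a).
  move=> cx; split=> /=; last by rewrite chart_mapK// mulg1; exact: (chart_invK cx).2.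
  by case: cx => y dy <-; exists (y, 1%g).
have ma x : (phi @` chart_dom phi) x -> m (x, a) = x.
  by move=> cx; rewrite /m /= chart_mapK// mulg1 (chart_invK cx).1.
pose W := (J `*` (phi @` chart_dom phi)).
have oW : open W by apply: openX => //; exact: chart_cod_open.
pose F (tx : R * 'rV[R]_k) := \sum_i xi tx.1 (z i) *: 'd m (tx.2, a) (0, delta_mx ord0 i).
have sF : smooth_on W F.
  apply/(smooth_on_rowP _ oW) => j.
  have H : smooth_on W (fun tx : R * 'rV[R]_k =>
      \sum_i xi tx.1 (z i) * ('d m (tx.2, a) (0, delta_mx ord0 i)) ord0 j).
    apply: smooth_on_sum => // i _; apply: smooth_onM => //.
      apply: (@smooth_on_comp_real _ _ _ W J fst (fun t => xi t (z i))) => //.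
      - exact: finite_dimR.
      - by move=> [t x] [].
      - exact: smooth_on_fst.
      - exact: sxi.
    have sd := smooth_on_dd (0, delta_mx ord0 i) smD.
    have := (smooth_on_rowP _ oD).1 sd j.
    apply: (@smooth_on_comp_real _ _ _ W D (fun tx : R * 'rV[R]_k => (tx.2, a))) => //.
    - exact: finite_dim_pair (finite_dim_row k) (finite_dim_row k).
    - by move=> [t x] [/= _ cx]; exact: Da.
    - apply: smooth_on_pair => //; last exact: smooth_on_cst.
      exact: smooth_on_snd.
  by apply: smooth_on_congr H => // tx _; rewrite /F summxE; apply: eq_bigr => i _; rewrite mxE.
have W0 : W (t0, a) by split=> //; exact: chart_image.
have [d d0 [x [xt0 sx Hx]]] := ode_local oW W0 sF.
have ob : open (ball t0 d) by exact: ball_open.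
exists d => //; exists (fun t => chart_inv phi (x t)); split.
- apply: smooth_into_inv => // t /Hx[[]//].
- by move=> t /Hx[[]].
- by rewrite xt0 chart_mapK.
move=> t bt; have [[/= Jt cx] dx] := Hx t bt.
have se : smooth_into (ball t0 d) (fun t => chart_inv phi (x t)).
  by apply: smooth_into_inv => // s /Hx[[]//].
set et := chart_inv phi (x t).
have sL : smooth_map (fun y : G => (et * y)%g).
  exact: smooth_map2_compose (smooth_map_cst _) (@smooth_map_id _ _ G) (@lie_mul_smooth R k G).
apply/funext => f; have [sf|nf] := pselect (smooth_fun f); last first.
  by rewrite /velocity /tdiff !asboolF.
rewrite tdiffE// (zE _ (txi t Jt)) fct_sumE.
have sfL : smooth_fun (f \o (fun y => (et * y)%g)) by exact: smooth_fun_compose.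
have df : differentiable (f \o chart_inv phi) (x t).
  exact: smooth_on_diff (sf _ aphi) cx.
have dxt : differentiable x t := smooth_on_diff sx bt.
have -> : velocity (fun t => chart_inv phi (x t)) t f =
    'd (f \o chart_inv phi) (x t) (F (t, x t)).
  by apply: velocity_derive => //; exact: chart_curve_derive dxt dx df.
rewrite /F linear_sum; apply: eq_bigr => i _ /=.
rewrite linearZ -[RHS]/(xi t (z i) * E i _) EE//; congr (_ * _).
have dm : differentiable m (x t, a) by apply: smooth_on_diff smD (Da _ cx).
have dy : is_diff a (fun y : 'rV[R]_k => (x t, y)) (fun h => (0, h)).
  by apply: is_diff_pair.
have dfm : is_diff (m (x t, a)) (f \o chart_inv phi) ('d (f \o chart_inv phi) (x t)).
  by rewrite (ma _ cx); exact: differentiableP df.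
have dc := is_diff_comp dy (is_diff_comp (differentiableP dm) dfm).
have nE : \forall y \near a, ((f \o chart_inv phi) \o m \o (fun y => (x t, y))) y =
    ((f \o (fun y : G => (et * y)%g)) \o chart_inv phi) y.
  have cp : {for a, continuous (fun y : 'rV[R]_k => (x t, y))}.
    by case: dy => dd _; exact: differentiable_continuous.
  have nD : \forall y \near a, D (x t, y).
    exact: cp _ (open_nbhs_nbhs (conj oD (Da _ cx))).
  by apply: filterS nD => y [/= _ Dy]; rewrite /m /= chart_mapK.
have [_ E2] := near_is_diff nE dc.
exact: (esym (congr1 (fun h => h (delta_mx ord0 i)) E2)).
Qed.

End left_ode.

(** * Horizontal lifts in Riemannian submersions *)

Section gram.
Context {R : realType} (k r : nat) (B : 'M[R]_k) (A : 'M[R]_(k, r)).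
Hypothesis Bsym : B^T = B.
Hypothesis Bpos : forall u : 'rV[R]_k, u != 0 -> 0 < (u *m B *m u^T) ord0 ord0.
Hypothesis Afull : forall w : 'rV[R]_r, exists v : 'rV[R]_k, v *m A = w.

Lemma gram_unit : B \in unitmx.
Proof.
rewrite -row_free_unit; apply: inj_row_free => v vB.
apply/eqP; apply: contraT => /Bpos.
by rewrite vB mul0mx mxE ltxx.
Qed.

(** [B] stands for the Gram matrix of the metric upstairs and [A] for the matrix, acting on rows, of
    the differential of the submersion. The inverse of [S] is then the Gram matrix of the quotient
    inner product on the base. *)
Let S := A^T *m invmx B *m A.

(** If u S = 0, the vector y = u A^T B^-1 satisfies y B y^T = u S u^T = 0, so y = 0 and u A^T = 0.
    As every row is of the form v A, u is orthogonal to all rows. *)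
Lemma schur_unit : S \in unitmx.
Proof.
rewrite -row_free_unit; apply: inj_row_free => u uS.
pose y := u *m A^T *m invmx B.
have yB : y *m B = u *m A^T by rewrite mulmxKV ?gram_unit.
have y0 : y = 0.
  apply/eqP; apply: contraT => /Bpos.
  rewrite yB /y trmx_mul trmx_mul trmxK trmx_inv Bsym !mulmxA.
  by rewrite -(mulmxA u) -(mulmxA u) -/S uS mul0mx mxE ltxx.
have uA : u *m A^T = 0 by rewrite -yB y0 mul0mx.
apply/rowP => i; have [v vA] := Afull (delta_mx ord0 i).
have : u *m (delta_mx ord0 i : 'rV[R]_r)^T = 0 by rewrite -vA trmx_mul mulmxA uA mul0mx.
by rewrite trmx_delta -colE => /matrixP/(_ ord0 ord0); rewrite !mxE.
Qed.

(* The solution of [x *m A = z] orthogonal to the kernel of [A] for the inner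
   product [B]. *)
Definition hlift (z : 'rV[R]_r) : 'rV[R]_k := z *m invmx S *m A^T *m invmx B.

Lemma hliftK z : hlift z *m A = z.
Proof. by rewrite /hlift -!mulmxA (mulmxA A^T) -/S mulVmx ?schur_unit// mulmx1. Qed.

Lemma hlift_orthogonal (z : 'rV[R]_r) (u : 'rV[R]_k) : u *m A = 0 -> hlift z *m B *m u^T = 0.
Proof.
move=> uA; rewrite /hlift mulmxKV ?gram_unit// -mulmxA -trmx_mul uA.
by rewrite trmx0 mulmx0.
Qed.

End gram.

Section smooth_matrices.
Context {R : realType} {E : normedModType R}.

Definition smooth_mx m n (U : set E) (A : E -> 'M[R]_(m, n)) :=
  forall i j, smooth_on U (fun x => A x i j).

Lemma smooth_on_prod (U : set E) (I : Type) (s : seq I) (f : I -> E -> R) : open U ->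
  (forall i, smooth_on U (f i)) -> smooth_on U (fun x => \prod_(i <- s) f i x).
Proof.
move=> oU sf; elim: s => [|i s IH].
  by under eq_fun do rewrite big_nil; exact: smooth_on_cst.
by under eq_fun do rewrite big_cons; exact: smooth_onM.
Qed.

Lemma smooth_mx_mul m n p (U : set E) (A : E -> 'M[R]_(m, n)) (B : E -> 'M[R]_(n, p)) :
  open U -> smooth_mx U A -> smooth_mx U B -> smooth_mx U (fun x => A x *m B x).
Proof.
move=> oU sA sB i j; under eq_fun do rewrite mxE.
by apply: smooth_on_sum => // l _; exact: smooth_onM.
Qed.

Lemma smooth_mx_tr m n (U : set E) (A : E -> 'M[R]_(m, n)) :
  smooth_mx U A -> smooth_mx U (fun x => (A x)^T).
Proof. by move=> sA i j; under eq_fun do rewrite mxE; exact: sA. Qed.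

Lemma smooth_det n (U : set E) (A : E -> 'M[R]_n) : open U ->
  smooth_mx U A -> smooth_on U (fun x => \det (A x)).
Proof.
move=> oU sA; rewrite /determinant; apply: smooth_on_sum => // s _.
apply: smooth_onM => //; first exact: smooth_on_cst.
by apply: smooth_on_prod => // i; exact: sA.
Qed.

(** Cramer's formula: the entries are cofactors divided by the determinant. *)
Lemma smooth_mx_inv n (U : set E) (A : E -> 'M[R]_n) : open U ->
  (forall x, U x -> A x \in unitmx) ->
  smooth_mx U A -> smooth_mx U (fun x => invmx (A x)).
Proof.
move=> oU uA sA i j.
have H : smooth_on U (fun x => (\det (A x))^-1 *
    ((-1) ^+ (j + i) * \det (row' j (col' i (A x))))).
  apply: smooth_onM => //.
    apply: smooth_onV => //; last exact: smooth_det.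
    by move=> x /uA; rewrite unitmxE unitfE.
  apply: smooth_onM => //; first exact: smooth_on_cst.
  apply: smooth_det => // i' j'; under eq_fun do rewrite !mxE; exact: sA.
by apply: smooth_on_congr H => // x /uA Ux; rewrite /invmx Ux !mxE.
Qed.

End smooth_matrices.

Section submersions.
Context {R : realType} {k r : nat} {G : manifoldType R k} {Q : manifoldType R r}.
Variables (g : metric_on G) (gQ : metric_on Q) (q : G -> Q).
Hypothesis gR : riemannian g.
Hypothesis qS : submersion q.

(* In charts, [(x, z) |-> L (x, z)] is the horizontal lift at [x] of the
   coordinate vector [z] of the base, and [V x z] is the same lift as a tangent
   vector. *)
Lemma horizontal_frame (a0 : G) : exists (phi : chart R k G) (psi : chart R r Q)
    (D : set 'rV[R]_k) (L : 'rV[R]_k * 'rV[R]_r -> 'rV[R]_k)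
    (X : 'I_k -> G -> (G -> R) -> R),
  let V x z := \sum_i (L (x, z)) ord0 i *: X i (chart_inv phi x) in
  let kappa x := psi (q (chart_inv phi x)) in
  [/\ [/\ atlas phi, chart_dom phi a0, atlas psi & chart_dom psi (q a0)],
      [/\ open D, D (phi a0), D `<=` phi @` chart_dom phi &
        forall x, D x -> chart_dom psi (q (chart_inv phi x))],
      smooth_on D kappa /\ smooth_on (D `*` setT) L,
      forall x z, D x -> [/\ 'd kappa x (L (x, z)) = z,
        ker_orthogonal q g (chart_inv phi x) (V x z) &
        forall f, smooth_fun f -> V x z f = 'd (f \o chart_inv phi) x (L (x, z))] &
      forall x v, D x -> tangent (chart_inv phi x) v ->
        exists z, tdiff q v = tdiff q (V x z)].
Proof.
have [sq surj] := qS.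
have [phi aphi d0] := atlas_cover a0.
have [psi apsi e0] := atlas_cover (q a0).
have [X [U [vX oU Ua0 Ud XE]]] := coordinate_frame aphi d0.
pose C := phi @` (chart_dom phi `&` U).
have oC : open C by exact: open_chart_image.
have Cd : C `<=` phi @` chart_dom phi by move=> _ [x [dx _] <-]; exists x.
pose D := C `&` (fun x => q (chart_inv phi x)) @^-1` chart_dom psi.
have sqC : smooth_into C (fun x => q (chart_inv phi x)).
  exact: smooth_into_sub Cd (smooth_mapE sq aphi).
have oD : open D by exact: smooth_into_open sqC (chart_dom_open psi).
pose kappa x := psi (q (chart_inv phi x)).
have sk : smooth_on D kappa := sqC.2 _ apsi.
pose A x : 'M[R]_(k, r) := \matrix_(i, j) ('d kappa x (delta_mx ord0 i)) ord0 j.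
pose B x : 'M[R]_k := \matrix_(i, j)
  g (chart_inv phi x) (X i (chart_inv phi x)) (X j (chart_inv phi x)).
pose V x (u : 'rV[R]_k) := \sum_i u ord0 i *: X i (chart_inv phi x).
have tX i p : tangent p (X i p) by exact: (vX i).1.
have tV x u : tangent (chart_inv phi x) (V x u).
  by apply: tangent_sum => i _; exact: tangentZ.
have Dd x : D x -> chart_dom phi (chart_inv phi x) /\ phi (chart_inv phi x) = x.
  by move=> [/Cd cx _]; have [h1 h2] := chart_invK cx; split.
have DU x : D x -> U (chart_inv phi x).
  by move=> [[p [dp Up] <-] _]; rewrite chart_mapK.
have VE x u f : D x -> smooth_fun f -> V x u f = 'd (f \o chart_inv phi) x u.
  move=> Dx sf; rewrite /V fct_sumE linear_row; apply: eq_bigr => i _.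
  rewrite -[LHS]/(u ord0 i * X i (chart_inv phi x) f).
  by rewrite (XE _ _ _ (DU x Dx) sf) (Dd x Dx).2.
have Bg x u v : (u *m B x *m v^T) ord0 ord0 = g (chart_inv phi x) (V x u) (V x v).
  rewrite /V riem_suml//; last exact: tV.
  rewrite -mulmxA mxE; apply: eq_bigr => i _; congr (_ * _).
  rewrite riem_sumr// mxE; apply: eq_bigr => j _.
  by rewrite !mxE mulrC.
have Bsym x : (B x)^T = B x.
  by apply/matrixP => i j; rewrite !mxE riem_sym.
have basis x : D x -> exists z : 'I_k -> G -> R,
    (forall u j, V x u (z j) = u ord0 j) /\
    (forall v, tangent (chart_inv phi x) v -> v = V x (\row_i v (z i))).
  move=> Dx; have [dp ep] := Dd x Dx.
  have [z [E [sz tE EE zE dE]]] := tangent_basis aphi dp.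
  have EX i : E i = X i (chart_inv phi x).
    apply/funext => f; have [sf|nf] := pselect (smooth_fun f).
      by rewrite (EE _ _ sf) (XE _ _ _ (DU x Dx) sf).
    by rewrite (tangent_nonsmooth (tE i))// (tangent_nonsmooth (tX i _)).
  exists z; split=> [u j|v tv].
    rewrite /V fct_sumE (bigD1 j)//= big1 => [|i ij].
      by rewrite -EX -[(_ *: _) _]/(_ * _) dE eqxx mulr1 addr0.
    by rewrite -EX -[(_ *: _) _]/(_ * _) dE (negbTE ij) mulr0.
  by rewrite {1}(zE v tv) /V; apply: eq_bigr => i _; rewrite mxE EX.
have Bpos x : D x -> forall u : 'rV[R]_k, u != 0 -> 0 < (u *m B x *m u^T) ord0 ord0.
  move=> Dx u u0; rewrite Bg; apply: (riem_gt0 gR (tV x u)) => V0.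
  move/negP: u0; apply; apply/eqP/rowP => j.
  by have [z [<- _]] := basis x Dx; rewrite V0 mxE.
have tqV x : D x -> exists E : 'I_r -> (Q -> R) -> R,
    (forall i, tangent (q (chart_inv phi x)) (E i)) /\
    exists z : 'I_r -> Q -> R, (forall i j, E i (z j) = (i == j)%:R) /\
    forall u, tdiff q (V x u) = \sum_j (u *m A x) ord0 j *: E j.
  move=> Dx; have eq_ : chart_dom psi (q (chart_inv phi x)) := Dx.2.
  have [z [E [sz tE EE zE dE]]] := tangent_basis apsi eq_.
  exists E; split=> //; exists z; split=> // u.
  apply/funext => f; rewrite fct_sumE.
  have [sf|nf] := pselect (smooth_fun f); last first.
    rewrite /tdiff asboolF// big1// => j _.
    by rewrite -[(_ *: _) f]/(_ * _) (tangent_nonsmooth (tE j))// mulr0.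
  have sfq : smooth_fun (f \o q) by exact: smooth_fun_compose.
  rewrite tdiffE// VE//.
  have dk : differentiable kappa x := smooth_on_diff sk Dx.
  have df : differentiable (f \o chart_inv psi) (kappa x).
    by apply: (smooth_on_diff (sf _ apsi)); exact: chart_image.
  have nE : \forall y \near x, ((f \o chart_inv psi) \o kappa) y =
      ((f \o q) \o chart_inv phi) y.
    apply: filterS (open_nbhs_nbhs (conj oD Dx)) => y [_ ey] /=.
    by rewrite /kappa chart_mapK.
  have [_ E1] := near_is_diff nE (is_diff_comp (differentiableP dk) (differentiableP df)).
  apply: (etrans (congr1 (fun h => h u) E1)).
  rewrite /= linear_row; apply: eq_bigr => j _.
  rewrite -[RHS]/((u *m A x) ord0 j * E j f) EE//; congr (_ * _).
  rewrite mxE {1}(row_sum_delta u) linear_sum summxE; apply: eq_bigr => i _.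
  by rewrite linearZ !mxE.
(* The submersion property lifts the tangent vector with components [w]; the components of the lift,
   read off by the dual functions, form the required row. *)
have Afull x : D x -> forall w : 'rV[R]_r, exists v : 'rV[R]_k, v *m A x = w.
  move=> Dx w; have [E [tE [z [dE tqVE]]]] := tqV x Dx.
  have tw : tangent (q (chart_inv phi x)) (\sum_j w ord0 j *: E j).
    by apply: tangent_sum => j _; exact: tangentZ.
  have [v tv qv] := surj _ _ tw; have [zG [_ /(_ v tv) vE]] := basis x Dx.
  exists (\row_i v (zG i)); apply/rowP => j.
  have := congr1 (fun h => h (z j)) qv; rewrite vE tqVE !fct_sumE.
  have ev (a : 'rV[R]_r) : \sum_i (a ord0 i *: E i) (z j) = a ord0 j.
    rewrite (bigD1 j)//= big1 => [|i ij].
      by rewrite -[(_ *: _) _]/(_ * _) dE eqxx mulr1 addr0.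
    by rewrite -[(_ *: _) _]/(_ * _) dE (negbTE ij) mulr0.
  by rewrite !ev -vE.
pose L (xz : 'rV[R]_k * 'rV[R]_r) := hlift (B xz.1) (A xz.1) xz.2.
exists phi, psi, D, L, X; split=> //.
- split=> //; first by split; [exists a0|rewrite /= chart_mapK].
    by move=> x [/Cd].
  by move=> x [].
- split=> //.
  have oDT : open (D `*` [set: 'rV[R]_r]) by apply: openX => //; exact: openT.
  have pull (f : 'rV[R]_k -> R) : smooth_on D f ->
      smooth_on (D `*` [set: 'rV[R]_r]) (fun z => f z.1).
    move=> sf; apply: (@smooth_on_comp_real _ _ _ _ D fst f) => //.
    - exact: finite_dim_row.
    - by move=> [x z] [].
    - exact: smooth_on_fst.
  have sA : smooth_mx D A.
    by move=> i j; under eq_fun do rewrite mxE; apply: ((smooth_on_rowP _ oD).1 (smooth_on_dd _ sk)).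
  have sB : smooth_mx D B.
    move=> i j; under eq_fun do rewrite mxE.
    have sg : smooth_fun (fun p => g p (X i p) (X j p)) by case: gR => _ _ _; apply.
    by apply: smooth_on_sub (sg _ aphi) => x [/Cd].
  have sBi : smooth_mx D (fun x => invmx (B x)).
    by apply: smooth_mx_inv => // x Dx; apply: gram_unit; exact: Bpos.
  have sS : smooth_mx D (fun x => invmx ((A x)^T *m invmx (B x) *m A x)).
    apply: smooth_mx_inv => // [x Dx|].
      by apply: schur_unit; [exact: Bsym|exact: Bpos|exact: Afull].
    by apply: smooth_mx_mul => //; apply: smooth_mx_mul => //; exact: smooth_mx_tr.
  have sM : smooth_mx D (fun x => invmx ((A x)^T *m invmx (B x) *m A x) *m (A x)^T *m invmx (B x)).
    by apply: smooth_mx_mul => //; apply: smooth_mx_mul => //; exact: smooth_mx_tr.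
  have sz : smooth_mx (D `*` [set: 'rV[R]_r]) (fun z : 'rV[R]_k * 'rV[R]_r => z.2).
    move=> i j n; rewrite (ord1 i).
    apply: (@Ck_linear _ _ _ n _ (coordmx_lin ord0 j \o (@snd 'rV[R]_k 'rV[R]_r : {linear _ -> _}))).
    by move=> x; apply: continuous_comp; [exact: cvg_snd|exact: coordmx_lin_continuous].
  apply/(smooth_on_rowP _ oDT) => i.
  have H := smooth_mx_mul oDT sz (fun i j => pull _ (sM i j)).
  by apply: smooth_on_congr (H ord0 i) => // z _; rewrite /L /hlift !mulmxA.
- move=> x z Dx; have Bp := Bpos x Dx; have Af := Afull x Dx.
  split.
  + rewrite -[RHS](hliftK (Bsym x) Bp Af z); apply/rowP => j.
    rewrite /L /= mxE {1}(row_sum_delta (hlift _ _ _)) linear_sum summxE.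
    by apply: eq_bigr => i _; rewrite linearZ !mxE.
  + split; first exact: tV.
    move=> v tv qv; have [zG [_ /(_ v tv) vE]] := basis x Dx.
    rewrite vE -/(V x (L (x, z))) -Bg.
    have uA : (\row_i v (zG i)) *m A x = 0.
      have [E [tE [zz [dE tqVE]]]] := tqV x Dx.
      apply/rowP => j; rewrite [RHS]mxE.
      have := congr1 (fun h => h (zz j)) qv; rewrite vE tqVE fct_sumE.
      rewrite (bigD1 j)//= big1 => [|i ij].
        by rewrite -[(_ *: _) _]/(_ * _) dE eqxx mulr1 addr0 -vE.
      by rewrite -[(_ *: _) _]/(_ * _) dE (negbTE ij) mulr0.
    by rewrite hlift_orthogonal// mxE.
  + by move=> f sf; exact: VE.
- move=> x v Dx tv; have Bp := Bpos x Dx; have Af := Afull x Dx.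
  have [zG [_ /(_ v tv) vE]] := basis x Dx.
  have [E [tE [zz [dE tqVE]]]] := tqV x Dx.
  exists ((\row_i v (zG i)) *m A x).
  rewrite {1}vE -/(V x (L (x, _))) !tqVE; apply: eq_bigr => j _.
  by rewrite /L /= (hliftK (Bsym x) Bp Af).
Qed.

End submersions.

Section diff_coordinates.
Context {R : realType}.

Lemma diff_coord (E : normedModType R) n (f : E -> 'rV[R]_n) x i :
  differentiable f x -> differentiable (fun y => f y ord0 i) x /\
  forall v, 'd (fun y => f y ord0 i) x v = ('d f x v) ord0 i.
Proof.
move=> df; have cl := @coordmx_lin_continuous R 1 n ord0 i.
have dl := linear_differentiable (f x) cl.
have [d1 E1] := is_diff_comp (differentiableP df) (differentiableP dl).
split=> // v; apply: (etrans (congr1 (fun h => h v) E1)).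
exact: (congr1 (fun h => h ('d f x v)) (diff_lin (f x) cl)).
Qed.

Lemma is_derive0_ball_cst (f : R -> R) (t0 d t : R) :
  (forall s, ball t0 d s -> is_derive s 1 f (0 : R)) -> ball t0 d t -> f t = f t0.
Proof.
move=> H; rewrite -ball_normE/= => bt.
have B s : `|s - t0| <= `|t - t0| -> ball t0 d s.
  by move=> st; rewrite -ball_normE/= distrC (le_lt_trans st)// distrC.
have [tt|/ltW tt] := leP t0 t.
  apply/eqP; rewrite -subr_eq0 -normr_le0 -(mul0r (t - t0)).
  apply: (@mvt_bound R f (fun=> 0)) => // s /andP[s1 s2]; last by rewrite normr0.
  by apply: H; apply: B; rewrite !ger0_norm ?subr_ge0// lerD2r.
apply/esym/eqP; rewrite -subr_eq0 -normr_le0 -(mul0r (t0 - t)).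
apply: (@mvt_bound R f (fun=> 0)) => // s /andP[s1 s2]; last by rewrite normr0.
by apply: H; apply: B; rewrite !ler0_norm ?subr_le0// lerN2 lerD2r.
Qed.

End diff_coordinates.

Section riemannian_submersions.
Context {R : realType} {k r : nat} {G : manifoldType R k} {Q : manifoldType R r}.
Variables (g : metric_on G) (gQ : metric_on Q) (q : G -> Q).
Hypothesis gR : riemannian g.
Hypothesis qS : riemannian_submersion g gQ q.

(** Pythagoras: [v] is the sum of the horizontal lift [V] of its image, whose norm is that of the
    image, and of a vector killed by the differential of [q], hence orthogonal to [V]. *)
Lemma riem_submersion_le a v : tangent a v ->
  gQ (q a) (tdiff q v) (tdiff q v) <= g a v v.
Proof.
move=> tv; have [sub pb] := qS.
have [phi [psi [D [L [X /= [[aphi da apsi ea] [oD Da _ _] _ HV surj]]]]]] :=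
  horizontal_frame gR sub a.
have [|z] := surj (phi a) v Da; first by rewrite chart_mapK.
have [_] := HV (phi a) z Da; rewrite chart_mapK//.
set V := \sum_i _ => oV _ E; rewrite E.
have tV : tangent a V := oV.1.
have tw : tangent a (v - V) by exact: tangentB.
have kw : tdiff q (v - V) = 0 by rewrite tdiffB E subrr.
have VE : pullback q gQ a V V = g a V V by exact: pb.
rewrite -[leLHS]/(pullback q gQ a V V) VE.
have -> : v = V + (v - V) by rewrite addrC subrK.
have tVw : tangent a (V + (v - V)) by exact: tangentD.
rewrite (riem_addl gR tV tw tVw) (riem_addr gR tV tw tV) (riem_addr gR tV tw tw).
have z1 := oV.2 _ tw kw; rewrite (riem_sym gR tw tV) z1 addr0 add0r lerDl.
exact: riem_ge0.
Qed.

(** The lift solves x' = L(x, zeta(t)) in a chart, where zeta is the coordinate velocity of [gam].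
    Since [L (x, z)] projects to z, the coordinates of q(al) - gam have zero derivative and vanish
    at [t0]. The velocity of the lift is horizontal, so the submersion preserves its norm. *)
Lemma riem_submersion_lift (J : set R) (gam : R -> Q) (t0 : R) (a0 : G) :
  open J -> J t0 -> smooth_into J gam -> q a0 = gam t0 ->
  exists2 d, 0 < d & exists al : R -> G,
  [/\ smooth_into (ball t0 d) al, ball t0 d `<=` J, al t0 = a0 &
      forall t, ball t0 d t -> q (al t) = gam t /\
        g (al t) (velocity al t) (velocity al t) =
        gQ (gam t) (velocity gam t) (velocity gam t)].
Proof.
move=> oJ Jt0 sg qa0; have [sub pb] := qS; have [sq _] := sub.
have [phi [psi [D [L [X [[aphi da apsi ea] [oD Da Dphi Dpsi] [sk sL] HV _]]]]]] :=
  horizontal_frame gR sub a0.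
pose V x z := \sum_i (L (x, z)) ord0 i *: X i (chart_inv phi x).
pose kappa x := psi (q (chart_inv phi x)).
rewrite -/kappa in sk.
have {}HV x z : D x -> [/\ 'd kappa x (L (x, z)) = z,
    ker_orthogonal q g (chart_inv phi x) (V x z) &
    forall f, smooth_fun f -> V x z f = 'd (f \o chart_inv phi) x (L (x, z))].
  exact: HV.
pose J' := J `&` gam @^-1` chart_dom psi.
have oJ' : open J' by exact: smooth_into_open sg (chart_dom_open psi).
have sp : smooth_on J' (fun t => psi (gam t)) by exact: sg.2.
pose zeta t := 'd (fun t => psi (gam t)) t 1.
have sz : smooth_on J' zeta by exact: smooth_on_dd.
pose W := J' `*` D.
have oW : open W by exact: openX.
pose F (tx : R * 'rV[R]_k) := L (tx.2, zeta tx.1).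
have sF : smooth_on W F.
  apply: (@smooth_on_comp _ _ _ _ W (D `*` setT) (fun tx : R * 'rV[R]_k => (tx.2, zeta tx.1)) L) => //.
  - exact: finite_dim_pair (finite_dim_row k) (finite_dim_row r).
  - by apply: openX => //; exact: openT.
  - by move=> [t x] [_ Dx].
  - apply: (smooth_on_pair oW).
      exact: smooth_on_snd.
    apply: (@smooth_on_comp _ _ _ _ W J' (@fst R 'rV[R]_k) zeta finite_dimR oW oJ') sz.
    - by move=> [t x] [].
    - exact: smooth_on_fst.
have W0 : W (t0, phi a0) by split=> //; split=> //=; rewrite -qa0.
have [d d0 [x [xt0 sx Hx]]] := ode_local oW W0 sF.
have ob : open (ball t0 d) by exact: ball_open.
pose al t := chart_inv phi (x t).
have sal : smooth_into (ball t0 d) al.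
  by apply: smooth_into_inv => // t /Hx[[_ /Dphi]//].
have qal t : ball t0 d t -> q (al t) = gam t.
  move=> bt; have [[[_ ept] Dx] _] := Hx t bt.
  have eqt : chart_dom psi (q (al t)) by exact: Dpsi.
  rewrite -(chart_mapK eqt) -(chart_mapK ept); congr (chart_inv psi _).
  rewrite -[LHS]/(kappa (x t)); apply/rowP => i.
  apply/eqP; rewrite -subr_eq0; apply/eqP.
  suff Z : forall s, ball t0 d s ->
      is_derive s 1 (fun s => kappa (x s) ord0 i - psi (gam s) ord0 i) (0 : R).
    apply: (etrans (is_derive0_ball_cst Z bt)).
    by rewrite xt0 /kappa chart_mapK// qa0 subrr.
  move=> s bs; have [[Js Dxs] dxs] := Hx s bs.
  have dxt : differentiable x s := smooth_on_diff sx bs.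
  have dkx : differentiable kappa (x s) := smooth_on_diff sk Dxs.
  have [dki Eki] := diff_coord i dkx.
  have dps : differentiable (fun t => psi (gam t)) s := smooth_on_diff sp Js.
  have [dpi Epi] := diff_coord i dps.
  have D1 := chart_curve_derive dxt dxs dki.
  have D2 := is_diff_derive1 (differentiableP dpi).
  rewrite Eki in D1; rewrite Epi in D2.
  have [K _ _] := HV (x s) (zeta s) Dxs.
  rewrite K in D1.
  by have DB := is_deriveB D1 D2; rewrite -(subrr (zeta s ord0 i)); exact: DB.
exists d => //; exists al; split=> //.
- by move=> t /Hx[[[]]].
- by rewrite /al xt0 chart_mapK.
move=> t bt; split; first exact: qal.
have [[Jt Dx] dx] := Hx t bt.
have [_ oV VE] := HV (x t) (zeta t) Dx.
have velE : velocity al t = V (x t) (zeta t).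
  apply/funext => f; have [sf|nf] := pselect (smooth_fun f); last first.
    by rewrite /velocity asboolF// (tangent_nonsmooth oV.1).
  rewrite VE//; apply: velocity_derive => //.
  have df : differentiable (f \o chart_inv phi) (x t).
    by apply: smooth_on_diff (sf _ aphi) _; exact: Dphi.
  have dxt : differentiable x t := smooth_on_diff sx bt.
  exact: chart_curve_derive dxt dx df.
have := pb _ _ _ oV oV; rewrite -[chart_inv phi (x t)]/(al t) -velE => <-.
rewrite /pullback (tdiff_velocity _ _ sq) (qal t bt).
suff -> : velocity (fun s => q (al s)) t = velocity gam t by [].
apply: velocity_near; apply: filterS (open_nbhs_nbhs (conj ob bt)) => s; exact: qal.
Qed.

End riemannian_submersions.

(** * Piecewise smooth curves *)

Section interval_gluing.
Context {R : realType}.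

(** Real induction: let c be the supremum of the t with [L a t]. The local hypothesis at c leads
    from such a t close to c to min(b, c + d / 2), which exceeds c unless it is b. *)
Lemma interval_glue (L : R -> R -> Prop) (a b : R) : a <= b ->
  (forall s t r, a <= s -> s <= t -> t <= r -> r <= b -> L s t -> L t r -> L s r) ->
  (forall t0, a <= t0 <= b -> exists2 d, 0 < d & forall s t, a <= s -> s <= t0 ->
     t0 <= t -> t <= b -> t0 - d < s -> t < t0 + d -> L s t /\ L s t0) ->
  L a b.
Proof.
move=> ab Ltr Lloc; pose A := [set t | [/\ a <= t, t <= b & L a t]].
have Aa : A a.
  have [|d d0 H] := Lloc a; first by rewrite lexx.
  split=> //; have [] := H a a; rewrite ?lexx// ?ltrDl// ltrBlDr ltrDl//.
have hA : has_sup A by split; [exists a|exists b => t []].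
pose c := sup A.
have ac : a <= c by apply: sup_upper_bound.
have cb : c <= b by apply: ge_sup => [|t []//]; exists a.
have [|d d0 H] := Lloc c; first by rewrite ac.
have [t [at_ tb Lat] ct] := sup_adherent d0 hA.
have tc : t <= c by apply: sup_upper_bound.
pose t' := Num.min b (c + d / 2).
have d2 : 0 < d / 2 by rewrite divr_gt0.
have ct' : c <= t' by rewrite le_min cb lerDl ltW.
have t'b : t' <= b by rewrite ge_min lexx.
have t'd : t' < c + d.
  by rewrite gt_min; apply/orP; right; rewrite ltrD2l ltr_pdivrMr// ltr_pMr// ltr1n.
have [Ltt' _] := H t t' at_ tc ct' t'b ct t'd.
have Lat' : L a t' by apply: (Ltr a t t') => //; exact: le_trans tc ct'.
have t'c : t' <= c by apply: sup_upper_bound => //; split=> //; exact: le_trans ac ct'.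
have tE : t' = b.
  move: t'c; rewrite /t'; have [//|_] := leP b (c + d / 2).
  by rewrite gerDl leNgt d2.
by rewrite -tE.
Qed.

(* By compactness of [a, b] the exceptions in ]a, b[ are finitely many, see
   [off_finite_finite]; the local form is the one that glues. *)
Definition off_finite (Phi : R -> Prop) (a b : R) : Prop :=
  forall t0, a <= t0 <= b -> exists2 d, 0 < d &
    forall x, a < x < b -> x != t0 -> `|x - t0| < d -> Phi x.

Implicit Types (Phi : R -> Prop) (a b : R).

Lemma off_finite_all Phi a b : (forall x, a < x < b -> Phi x) -> off_finite Phi a b.
Proof. by move=> H t0 _; exists 1 => // x /H. Qed.

Lemma off_finite_and Phi Psi a b : off_finite Phi a b -> off_finite Psi a b ->
  off_finite (fun x => Phi x /\ Psi x) a b.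
Proof.
move=> H1 H2 t0 t0ab; have [d1 d10 h1] := H1 t0 t0ab; have [d2 d20 h2] := H2 t0 t0ab.
exists (Num.min d1 d2); first by rewrite lt_min d10.
by move=> x xab xt; rewrite lt_min => /andP[x1 x2]; split; [exact: h1|exact: h2].
Qed.

Lemma off_finite_sub Phi Psi a b : (forall x, a < x < b -> Phi x -> Psi x) ->
  off_finite Phi a b -> off_finite Psi a b.
Proof.
move=> PP H t0 t0ab; have [d d0 h] := H t0 t0ab; exists d => // x xab xt xd.
by apply: PP => //; exact: h.
Qed.

Lemma off_finite_cat Phi a b c : a <= b -> b <= c ->
  off_finite Phi a b -> off_finite Phi b c -> off_finite Phi a c.
Proof.
move=> ab bc H1 H2 t0 /andP[at0 t0c].
have [t0b|bt0|->] := ltgtP t0 b.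
- have [|d d0 h] := H1 t0; first by rewrite at0 ltW.
  exists (Num.min d (b - t0)); first by rewrite lt_min d0 subr_gt0.
  move=> x /andP[ax xc] xt; rewrite lt_min => /andP[xd xb]; apply: h => //.
  rewrite ax/=; have := le_lt_trans (ler_norm _) xb; by rewrite ltrD2r.
- have [|d d0 h] := H2 t0; first by rewrite t0c ltW.
  exists (Num.min d (t0 - b)); first by rewrite lt_min d0 subr_gt0.
  move=> x /andP[ax xc] xt; rewrite lt_min => /andP[xd xb]; apply: h => //.
  rewrite xc andbT; rewrite distrC in xb.
  by have := le_lt_trans (ler_norm _) xb; rewrite ltrD2l ltrN2.
- have [|d1 d10 h1] := H1 b; first by rewrite ab lexx.
  have [|d2 d20 h2] := H2 b; first by rewrite bc lexx.
  exists (Num.min d1 d2); first by rewrite lt_min d10.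
  move=> x /andP[ax xc] xt; rewrite lt_min => /andP[x1 x2].
  by have [xb|xb|E] := ltgtP x b; [apply: h1; rewrite ?ax|apply: h2; rewrite ?xb|rewrite E eqxx in xt].
Qed.

Lemma off_finite_affine Phi a b (al be : R) : 0 < al ->
  off_finite Phi (al * a + be) (al * b + be) -> off_finite (fun x => Phi (al * x + be)) a b.
Proof.
move=> al0 H t0 /andP[at0 t0b].
have [|d d0 h] := H (al * t0 + be); first by rewrite !lerD2r !ler_pM2l// at0.
exists (d / al); first by rewrite divr_gt0.
move=> x /andP[ax xb] xt xd; apply: h.
- by rewrite !ltrD2r !ltr_pM2l// ax.
- by apply: contra xt => /eqP/addIr/(mulfI (lt0r_neq0 al0))->.
- by rewrite opprD addrACA subrr addr0 -mulrBr normrM gtr0_norm// mulrC -ltr_pdivlMr.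
Qed.

Lemma off_finite_opp Phi a b :
  off_finite Phi (- b) (- a) -> off_finite (fun x => Phi (- x)) a b.
Proof.
move=> H t0 /andP[at0 t0b].
have [|d d0 h] := H (- t0); first by rewrite !lerN2 t0b.
exists d => // x /andP[ax xb] xt xd; apply: h.
- by rewrite !ltrN2 xb.
- by rewrite eqr_opp.
- by rewrite -opprD normrN.
Qed.

Lemma off_finite_finite Phi a b : a <= b -> off_finite Phi a b ->
  finite_set [set x | a <= x <= b /\ ~ Phi x].
Proof.
move=> ab H.
apply: (@interval_glue (fun s t => finite_set [set x | s <= x <= t /\ ~ Phi x]) a b ab).
- move=> s t r _ st tr _ H1 H2.
  apply: (sub_finite_set _ (_ : finite_set ([set x | s <= x <= t /\ ~ Phi x] `|`
    [set x | t <= x <= r /\ ~ Phi x]))); last by rewrite finite_setU.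
  move=> x [/andP[sx xr] nP]; have [xt|tx] := leP x t; [left|right]; split=> //.
    by rewrite sx.
  by rewrite ltW.
- move=> t0 t0ab; have [d d0 h] := H t0 t0ab; exists d => // s t as_ st0 t0t tb sd td.
  have F : finite_set [set x | s <= x <= t /\ ~ Phi x].
    apply: (sub_finite_set _ (_ : finite_set ([set a] `|` [set b] `|` [set t0]))).
      move=> x [/andP[sx xt] nP]; apply: contrapT => nx; apply: nP.
      have xt0 : x != t0 by apply/eqP => E; apply: nx; right.
      have xa : x != a by apply/eqP => E; apply: nx; left; left.
      have xb : x != b by apply/eqP => E; apply: nx; left; right.
      apply: h => //.
        by rewrite !lt_neqAle xb (le_trans xt tb) (le_trans as_ sx) eq_sym xa.
      by rewrite ltr_distl (lt_le_trans sd sx) (le_lt_trans xt td).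
    by rewrite !finite_setU; split; [split|]; exact: finite_set1.
  split=> //; apply: sub_finite_set F => x [/andP[sx xt] nP]; split=> //.
  by rewrite sx (le_trans xt).
Qed.

End interval_gluing.

Section piecewise_curves.
Context {R : realType}.

(* Piecewise smoothness without subdivisions: near each point the curve agrees on
   either side with a smooth curve. *)
Definition pws n (N : manifoldType R n) (a b : R) (c : R -> N) : Prop :=
  forall t0, a <= t0 <= b -> exists2 d, 0 < d &
    (exists cl : R -> N, smooth_into (ball t0 d) cl /\
       forall x, a <= x <= t0 -> t0 - d < x -> c x = cl x) /\
    (exists cr : R -> N, smooth_into (ball t0 d) cr /\
       forall x, t0 <= x <= b -> x < t0 + d -> c x = cr x).

Definition smooth_near n (N : manifoldType R n) (c : R -> N) (x : R) : Prop :=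
  exists U : set R, [/\ open U, U x & smooth_into U c].

Lemma ballR (t d x : R) : ball t d x <-> `|x - t| < d.
Proof. by rewrite -ball_normE/= distrC. Qed.

Section one_curve.
Context {n : nat} {N : manifoldType R n}.
Implicit Types (a b : R) (c : R -> N).

Lemma smooth_near_congr c d (U : set R) x : open U -> U x ->
  (forall y, U y -> c y = d y) -> smooth_near c x -> smooth_near d x.
Proof.
move=> oU Ux cd [V [oV Vx sc]]; exists (V `&` U).
have oVU : open (V `&` U) by exact: openI.
split=> //; apply: smooth_into_congr oVU _ (smooth_into_sub _ sc).
  by move=> y [_ /cd].
by move=> y [].
Qed.

Lemma pws_smooth (U : set R) a b c : open U -> smooth_into U c ->
  (forall x, a <= x <= b -> U x) -> pws a b c.
Proof.
move=> oU sc abU t0 /abU Ut0.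
have /nbhs_ballP[d /= d0 dU] := open_nbhs_nbhs (conj oU Ut0).
have sd : smooth_into (ball t0 d) c by exact: smooth_into_sub sc.
by exists d => //; split; exists c.
Qed.

Lemma pws_congr a b c d : (forall x, a <= x <= b -> c x = d x) -> pws a b c -> pws a b d.
Proof.
move=> cd H t0 t0ab; have [e e0 [[cl [scl Ecl]] [cr [scr Ecr]]]] := H t0 t0ab.
have /andP[at0 t0b] := t0ab.
exists e => //; split; [exists cl|exists cr]; split=> // x /andP[h1 h2] h3.
  by rewrite -cd ?h1 ?(le_trans h2)//; apply: Ecl => //; rewrite h1.
by rewrite -cd ?h2 ?(le_trans at0)//; apply: Ecr => //; rewrite h1.
Qed.

Lemma pws_cat a b r c : a <= b -> b <= r -> pws a b c -> pws b r c -> pws a r c.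
Proof.
move=> ab br H1 H2 t0 /andP[at0 t0r].
have [t0b|bt0|->] := ltgtP t0 b.
- have [|d d0 [[cl [scl Ecl]] [cr [scr Ecr]]]] := H1 t0; first by rewrite at0 ltW.
  have dd : ball t0 (Num.min d (b - t0)) `<=` ball t0 d.
    by apply: le_ball; rewrite ge_min lexx.
  exists (Num.min d (b - t0)); first by rewrite lt_min d0 subr_gt0.
  split; [exists cl|exists cr]; (split; first exact: smooth_into_sub dd _).
    move=> x xt xd; apply: Ecl => //; apply: le_lt_trans xd.
    by rewrite lerD2l lerN2 ge_min lexx.
  move=> x /andP[tx xr] xd; apply: Ecr; last first.
    by apply: (lt_le_trans xd); rewrite lerD2l ge_min lexx.
  rewrite tx/= ltW//; apply: (lt_le_trans xd).
  by rewrite addrC -lerBrDr ge_min lexx orbT.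
- have [|d d0 [[cl [scl Ecl]] [cr [scr Ecr]]]] := H2 t0; first by rewrite t0r ltW.
  have dd : ball t0 (Num.min d (t0 - b)) `<=` ball t0 d.
    by apply: le_ball; rewrite ge_min lexx.
  exists (Num.min d (t0 - b)); first by rewrite lt_min d0 subr_gt0.
  split; [exists cl|exists cr]; (split; first exact: smooth_into_sub dd _).
    move=> x /andP[ax xt] xd; apply: Ecl; last first.
      by apply: le_lt_trans xd; rewrite lerD2l lerN2 ge_min lexx.
    rewrite xt andbT ltW//; apply: le_lt_trans xd.
    by rewrite lerBrDr -lerBrDl ge_min lexx orbT.
  move=> x xt xd; apply: Ecr => //; apply: (lt_le_trans xd).
  by rewrite lerD2l ge_min lexx.
- have [|d1 d10 [[cl [scl Ecl]] _]] := H1 b; first by rewrite ab lexx.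
  have [|d2 d20 [_ [cr [scr Ecr]]]] := H2 b; first by rewrite br lexx.
  have dd1 : ball b (Num.min d1 d2) `<=` ball b d1.
    by apply: le_ball; rewrite ge_min lexx.
  have dd2 : ball b (Num.min d1 d2) `<=` ball b d2.
    by apply: le_ball; rewrite ge_min lexx orbT.
  exists (Num.min d1 d2); first by rewrite lt_min d10.
  split; [exists cl; split; first exact: smooth_into_sub dd1 _|
    exists cr; split; first exact: smooth_into_sub dd2 _].
    by move=> x xt xd; apply: Ecl => //; apply: le_lt_trans xd; rewrite lerD2l lerN2 ge_min lexx.
  by move=> x xt xd; apply: Ecr => //; apply: (lt_le_trans xd); rewrite lerD2l ge_min lexx orbT.
Qed.

Lemma pws_off_finite a b c : pws a b c -> off_finite (smooth_near c) a b.
Proof.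
move=> H t0 t0ab; have [d d0 [[cl [scl Ecl]] [cr [scr Ecr]]]] := H t0 t0ab.
exists d => // x /andP[ax xb] xt xd.
have ob : open (ball t0 d) by exact: ball_open.
have [xt0|t0x|E] := ltgtP x t0; last by rewrite E eqxx in xt.
  apply: (@smooth_near_congr cl c (ball t0 d `&` `]a, t0[%classic)).
  - by apply: openI => //; exact: itv_open.
  - by split; [exact/ballR|rewrite /= in_itv/= ax xt0].
  - move=> y [/ballR]; rewrite ltr_distl => /andP[yd _]; rewrite /= in_itv/= => /andP[ay yt].
    by rewrite Ecl// !ltW.
  - by exists (ball t0 d); split=> //; exact/ballR.
apply: (@smooth_near_congr cr c (ball t0 d `&` `]t0, b[%classic)).
- by apply: openI => //; exact: itv_open.
- by split; [exact/ballR|rewrite /= in_itv/= xb t0x].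
- move=> y [/ballR]; rewrite ltr_distl => /andP[_ yd]; rewrite /= in_itv/= => /andP[ay yt].
  by rewrite Ecr// !ltW.
- by exists (ball t0 d); split=> //; exact/ballR.
Qed.

Lemma smooth_near_common m (M : manifoldType R m) c (e : R -> M) x :
  smooth_near c x -> smooth_near e x ->
  exists U : set R, [/\ open U, U x, smooth_into U c & smooth_into U e].
Proof.
move=> [U [oU Ux sc]] [V [oV Vx se]]; exists (U `&` V).
by split; [exact: openI|split|apply: smooth_into_sub sc => y []|apply: smooth_into_sub se => y []].
Qed.

Lemma smooth_near_tangent c x : smooth_near c x -> tangent (c x) (velocity c x).
Proof. by move=> [U [oU Ux sc]]; exact: tangent_velocity sc oU Ux. Qed.

Lemma velocity_affine c (al be x : R) : smooth_near c (al * x + be) ->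
  velocity (fun s => c (al * s + be)) x = al *: velocity c (al * x + be).
Proof.
move=> [U [oU Ux sc]]; apply/funext => f.
rewrite -[RHS]/(al * velocity c (al * x + be) f).
have [sf|nf] := pselect (smooth_fun f); last by rewrite /velocity !asboolF// mulr0.
apply: velocity_derive => //.
have d1 := smooth_curve_diff sc oU Ux sf.
have da : is_diff x (fun s : R => al *: s + be) (fun s : R => al *: s + 0).
  exact: is_diffD.
have [_ E] := is_diff_derive1 (is_diff_comp da (differentiableP d1)).
have dd := is_diff_derive1 (is_diff_comp da (differentiableP d1)).
rewrite (velocity_diff sc oU Ux sf).
apply: (@eq_ind _ _ (is_derive x 1 (fun s => f (c (al * s + be)))) dd).
rewrite /= addr0; exact: linearZ.
Qed.

Lemma smooth_into_affine c (al be : R) (U : set R) : open U -> smooth_into U c ->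
  open ((fun s => al * s + be) @^-1` U) /\
  smooth_into ((fun s => al * s + be) @^-1` U) (fun s => c (al * s + be)).
Proof.
move=> oU sc; set V := _ @^-1` U.
have cf : continuous (fun s : R => al * s + be).
  by move=> y; apply: cvgD; [apply: cvgM; [exact: cvg_cst|exact: cvg_id]|exact: cvg_cst].
have oV : open V by apply: open_comp => // y _; exact: cf.
split=> //; apply: (smooth_into_comp finite_dimR sc _ _ oV oU) => //.
apply: smooth_onD => //; last exact: smooth_on_cst.
by apply: smooth_onM => //; [exact: smooth_on_cst|exact: smooth_on_id].
Qed.

Lemma pws_affine a b c (al be : R) : 0 < al ->
  pws (al * a + be) (al * b + be) c -> pws a b (fun x => c (al * x + be)).
Proof.
move=> al0 H t0 /andP[at0 t0b].
have [|d d0 [[cl [scl Ecl]] [cr [scr Ecr]]]] := H (al * t0 + be).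
  by rewrite !lerD2r !ler_pM2l// at0.
have ob : open (ball (al * t0 + be) d) by exact: ball_open.
have bb : ball t0 (d / al) `<=` (fun s => al * s + be) @^-1` ball (al * t0 + be) d.
  move=> x /ballR xt; apply/ballR.
  by rewrite opprD addrACA subrr addr0 -mulrBr normrM gtr0_norm// mulrC -ltr_pdivlMr.
exists (d / al); first by rewrite divr_gt0.
split; [exists (fun x => cl (al * x + be))|exists (fun x => cr (al * x + be))].
  split; first exact: smooth_into_sub bb (smooth_into_affine al be ob scl).2.
  move=> x /andP[ax xt] xd; apply: Ecl; first by rewrite !lerD2r !ler_pM2l// ax.
  rewrite addrAC ltrD2r ltrBlDr -[X in _ + X](@divfK _ al) ?gt_eqF//.
  by rewrite [X in _ + X]mulrC -mulrDr ltr_pM2l// -ltrBlDr.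
split; first exact: smooth_into_sub bb (smooth_into_affine al be ob scr).2.
move=> x /andP[tx xb] xd; apply: Ecr; first by rewrite !lerD2r !ler_pM2l// tx.
rewrite addrAC ltrD2r -[X in _ + X](@divfK _ al) ?gt_eqF//.
by rewrite [X in _ + X]mulrC -mulrDr ltr_pM2l.
Qed.

Lemma pws_opp a b c : pws (- b) (- a) c -> pws a b (fun x => c (- x)).
Proof.
move=> H t0 /andP[at0 t0b].
have [|d d0 [[cl [scl Ecl]] [cr [scr Ecr]]]] := H (- t0); first by rewrite !lerN2 t0b.
have ob : open (ball (- t0) d) by exact: ball_open.
have E (e : R -> N) x : e (-1 * x + 0) = e (- x) by rewrite addr0 mulN1r.
have bb : ball t0 d `<=` (fun s => -1 * s + 0) @^-1` ball (- t0) d.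
  move=> x /ballR xt; apply/ballR.
  by rewrite addr0 mulN1r -opprD normrN.
have sN (e : R -> N) : smooth_into (ball (- t0) d) e -> smooth_into (ball t0 d) (fun x => e (- x)).
  move=> se; have [_ H1] := smooth_into_affine (-1) 0 ob se.
  apply: smooth_into_congr (smooth_into_sub bb H1); first exact: ball_open.
  by move=> x _; exact: E.
exists d => //.
split; [exists (fun x => cr (- x))|exists (fun x => cl (- x))].
  split; first exact: sN.
  by move=> x /andP[ax xt] xd; apply: Ecr; rewrite ?lerN2 ?xt// ltrNl opprD opprK.
split; first exact: sN.
by move=> x /andP[tx xb] xd; apply: Ecl; rewrite ?lerN2 ?xb// -opprD ltrN2.
Qed.

Lemma pws_point a c : pws a a c.
Proof.
move=> t0 /andP[h1 h2]; have -> : t0 = a by apply/eqP; rewrite eq_le h1 h2.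
exists 1 => //; split; exists (fun=> c a); (split; first exact: smooth_into_cst).
  by move=> x /andP[x1 x2] _; congr c; apply/eqP; rewrite eq_le x1 x2.
by move=> x /andP[x1 x2] _; congr c; apply/eqP; rewrite eq_le x1 x2.
Qed.

Lemma pws_arc a b c : smooth_arc a b c -> pws a b c.
Proof.
move=> [U [e [oU abU se ce]]]; apply: (@pws_congr a b e).
  by move=> x xab; rewrite ce.
by apply: pws_smooth oU se _ => x xab; apply: abU; rewrite /= in_itv/= xab.
Qed.

(** The common shape of the subdivisions in [piecewise_smooth] and in [horizontal], on an arbitrary
    interval so that they can be concatenated; [Phi] is the condition imposed inside the pieces. *)
Definition subdivided (Phi : R -> Prop) (c : R -> N) a b := exists (k : nat) (t : nat -> R),
  [/\ t 0%N = a, t k = b, forall i, (i < k)%N -> t i < t i.+1,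
      forall i, (i < k)%N -> smooth_arc (t i) (t i.+1) c &
      forall i s, (i < k)%N -> t i < s < t i.+1 -> Phi s].

Lemma subdivided_trans Phi c a b r :
  subdivided Phi c a b -> subdivided Phi c b r -> subdivided Phi c a r.
Proof.
move=> [k [t [t0 tk tl ta tP]]] [j [s [s0 sj sl sa sP]]].
pose u i := if (i <= k)%N then t i else s (i - k)%N.
have ul i : (i <= k)%N -> u i = t i by rewrite /u => ->.
have ur i : u (k + i)%N = s i.
  rewrite /u addKn; case: leqP => // ik.
  have i0 : i = 0%N by lia.
  by rewrite i0 addn0 tk s0.
have cases i : (i < k + j)%N -> (i < k)%N \/ exists2 i', i = (k + i')%N & (i' < j)%N.
  move=> ikj; have [|ki] := ltnP i k; [by left|right; exists (i - k)%N; lia].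
have u1 i : (i < k)%N -> u i = t i /\ u i.+1 = t i.+1.
  by move=> ik; rewrite !ul// ltnW.
have u2 i : u (k + i)%N = s i /\ u (k + i).+1 = s i.+1 by rewrite -addnS !ur.
exists (k + j)%N, u; split.
- by rewrite ul.
- by rewrite ur.
- move=> i /cases[ik|[i' -> ij]]; first by have [-> ->] := u1 i ik; exact: tl.
  by have [-> ->] := u2 i'; exact: sl.
- move=> i /cases[ik|[i' -> ij]]; first by have [-> ->] := u1 i ik; exact: ta.
  by have [-> ->] := u2 i'; exact: sa.
- move=> i x /cases[ik|[i' -> ij]]; first by have [-> ->] := u1 i ik; exact: tP.
  by have [-> ->] := u2 i'; exact: sP.
Qed.

Lemma subdivided_pws Phi c a b : subdivided Phi c a b ->
  [/\ a <= b, pws a b c & off_finite Phi a b].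
Proof.
move=> [k [t [t0 tk tl ta tP]]].
suff H i : (i <= k)%N -> [/\ t 0%N <= t i, pws (t 0%N) (t i) c & off_finite Phi (t 0%N) (t i)].
  by have [] := H k (leqnn k); rewrite t0 tk.
elim: i => [_|i IH ik].
  split=> //; first exact: pws_point.
  by apply: off_finite_all => x /andP[x1]; rewrite ltNge ltW.
have [h1 h2 h3] := IH (ltnW ik); have tt := ltW (tl i ik).
split; first exact: le_trans tt.
  by apply: pws_cat h2 _ => //; apply: pws_arc; exact: ta.
by apply: off_finite_cat h3 _ => //; apply: off_finite_all => x; exact: tP.
Qed.

(** By gluing it suffices to subdivide an interval around [t0], which splits at [t0] into two smooth
    arcs. Subdivisions increase strictly, so an arc reduced to a point is given the empty
    subdivision instead. *)
Lemma pws_subdivided Phi c a b : a <= b -> pws a b c -> off_finite Phi a b ->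
  subdivided Phi c a b.
Proof.
move=> ab H1 H2.
have refl s : subdivided Phi c s s by exists 0%N, (fun=> s).
apply: (interval_glue ab).
  by move=> s t r _ _ _ _; exact: subdivided_trans.
move=> t0 t0ab; have [d1 d10 [[cl [scl Ecl]] [cr [scr Ecr]]]] := H1 t0 t0ab.
have [d2 d20 HP] := H2 t0 t0ab.
exists (Num.min d1 d2) => [|s t as_ st0 t0t tb sd td]; first by rewrite lt_min d10.
have sd1 : t0 - d1 < s by apply: le_lt_trans sd; rewrite lerD2l lerN2 ge_min lexx.
have sd2 : t0 - d2 < s by apply: le_lt_trans sd; rewrite lerD2l lerN2 ge_min lexx orbT.
have td1 : t < t0 + d1 by apply: (lt_le_trans td); rewrite lerD2l ge_min lexx.
have td2 : t < t0 + d2 by apply: (lt_le_trans td); rewrite lerD2l ge_min lexx orbT.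
have one x y : x < y -> smooth_arc x y c -> (forall z, x < z < y -> Phi z) ->
    subdivided Phi c x y.
  move=> xy arc PP; exists 1%N, (fun i => if i is 0%N then x else y).
  by split=> //; [case|case|case=> // z _; exact: PP].
have S1 : subdivided Phi c s t0.
  have [->|ne] := eqVneq s t0; first exact: refl.
  have lt_ : s < t0 by rewrite lt_neqAle ne.
  apply: one => //.
    exists (ball t0 d1), cl; split=> //; first exact: ball_open.
      move=> x; rewrite /= in_itv/= => /andP[sx xt]; apply/ballR.
      by rewrite ltr_distl (lt_le_trans sd1 sx) (le_lt_trans xt)// ltrDl.
    move=> x /andP[sx xt]; apply: Ecl; first by rewrite xt andbT (le_trans as_).
    exact: lt_le_trans sx.
  move=> x /andP[sx xt]; apply: HP.
  - by rewrite (le_lt_trans as_ sx) (lt_le_trans xt (le_trans t0t tb)).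
  - by rewrite lt_eqF.
  - by rewrite ltr_distl (lt_trans sd2 sx) (lt_trans xt)// ltrDl.
split=> //.
have [<-|ne] := eqVneq t0 t; first exact: S1.
have lt_ : t0 < t by rewrite lt_neqAle ne.
apply: subdivided_trans S1 _; apply: one => //.
  exists (ball t0 d1), cr; split=> //; first exact: ball_open.
    move=> x; rewrite /= in_itv/= => /andP[sx xt]; apply/ballR.
    by rewrite ltr_distl (le_lt_trans xt td1) (lt_le_trans _ sx)// ltrBlDr ltrDl.
  move=> x /andP[sx xt]; apply: Ecr; first by rewrite sx (le_trans xt).
  exact: le_lt_trans td1.
move=> x /andP[sx xt]; apply: HP.
- by rewrite (lt_le_trans xt tb) (le_lt_trans _ sx)// (le_trans as_).
- by rewrite gt_eqF.
- by rewrite ltr_distl (lt_trans xt td2) (lt_trans _ sx)// ltrBlDr ltrDl.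
Qed.

Lemma piecewise_smoothP c : piecewise_smooth c <-> pws 0 1 c.
Proof.
split=> [[k [t [[t0 tk tl] ta]]]|H].
  have H : subdivided (fun=> True) c 0 1 by exists k, t.
  by have [] := subdivided_pws H.
have [k [t [t0 tk tl ta _]]] :=
  pws_subdivided ler01 H (off_finite_all (fun x _ => Logic.I) : off_finite (fun=> True) 0 1).
by exists k, t.
Qed.

End one_curve.

Lemma pws_map m n (M : manifoldType R m) (N : manifoldType R n) (F : M -> N) a b c :
  smooth_map F -> pws a b c -> pws a b (fun x => F (c x)).
Proof.
move=> sF H t0 /H[d d0 [[cl [scl Ecl]] [cr [scr Ecr]]]]; exists d => //.
have ob : open (ball t0 d) by exact: ball_open.
split; [exists (fun x => F (cl x))|exists (fun x => F (cr x))].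
  by split=> [|x h1 h2]; [exact: smooth_map_comp|rewrite Ecl].
by split=> [|x h1 h2]; [exact: smooth_map_comp|rewrite Ecr].
Qed.

Lemma pws_map2 m1 m2 n (M1 : manifoldType R m1) (M2 : manifoldType R m2)
    (N : manifoldType R n) (F : M1 -> M2 -> N) a b c1 c2 :
  smooth_map2_on [set: M1 * M2] F -> pws a b c1 -> pws a b c2 ->
  pws a b (fun x => F (c1 x) (c2 x)).
Proof.
move=> sF H1 H2 t0 t0ab.
have [d1 d10 [[l1 [sl1 El1]] [r1 [sr1 Er1]]]] := H1 t0 t0ab.
have [d2 d20 [[l2 [sl2 El2]] [r2 [sr2 Er2]]]] := H2 t0 t0ab.
set d := Num.min d1 d2.
have dd1 : d <= d1 by rewrite ge_min lexx.
have dd2 : d <= d2 by rewrite ge_min lexx orbT.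
have ob : open (ball t0 d) by exact: ball_open.
exists d; first by rewrite lt_min d10.
split; [exists (fun x => F (l1 x) (l2 x))|exists (fun x => F (r1 x) (r2 x))]; split.
- apply: smooth_map2_comp sF ob; first exact: smooth_into_sub (le_ball dd1) sl1.
  exact: smooth_into_sub (le_ball dd2) sl2.
- move=> x h1 h2; rewrite El1 ?El2//; apply: le_lt_trans h2; by rewrite lerD2l lerN2.
- apply: smooth_map2_comp sF ob; first exact: smooth_into_sub (le_ball dd1) sr1.
  exact: smooth_into_sub (le_ball dd2) sr2.
- move=> x h1 h2; rewrite Er1 ?Er2//; apply: (lt_le_trans h2); by rewrite lerD2l.
Qed.

(** Passage from local to global lifts. [S] says which points lie over a given time. The local
    hypothesis must provide a lift from every admissible point [p], not from a single one: this is
    what lets consecutive pieces be matched. It is applied to the smooth extensions [g] of the curve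
    from either side of a time [t0]. *)
Lemma pws_lift m n (M : manifoldType R m) (N : manifoldType R n) (gam : R -> M)
    (S : R -> N -> Prop) (Phi : (R -> N) -> R -> Prop) (a b : R) :
  a <= b -> pws a b gam ->
  (forall c d x, (\forall y \near x, c y = d y) -> Phi c x -> Phi d x) ->
  (forall (U : set R) (g : R -> M) t0, open U -> U t0 -> smooth_into U g ->
     exists2 d, 0 < d & forall s t, a <= s -> s <= t -> t <= b -> t0 - d < s -> t < t0 + d ->
       (forall x, s <= x <= t -> gam x = g x) -> forall p, S s p ->
       exists c, [/\ c s = p, pws s t c, off_finite (Phi c) s t &
         forall x, s <= x <= t -> S x (c x)]) ->
  forall p, S a p -> exists c, [/\ c a = p, pws a b c, off_finite (Phi c) a b &
         forall x, a <= x <= b -> S x (c x)].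
Proof.
move=> ab Hg Ploc Hloc.
have tr s t r : a <= s -> s <= t -> t <= r -> r <= b ->
    (forall p, S s p -> exists c, [/\ c s = p, pws s t c, off_finite (Phi c) s t &
         forall x, s <= x <= t -> S x (c x)]) ->
    (forall p, S t p -> exists c, [/\ c t = p, pws t r c, off_finite (Phi c) t r &
         forall x, t <= x <= r -> S x (c x)]) ->
    forall p, S s p -> exists c, [/\ c s = p, pws s r c, off_finite (Phi c) s r &
         forall x, s <= x <= r -> S x (c x)].
  move=> as_ st tr rb H1 H2 p /H1[c1 [c1s pc1 oc1 Sc1]].
  have [|c2 [c2t pc2 oc2 Sc2]] := H2 (c1 t); first by apply: Sc1; rewrite st lexx.
  pose c x := if x <= t then c1 x else c2 x.
  have E1 x : x <= t -> c x = c1 x by rewrite /c => ->.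
  have E2 x : t <= x -> c x = c2 x.
    rewrite le_eqVlt => /predU1P[<-|tx]; first by rewrite E1.
    by rewrite /c leNgt tx.
  exists c; split.
  - by rewrite E1.
  - apply: (pws_cat st tr).
      by apply: pws_congr pc1 => x /andP[_ xt]; rewrite E1.
    by apply: pws_congr pc2 => x /andP[xt _]; rewrite E2.
  - apply: (off_finite_cat st tr).
      apply: off_finite_sub oc1 => x /andP[sx xt]; apply: Ploc.
      by near=> y; rewrite E1// ltW//; near: y; exact: lt_nbhsl.
    apply: off_finite_sub oc2 => x /andP[sx xt]; apply: Ploc.
    by near=> y; rewrite E2// ltW//; near: y; exact: lt_nbhsr.
  - move=> x /andP[sx xr]; have [xt|/ltW tx] := leP x t.
      by rewrite E1//; apply: Sc1; rewrite sx.
    by rewrite E2//; apply: Sc2; rewrite tx.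
apply: (interval_glue ab tr).
move=> t0 t0ab; have [d0 d00 [[cl [scl Ecl]] [cr [scr Ecr]]]] := Hg t0 t0ab.
have ob : open (ball t0 d0) by exact: ball_open.
have bt : ball t0 d0 t0 by exact: ballxx.
have [d1 d10 H1] := Hloc _ _ _ ob bt scl.
have [d2 d20 H2] := Hloc _ _ _ ob bt scr.
exists (Num.min d0 (Num.min d1 d2)); first by rewrite !lt_min d00 d10.
move=> s t as_ st0 t0t tb.
rewrite ltrBlDr -ltrBlDl !lt_min => /and3P[sd0 sd1 sd2].
rewrite -ltrBlDl !lt_min => /and3P[td0 td1 td2].
have L1 : forall p, S s p -> exists c, [/\ c s = p, pws s t0 c, off_finite (Phi c) s t0 &
         forall x, s <= x <= t0 -> S x (c x)].
  apply: (H1 s t0 as_ st0 (le_trans t0t tb)); rewrite ?ltrDl//.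
    by rewrite ltrBlDr -ltrBlDl.
  move=> x /andP[sx xt]; apply: Ecl; first by rewrite xt andbT (le_trans as_).
  by rewrite ltrBlDr -ltrBlDl (le_lt_trans _ sd0)// lerD2l lerN2.
split=> //.
apply: (tr s t0 t) => //.
have at0 : a <= t0 by exact: le_trans as_ st0.
apply: (H2 t0 t at0 t0t tb); rewrite ?ltrBlDr ?ltrDl// -?ltrBlDl//.
move=> x /andP[tx xt]; apply: Ecr; first by rewrite tx (le_trans xt).
by rewrite -ltrBlDl (le_lt_trans _ td0)// lerD2r.
Unshelve. all: by end_near. Qed.

End piecewise_curves.

(** * Horizontal curves *)

Section lie_groups.
Context {R : realType} {k : nat} {G : lieGroupType R k}.
Implicit Types (h : G) (e : R -> G) (x : R).

Lemma smooth_mulg h : smooth_map (fun y : G => (h * y)%g).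
Proof.
exact: smooth_map2_compose (smooth_map_cst _) (@smooth_map_id _ _ G) (@lie_mul_smooth R k G).
Qed.

Lemma smooth_mulgr h : smooth_map (fun y : G => (y * h)%g).
Proof.
exact: smooth_map2_compose (@smooth_map_id _ _ G) (smooth_map_cst _) (@lie_mul_smooth R k G).
Qed.

Lemma smooth_near_map m n (M : manifoldType R m) (N : manifoldType R n) (F : M -> N)
    (c : R -> M) x : smooth_map F -> smooth_near c x -> smooth_near (fun s => F (c s)) x.
Proof. by move=> sF [U [oU Ux sc]]; exists U; split=> //; exact: smooth_map_comp. Qed.

(* The Leibniz rule applied to [e s * (e s)^-1 = 1] *)
Lemma velocity_inv_eq e x : smooth_near e x ->
  tdiff (fun y : G => (y * (e x)^-1)%g) (velocity e x) =
  - tdiff (fun y : G => (e x * y)%g) (velocity (fun s => (e s)^-1%g) x).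
Proof.
move=> [U [oU Ux se]]; rewrite !tdiff_velocity; [|exact: smooth_mulg|exact: smooth_mulgr].
have si : smooth_into U (fun s => (e s)^-1%g) by exact: smooth_map_comp lie_inv_smooth oU.
have H := velocity_map2 (@lie_mul_smooth R k G) se si oU Ux.
apply/eqP; rewrite -subr_eq0 opprK -H; apply/eqP.
rewrite -(velocity_cst (1%g : G) x); congr (velocity _ x).
by apply/funext => s; rewrite mulgV.
Qed.

Variable b : metric_on G.
Hypothesis bR : riemannian b.
Hypothesis bI : bi_invariant b.

Lemma bi_invariant_mulg h p v : tangent p v ->
  b (h * p)%g (tdiff (fun y => (h * y)%g) v) (tdiff (fun y => (h * y)%g) v) = b p v v.
Proof. by move=> tv; exact: (bI h).1. Qed.

Lemma bi_invariant_mulgr h p v : tangent p v ->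
  b (p * h)%g (tdiff (fun y => (y * h)%g) v) (tdiff (fun y => (y * h)%g) v) = b p v v.
Proof. by move=> tv; exact: (bI h).2. Qed.

(** The velocity of the inverse is carried to the identity by a left translation and that of [e] by
    a right translation; there they are opposite by [velocity_inv_eq]. Left and right invariance
    meet here. *)
Lemma speed_inv e x : smooth_near e x ->
  b (e x)^-1%g (velocity (fun s => (e s)^-1%g) x) (velocity (fun s => (e s)^-1%g) x) =
  b (e x) (velocity e x) (velocity e x).
Proof.
move=> se; have te := smooth_near_tangent se.
have ti := smooth_near_tangent (smooth_near_map lie_inv_smooth se).
rewrite -(bi_invariant_mulg (e x) ti) -(bi_invariant_mulgr (e x)^-1%g te).
rewrite (velocity_inv_eq se) riem_opp// mulgV.
by have := tdiff_tangent (smooth_mulg (e x)) ti; rewrite mulgV.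
Qed.

End lie_groups.

Section connections_along_curves.
Context {R : realType} {k m l : nat} {G : lieGroupType R k}
  {M : manifoldType R m} {P : manifoldType R l}.
Variables (pi : P -> M) (act : P -> G -> P) (theta : form_on G P).
Hypothesis hP : principal_bundle pi act.
Hypothesis th : principal_connection act theta.

Let sact : smooth_map2_on [set: P * G] act. Proof. by case: hP => -[]. Qed.
Let act1 p : act p 1%g = p. Proof. by case: hP => _ []. Qed.
Let actM p g h : act (act p g) h = act p (g * h)%g. Proof. by case: hP => _ []. Qed.

Lemma smooth_act g : smooth_map (act^~ g).
Proof. exact: smooth_map2_compose (@smooth_map_id _ _ P) (smooth_map_cst _) sact. Qed.

Lemma smooth_orbit p : smooth_map (act p).
Proof. exact: smooth_map2_compose (smooth_map_cst _) (@smooth_map_id _ _ G) sact. Qed.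

(** The Leibniz rule splits the velocity in two. Equivariance of [theta] evaluates the part where w
    is frozen; the part where c is frozen is the fundamental vector of w^-1 w' at the point c w. *)
Lemma connection_act_velocity (c : R -> P) (w : R -> G) x :
  smooth_near c x -> smooth_near w x ->
  theta (act (c x) (w x)) (velocity (fun s => act (c s) (w s)) x) =
  Ad (w x)^-1%g (theta (c x) (velocity c x)) +
  tdiff (fun y => ((w x)^-1 * y)%g) (velocity w x).
Proof.
move=> cn wn; have [U [oU Ux sc sw]] := smooth_near_common cn wn.
have [_ _ _ thR thF] := th.
have tc := tangent_velocity sc oU Ux; have tw := tangent_velocity sw oU Ux.
rewrite (velocity_map2 sact sc sw oU Ux).
rewrite -(tdiff_velocity c x (smooth_act (w x))).
have E : velocity (fun s => act (c x) (w s)) x =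
    tdiff (act (act (c x) (w x))) (tdiff (fun y => ((w x)^-1 * y)%g) (velocity w x)).
  rewrite tdiff_comp; last exact: smooth_orbit.
  rewrite tdiff_velocity; last exact: smooth_map_compose (smooth_mulg _) (smooth_orbit _).
  by congr (velocity _ x); apply/funext => s; rewrite actM mulVKg.
have t1 : tangent (1%g : G) (tdiff (fun y => ((w x)^-1 * y)%g) (velocity w x)).
  by have := tdiff_tangent (smooth_mulg (w x)^-1%g) tw; rewrite mulVg.
have t2 : tangent (act (c x) (w x)) (velocity (fun s => act (c x) (w s)) x).
  rewrite E; have := tdiff_tangent (smooth_orbit (act (c x) (w x))) t1.
  by rewrite act1.
have t3 := tdiff_tangent (smooth_act (w x)) tc.
by rewrite (connection_add th t3 t2) thR// E thF.
Qed.

(** For w = e^-1 the first term of [connection_act_velocity] is Ad(e) theta(c') = e' e^-1, and the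
    second is e (e^-1)' = - e' e^-1. *)
Lemma horizontal_correction (c : R -> P) (e : R -> G) x :
  smooth_near c x -> smooth_near e x ->
  velocity e x = tdiff (fun y => (e x * y)%g) (theta (c x) (velocity c x)) ->
  theta (act (c x) (e x)^-1%g) (velocity (fun s => act (c s) (e s)^-1%g) x) = 0.
Proof.
move=> cn en ve.
have win := smooth_near_map (@lie_inv_smooth R k G) en.
rewrite (connection_act_velocity cn win) invgK /Ad.
set xi := theta _ _ in ve *.
have -> : tdiff (fun y : G => (e x * y * (e x)^-1)%g) xi =
    tdiff (fun y : G => (y * (e x)^-1)%g) (velocity e x).
  by rewrite ve tdiff_comp//; exact: smooth_mulgr.
by rewrite velocity_inv_eq// addNr.
Qed.

Lemma left_development (c : R -> P) a b g : a <= b -> pws a b c ->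
  exists e : R -> G, [/\ e a = g, pws a b e & off_finite (fun x =>
    velocity e x = tdiff (fun y => (e x * y)%g) (theta (c x) (velocity c x))) a b].
Proof.
move=> ab pc.
have [] := @pws_lift R l k P G c (fun _ _ => True) (fun e x =>
    velocity e x = tdiff (fun y => (e x * y)%g) (theta (c x) (velocity c x))) a b ab pc _ _ g Logic.I.
- by move=> e d x ed; rewrite (velocity_near ed) (nbhs_singleton ed).
- move=> U gam t0 oU Ut sg.
  have [] := @left_ode R k G U t0 (fun x => theta (gam x) (velocity gam x)) oU Ut.
  + by move=> t Ut'; apply: (connection_tangent th); exact: tangent_velocity sg oU Ut'.
  + by move=> f sf; exact (connection_velocity_smooth th sg oU sf).
  move=> d d0 [e [se bU et0 He]]; exists d => // s t as_ st tb sd td gE p _.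
  have ob : open (ball t0 d) by exact: ball_open.
  have inb x : s <= x <= t -> ball t0 d x.
    move=> /andP[sx xt]; apply/ballR.
    by rewrite ltr_distl (lt_le_trans sd sx) (le_lt_trans xt td).
  (* A left translate of a solution is a solution, which allows any initial value [p] at [s]. *)
  exists (fun x => (p * (e s)^-1 * e x)%g); split=> //.
  + by rewrite mulgVK.
  + by apply: (pws_smooth ob _ inb); exact: smooth_map_comp se (smooth_mulg _) ob.
  + apply: off_finite_all => x /andP[sx xt].
    have bx : ball t0 d x by apply: inb; rewrite !ltW.
    have -> : velocity c x = velocity gam x.
      apply: velocity_near.
      have ost : open `]s, t[%classic by exact: itv_open.
      apply: filterS (open_nbhs_nbhs (conj ost _)); last by rewrite /= in_itv/= sx.
      by move=> r; rewrite /= in_itv/= => /andP[sr rt]; apply: gE; rewrite !ltW.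
    rewrite gE ?(ltW sx)// ?(ltW xt)//.
    rewrite -(tdiff_velocity e x (smooth_mulg (p * (e s)^-1)%g)) He//.
    rewrite tdiff_comp; last exact: smooth_mulg.
    by apply: (congr1 (fun F : G -> G => tdiff F _)); apply/funext => y; rewrite !mulgA.
- by move=> e [ea pe oe _]; exists e.
Qed.

Lemma horizontal_pws (c : R -> P) : horizontal theta c <->
  pws 0 1 c /\ off_finite (fun x => theta (c x) (velocity c x) = 0) 0 1.
Proof.
split=> [[j [t [[[t0 tj tl] ta] tP]]]|[pc oc]].
  have H : subdivided (fun x => theta (c x) (velocity c x) = 0) c 0 1 by exists j, t.
  by have [] := subdivided_pws H.
have [j [t [t0 tj tl ta tP]]] := pws_subdivided ler01 pc oc.
by exists j, t.
Qed.

Let hj := hjoined theta.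

Lemma hjoinedP x y : hj x y <-> exists c : R -> P, [/\ pws 0 1 c,
  off_finite (fun s => theta (c s) (velocity c s) = 0) 0 1, c 0 = x & c 1 = y].
Proof.
split=> [[c [/horizontal_pws[pc oc] c0 c1]]|[c [pc oc c0 c1]]]; exists c; split=> //.
exact/horizontal_pws.
Qed.

Lemma hjoined_refl x : hj x x.
Proof.
apply/hjoinedP; exists (fun=> x); split=> //.
  exact: pws_smooth openT (smooth_into_cst _ _) _.
by apply: off_finite_all => s _; rewrite velocity_cst (connection0 th).
Qed.

Lemma connectionN p v : tangent p v -> theta p v = 0 -> forall a, theta p (a *: v) = 0.
Proof.
move=> tv E a; have := connection_lin th a tv (tangent0 p).
by rewrite addr0 E scaler0 (connection0 th) addr0.
Qed.

Lemma hjoined_sym x y : hj x y -> hj y x.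
Proof.
move=> /hjoinedP[c [pc oc c0 c1]].
have p1 : pws (-1) 0 (fun s => c (- s)) by apply: pws_opp; rewrite oppr0 opprK.
have o1 : off_finite (fun s => theta (c (- s)) (velocity c (- s)) = 0 /\ smooth_near c (- s)) (-1) 0.
  apply: (@off_finite_opp _ (fun s => theta (c s) (velocity c s) = 0 /\ smooth_near c s)).
  by rewrite oppr0 opprK; apply: off_finite_and => //; exact: pws_off_finite.
(* The reversed curve s |-> c(1 - s), written as a reflection followed by a shift of the
   parameter. *)
have p2 : pws 0 1 (fun s => c (- (1 * s - 1))).
  apply: (@pws_affine _ _ _ 0 1 (fun s => c (- s)) 1 (-1)) => //.
  by rewrite mulr0 add0r mulr1 subrr.
have o2 : off_finite (fun s => theta (c (- (1 * s - 1))) (velocity c (- (1 * s - 1))) = 0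
    /\ smooth_near c (- (1 * s - 1))) 0 1.
  apply: (@off_finite_affine _ (fun s => theta (c (- s)) (velocity c (- s)) = 0
    /\ smooth_near c (- s)) 0 1 1 (-1)) => //.
  by rewrite mulr0 add0r mulr1 subrr.
apply/hjoinedP; exists (fun s => c (- (1 * s - 1))); split=> //.
- apply: off_finite_sub o2 => s _.
  have E (r : R) : - (1 * r - 1) = -1 * r + 1 by ring.
  rewrite (_ : (fun s => c (- (1 * s - 1))) = (fun s => c (-1 * s + 1))); last first.
    by apply/funext => r; rewrite E.
  rewrite E => -[t0 sn]; rewrite velocity_affine//.
  exact: connectionN (smooth_near_tangent sn) t0 _.
- by rewrite mulr0 add0r opprK.
- by rewrite mulr1 subrr oppr0.
Qed.

Lemma hjoined_trans x y z : hj x y -> hj y z -> hj x z.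
Proof.
move=> /hjoinedP[c1 [p1 o1 c10 c11]] /hjoinedP[c2 [p2 o2 c20 c21]].
pose c s := if s <= 1/2 then c1 (2 * s + 0) else c2 (2 * s - 1) : P.
have h0 : 0 <= 1/2 :> R by lra.
have h1 : 1/2 <= 1 :> R by lra.
have E1 s : s <= 1/2 -> c s = c1 (2 * s + 0) by rewrite /c => ->.
have E2 s : 1/2 <= s -> c s = c2 (2 * s - 1).
  rewrite le_eqVlt => /predU1P[<-|sh]; last by rewrite /c leNgt sh.
  rewrite E1// (_ : 2 * (1/2) + 0 = 1 :> R) ?c11; last by lra.
  by rewrite (_ : 2 * (1/2) - 1 = 0 :> R) ?c20//; lra.
have piece (d : R -> P) (a b be : R) (E : forall s, a <= s <= b -> c s = d (2 * s + be)) :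
    2 * a + be = 0 -> 2 * b + be = 1 -> pws 0 1 d ->
    off_finite (fun s => theta (d s) (velocity d s) = 0) 0 1 ->
    pws a b c /\ off_finite (fun s => theta (c s) (velocity c s) = 0) a b.
  move=> Ea Eb pd od; split.
    apply: (@pws_congr _ _ _ _ _ (fun s => d (2 * s + be))) => [s sab|]; first by rewrite E.
    by apply: pws_affine => //; rewrite Ea Eb.
  have H : off_finite (fun s => theta (d (2 * s + be)) (velocity d (2 * s + be)) = 0
      /\ smooth_near d (2 * s + be)) a b.
    apply: (@off_finite_affine _ (fun s => theta (d s) (velocity d s) = 0 /\ smooth_near d s)) => //.
    by rewrite Ea Eb; apply: off_finite_and => //; exact: pws_off_finite.
  apply: off_finite_sub H => s /andP[as_ sb] [t0 sn].
  have -> : velocity c s = velocity (fun s => d (2 * s + be)) s.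
    apply: velocity_near.
    have oab : open `]a, b[%classic by exact: itv_open.
    apply: filterS (open_nbhs_nbhs (conj oab _)); last by rewrite /= in_itv/= as_.
    by move=> r; rewrite /= in_itv/= => /andP[ar rb]; apply: E; rewrite !ltW.
  rewrite E ?ltW// velocity_affine//.
  exact: connectionN (smooth_near_tangent sn) t0 _.
have [pa oa] : pws 0 (1/2) c /\ off_finite (fun s => theta (c s) (velocity c s) = 0) 0 (1/2).
  by apply: (piece c1 0 (1/2) 0) => // [s /andP[_ /E1]//||]; lra.
have [pb ob] : pws (1/2) 1 c /\ off_finite (fun s => theta (c s) (velocity c s) = 0) (1/2) 1.
  by apply: (piece c2 (1/2) 1 (-1)) => // [s /andP[/E2 ]//||]; lra.
apply/hjoinedP; exists c; split.
- exact: pws_cat pa pb.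
- exact: off_finite_cat oa ob.
- by rewrite E1// mulr0 addr0.
- by rewrite E2// (_ : 2 * 1 - 1 = 1 :> R)//; lra.
Qed.

Lemma hjoined_act x y g : hj x y -> hj (act x g) (act y g).
Proof.
move=> /hjoinedP[c [pc oc c0 c1]]; apply/hjoinedP; exists (fun s => act (c s) g).
split; [exact: pws_map (smooth_act g) pc| |by rewrite c0|by rewrite c1].
apply: off_finite_sub (off_finite_and oc (pws_off_finite pc)) => s _ [t0 sn].
have [_ _ _ thR _] := th.
rewrite -(tdiff_velocity c s (smooth_act g)) thR ?t0; last exact: smooth_near_tangent.
exact: tdiff0.
Qed.

(** The chain u ~ y ~ y h ~ u h, whose last link is y ~ u translated by h. The holonomy groups at
    points of one holonomy bundle thus coincide, without conjugation. *)
Lemma Hol_of_bundle u y h : hj u y -> hj y (act y h) -> Hol act theta u h.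
Proof.
move=> uy yh; apply: (hjoined_trans uy); apply: (hjoined_trans yh).
by apply: hjoined_act; exact: hjoined_sym.
Qed.

Lemma Hol_act u y h : hj u y -> Hol act theta u h -> hj u (act y h).
Proof. by move=> uy Hh; apply: hjoined_trans Hh _; exact: hjoined_act. Qed.

Lemma horizontal_projection (c : R -> P) g : pws 0 1 c ->
  exists e : R -> G, [/\ e 0 = g, pws 0 1 e, off_finite (fun x => smooth_near e x /\
    velocity e x = tdiff (fun y => (e x * y)%g) (theta (c x) (velocity c x))) 0 1 &
    hj (act (c 0) g^-1%g) (act (c 1) (e 1%R)^-1%g)].
Proof.
move=> pc; have [e [e0 pe oe]] := left_development g ler01 pc.
exists e; split=> //; first exact: off_finite_and (pws_off_finite pe) oe.
apply/hjoinedP; exists (fun x => act (c x) (e x)^-1%g); split=> //; last by rewrite e0.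
  exact: pws_map2 sact pc (pws_map lie_inv_smooth pe).
have H := off_finite_and oe (off_finite_and (pws_off_finite pc) (pws_off_finite pe)).
apply: off_finite_sub H => x _ [ve [cn en]].
exact: horizontal_correction.
Qed.

End connections_along_curves.

(** * Lengths *)

Section lengths.
Context {R : realType}.

(** The interval is the union of an open set on which [f] is continuous and of the finite set [F],
    which contains the end points and the exceptional points and all of whose subsets are
    measurable. The values of a speed at break points are thus harmless. *)
Lemma off_finite_measurable (f : R -> R) (a b : R) : a <= b ->
  off_finite (fun x => {for x, continuous f}) a b -> measurable_fun `[a, b] f.
Proof.
move=> ab H; pose F := [set x | a <= x <= b /\ ~ (a < x < b /\ {for x, continuous f})].
have fF : finite_set F.
  apply: off_finite_finite => //; apply: off_finite_sub H => x xab cx.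
  by split.
have cF : closed F.
  by apply: compact_closed; [exact: Rhausdorff|exact: finite_compact].
pose D := `]a, b[%classic `\` F.
have oD : open D by apply: openI; [exact: itv_open|exact: closed_openC].
have E : `[a, b]%classic = D `|` F.
  apply/seteqP; split=> x; rewrite /= in_itv/=.
    move=> xab; have [[xo cx]|nx] := pselect (a < x < b /\ {for x, continuous f}).
      by left; split; [rewrite /= in_itv|move=> [_]; exact].
    by right.
  by move=> [[+ _]|[]//]; rewrite /= in_itv/= => /andP[/ltW-> /ltW->].
have mF (A : set R) : A `<=` F -> measurable A.
  move=> AF; apply: countable_measurable; first exact: measurable_set1.
  by apply: finite_set_countable; exact: sub_finite_set fF.
rewrite E; apply/measurable_funU; [exact: open_measurable|exact: mF|split].
  apply: open_continuous_measurable_fun => // x; rewrite inE => -[+ nF].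
  rewrite /= in_itv/= => xab; apply: contrapT => cx; apply: nF; split.
    by case/andP: xab => /ltW-> /ltW->.
  by move=> [].
by move=> _ Y _; apply: mF => x [].
Qed.

Section speed.
Context {n : nat} {N : manifoldType R n} (g : metric_on N).
Implicit Types (a b : R) (c : R -> N).

Definition speed c s := Num.sqrt (g (c s) (velocity c s) (velocity c s)).

(** The regularity of a metric that lengths use; it puts the metric of P on the same footing as the
    metrics known to be Riemannian. *)
Definition smooth_speed := forall (U : set R) c, open U -> smooth_into U c ->
  smooth_on U (fun s => g (c s) (velocity c s) (velocity c s)).

Hypothesis gS : smooth_speed.

Lemma speed_continuous c (U : set R) x : open U -> smooth_into U c -> U x ->
  {for x, continuous (speed c)}.
Proof.
move=> oU sc Ux; apply: (@continuous_comp _ _ _ _ (@Num.sqrt R)).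
  exact: smooth_on_cont (gS oU sc) Ux.
exact: sqrt_continuous.
Qed.

Lemma speed_measurable c a b : a <= b -> pws a b c -> measurable_fun `[a, b] (speed c).
Proof.
move=> ab /pws_off_finite H; apply: off_finite_measurable => //.
by apply: off_finite_sub H => x _ [U [oU Ux sc]]; exact: speed_continuous oU sc Ux.
Qed.

Lemma speed_near c d x : (\forall y \near x, c y = d y) -> speed c x = speed d x.
Proof. by move=> cd; rewrite /speed (velocity_near cd) (nbhs_singleton cd). Qed.

(** Around [t0] the speed is compared with the continuous speeds of the smooth extensions [cl] and
    [cr]. At [a], [b] and [t0] the curve need not agree with them on a neighborhood, so its speeds
    at these points enter the bound separately; all five terms are nonnegative, whence their sum
    dominates each. *)
Lemma speed_bounded c a b : a <= b -> pws a b c ->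
  exists K, forall x, a <= x <= b -> speed c x <= K.
Proof.
move=> ab pc.
apply: (@interval_glue _ (fun s t => exists K, forall x, s <= x <= t -> speed c x <= K) a b ab).
  move=> s t r _ _ _ _ [K1 H1] [K2 H2]; exists (Num.max K1 K2) => x /andP[sx xr].
  rewrite le_max; have [xt|/ltW tx] := leP x t.
    by rewrite H1// sx.
  by rewrite orbC H2// tx.
move=> t0 t0ab; have [d d0 [[cl [scl Ecl]] [cr [scr Ecr]]]] := pc t0 t0ab.
have ob : open (ball t0 d) by exact: ball_open.
have bt : ball t0 d t0 by exact: ballxx.
have loc e : smooth_into (ball t0 d) e -> exists2 d', 0 < d' &
    forall x, `|x - t0| < d' -> speed e x <= speed e t0 + 1.
  move=> se; have ce := speed_continuous ob se bt.
  have /nbhs_ballP[d' /= d'0 Hd] : \forall x \near t0, speed e x < speed e t0 + 1.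
    by apply: (ce [set y | y < speed e t0 + 1]); apply: lt_nbhsl; rewrite ltrDl.
  by exists d' => // x xt; apply/ltW/Hd/ballR.
have [d1 d10 H1] := loc _ scl; have [d2 d20 H2] := loc _ scr.
have ge0 e x : 0 <= speed e x by exact: sqrtr_ge0.
pose K := speed c a + speed c b + speed c t0 + (speed cl t0 + 1) + (speed cr t0 + 1).
have [Ka Kb Kt Kl Kr] : [/\ speed c a <= K, speed c b <= K, speed c t0 <= K,
    speed cl t0 + 1 <= K & speed cr t0 + 1 <= K].
  rewrite /K; have := ge0 c a; have := ge0 c b; have := ge0 c t0.
  have := ge0 cl t0; have := ge0 cr t0.
  move: (speed c a) (speed c b) (speed c t0) (speed cl t0) (speed cr t0) => *.
  by split; lra.
exists (Num.min d (Num.min d1 d2)); first by rewrite !lt_min d0 d10.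
move=> s t as_ st0 t0t tb.
rewrite ltrBlDr -ltrBlDl !lt_min => /and3P[sd sd1 sd2].
rewrite -ltrBlDl !lt_min => /and3P[td td1 td2].
have H x : s <= x <= t -> speed c x <= K.
  move=> /andP[sx xt].
  have [xt0|t0x|->] := ltgtP x t0; last exact: Kt.
    have [->|xa] := eqVneq x a; first exact: Ka.
    have ax : a < x by rewrite lt_neqAle eq_sym xa (le_trans as_).
    have xd : t0 - x < d by apply: le_lt_trans sd; rewrite lerD2l lerN2.
    rewrite (@speed_near c cl).
      apply: le_trans (H1 x _) Kl.
      by rewrite distrC ger0_norm ?subr_ge0 ?(ltW xt0)// (le_lt_trans _ sd1)// lerD2l lerN2.
    have oI : open `]Num.max a (t0 - d), t0[%classic by exact: itv_open.
    have Ix : `]Num.max a (t0 - d), t0[%classic x.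
      by rewrite /= in_itv/= gt_max ax xt0 ltrBlDr -ltrBlDl xd.
    apply: filterS (open_nbhs_nbhs (conj oI Ix)) => y.
    rewrite /= in_itv/= gt_max => /andP[/andP[ay yd] yt].
    by apply: Ecl => //; rewrite !ltW.
  have [->|xb] := eqVneq x b; first exact: Kb.
  have bx : x < b by rewrite lt_neqAle xb (le_trans xt).
  have xd : x - t0 < d by apply: le_lt_trans td; rewrite lerD2r.
  rewrite (@speed_near c cr).
    apply: le_trans (H2 x _) Kr.
    by rewrite ger0_norm ?subr_ge0 ?(ltW t0x)// (le_lt_trans _ td2)// lerD2r.
  have oI : open `]t0, Num.min b (t0 + d)[%classic by exact: itv_open.
  have Ix : `]t0, Num.min b (t0 + d)[%classic x.
    by rewrite /= in_itv/= lt_min bx t0x -ltrBlDl xd.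
  apply: filterS (open_nbhs_nbhs (conj oI Ix)) => y.
  rewrite /= in_itv/= lt_min => /andP[ty /andP[yb yd]].
  by apply: Ecr => //; rewrite !ltW.
split; exists K => x xst; apply: H => //.
by case/andP: xst => -> xt; rewrite (le_trans xt).
Qed.

Lemma curve_lengthE c : curve_length g c =
  (\int[lebesgue_measure]_(s in `[0%R, 1%R]) (speed c s)%:E)%E.
Proof. by []. Qed.

Lemma curve_length_ge0 c : (0 <= curve_length g c)%E.
Proof. by apply: integral_ge0 => x _; rewrite lee_fin sqrtr_ge0. Qed.

Lemma curve_length_fin c : pws 0 1 c -> (curve_length g c < +oo)%E.
Proof.
move=> pc; have [K HK] := speed_bounded ler01 pc.
have K0 : 0 <= K.
  by apply: le_trans (sqrtr_ge0 _) (HK 0 _); rewrite lexx ler01.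
rewrite curve_lengthE.
apply: (@le_lt_trans _ _ (\int[lebesgue_measure]_(s in `[0%R, 1%R]) (cst K%:E s))%E).
  apply: ge0_le_integral => //.
  - by move=> x _; rewrite lee_fin sqrtr_ge0.
  - by apply/measurable_EFinP; exact: speed_measurable.
rewrite integral_cst//= lebesgue_measure_itv/= lte_fin ltr01 oppr0 adde0 mule1.
exact: ltry.
Qed.

End speed.

Section comparison.
Context {n1 n2 n3 : nat} {N1 : manifoldType R n1} {N2 : manifoldType R n2}
  {N3 : manifoldType R n3}.
Variables (g1 : metric_on N1) (g2 : metric_on N2) (g3 : metric_on N3).
Hypothesis (S1 : smooth_speed g1) (S2 : smooth_speed g2) (S3 : smooth_speed g3).

Lemma off_finite_ae (Phi : R -> Prop) : off_finite Phi 0 1 ->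
  {ae lebesgue_measure, forall x : R, `[0, 1]%classic x -> Phi x}.
Proof.
move=> H; have F := off_finite_finite ler01 H.
set A := [set x | _] in F.
have cA : countable A by exact: finite_set_countable.
exists A; split.
- by apply: countable_measurable => // t; exact: measurable_set1.
- exact: countable_lebesgue_measure0.
- move=> x /not_implyP[]; rewrite /= in_itv/= => x01 nP; split=> //.
Qed.

Lemma curve_length_le c1 c2 : pws 0 1 c1 -> pws 0 1 c2 ->
  off_finite (fun s => speed g1 c1 s <= speed g2 c2 s) 0 1 ->
  (curve_length g1 c1 <= curve_length g2 c2)%E.
Proof.
move=> p1 p2 H; rewrite !curve_lengthE; apply: ae_ge0_le_integral => //.
- by move=> x _; rewrite lee_fin sqrtr_ge0.
- by apply/measurable_EFinP; exact: speed_measurable.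
- by move=> x _; rewrite lee_fin sqrtr_ge0.
- by apply/measurable_EFinP; exact: speed_measurable.
- by apply: off_finite_ae; apply: off_finite_sub H => x _; rewrite lee_fin.
Qed.

Lemma curve_length_le_add c1 c2 c3 : pws 0 1 c1 -> pws 0 1 c2 -> pws 0 1 c3 ->
  off_finite (fun s => speed g1 c1 s <= speed g2 c2 s + speed g3 c3 s) 0 1 ->
  (curve_length g1 c1 <= curve_length g2 c2 + curve_length g3 c3)%E.
Proof.
move=> p1 p2 p3 H; rewrite !curve_lengthE -ge0_integralD//=; last first.
- by apply/measurable_EFinP; exact: speed_measurable.
- by move=> x _; rewrite lee_fin sqrtr_ge0.
- by apply/measurable_EFinP; exact: speed_measurable.
- by move=> x _; rewrite lee_fin sqrtr_ge0.
apply: ae_ge0_le_integral => //.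
- by move=> x _; rewrite lee_fin sqrtr_ge0.
- by apply/measurable_EFinP; exact: speed_measurable.
- by move=> x _; rewrite -EFinD lee_fin addr_ge0// sqrtr_ge0.
- apply: emeasurable_funD; apply/measurable_EFinP; exact: speed_measurable.
- by apply: off_finite_ae; apply: off_finite_sub H => x _; rewrite -EFinD lee_fin.
Qed.

End comparison.
End lengths.

(** * Comparison of the distances *)

Section connectedness.
Context {R : realType} {n : nat} {N : manifoldType R n}.

(** The local hypothesis makes both [A] and its complement open. *)
Lemma connected_induction (A : N -> Prop) (x0 : N) : connected [set: N] ->
  (forall p, exists V : set N, [/\ open V, V p & forall x y, V x -> V y -> A x -> A y]) ->
  A x0 -> forall x, A x.
Proof.
move=> cN loc Ax0.
suff E : [set x | A x] = [set: N] by move=> x; rewrite -[A x]/([set x | A x] x) E.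
apply: cN; first by exists x0.
- exists [set x | A x]; last by rewrite setTI.
  rewrite openE => p Ap; have [V [oV Vp H]] := loc p.
  by apply: filterS (open_nbhs_nbhs (conj oV Vp)) => y Vy; exact: H Vp Vy Ap.
- exists [set x | A x]; last by rewrite setTI.
  rewrite -[X in closed X]setCK; apply: open_closedC.
  rewrite openE => p nAp; have [V [oV Vp H]] := loc p.
  by apply: filterS (open_nbhs_nbhs (conj oV Vp)) => y Vy /(H _ _ Vy Vp).
Qed.

(** A ball in a chart is convex, so it contains the segments between its points. The parameter
    ranges over the open set [J] of times spent in the ball, since smoothness on [0, 1] means
    smoothness on a neighborhood. *)
Lemma chart_segment (p : N) (U : set N) : open U -> U p ->
  exists V : set N, [/\ open V, V p & forall x y, V x -> V y ->
    exists (J : set R) (gam : R -> N), [/\ open J /\ smooth_into J gam,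
      forall t, 0 <= t <= 1 -> J t, gam 0 = x, gam 1 = y & forall t, J t -> U (gam t)]].
Proof.
move=> oU Up; have [phi aphi dp] := atlas_cover p.
have oC : open (phi @` (chart_dom phi `&` U)) by exact: open_chart_image.
have Cp : (phi @` (chart_dom phi `&` U)) (phi p) by exists p.
have /nbhs_ballP[r /= r0 rC] := open_nbhs_nbhs (conj oC Cp).
have ob : open (ball (phi p) r) by exact: ball_open.
exists (chart_dom phi `&` phi @^-1` ball (phi p) r); split.
- by apply: open_capl_preimage => //; [exact: chart_dom_open|exact: chart_map_cts].
- by split=> //=; exact: ballxx.
move=> x y [dx bx] [dy b_y].
pose l (t : R) := phi x + t *: (phi y - phi x).
have cl : continuous l.
  move=> t; apply: cvgD; first exact: cvg_cst.
  by apply: cvgZr_tmp; exact: cvg_id.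
have oJ : open (l @^-1` ball (phi p) r) by apply: open_comp => // t _; exact: cl.
exists (l @^-1` ball (phi p) r), (fun t => chart_inv phi (l t)); split.
- split=> //; apply: smooth_into_inv => //.
    apply/(smooth_on_rowP _ oJ) => i.
    have Hl : smooth_on (l @^-1` ball (phi p) r)
        (fun t : R => phi x ord0 i + t * (phi y - phi x) ord0 i).
      apply: smooth_onD => //; first exact: smooth_on_cst.
      by apply: smooth_onM => //; [exact: smooth_on_id|exact: smooth_on_cst].
    by apply: smooth_on_congr Hl => // t _; rewrite !mxE.
  by move=> t /rC[z [dz _] <-]; exact: chart_image.
- move=> t /andP[t0 t1]; rewrite /= -ball_normE/=.
  move: bx b_y; rewrite /= -!ball_normE/= => bx b_y.
  have -> : phi p - l t = (1 - t) *: (phi p - phi x) + t *: (phi p - phi y).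
    by apply/rowP => i; rewrite !mxE; ring.
  have [->|tn] := eqVneq t 0; first by rewrite subr0 scale1r scale0r addr0.
  have t_gt0 : 0 < t by rewrite lt_neqAle eq_sym tn.
  apply: le_lt_trans (ler_normD _ _) _; rewrite !normrZ !ger0_norm ?subr_ge0//.
  have -> : r = (1 - t) * r + t * r by ring.
  by apply: ler_ltD; [apply: ler_wpM2l; rewrite ?subr_ge0// ltW|rewrite ltr_pM2l].
- by rewrite /l scale0r addr0 chart_mapK.
- by rewrite /l scale1r addrC subrK chart_mapK.
- by move=> t /rC[z [dz Uz] <-]; rewrite chart_mapK.
Qed.

Lemma connected_pws (x y : N) : connected [set: N] ->
  exists c : R -> N, [/\ pws 0 1 c, c 0 = x & c 1 = y].
Proof.
move=> cN.
(* Curves are prolonged on growing intervals [0, T] and rescaled to [0, 1] only once. *)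
suff [T [c [T0 pc c0 cT]]] : exists T c, [/\ 0 < T, pws 0 T c, c 0 = x & c T = y].
  exists (fun s => c (T * s + 0)); split.
  - by apply: pws_affine => //; rewrite mulr0 mulr1 !addr0.
  - by rewrite mulr0 addr0.
  - by rewrite mulr1 addr0.
apply: (@connected_induction (fun y => exists T c, [/\ 0 < T, pws 0 T c, c 0 = x & c T = y]) x cN).
  move=> p; have [V [oV Vp HV]] := chart_segment openT (Logic.I : [set: N] p).
  exists V; split=> // z w Vz Vw [T [c [T0 pc c0 cT]]].
  have [J [gam [[oJ sg] J01 g0 g1 _]]] := HV z w Vz Vw.
  pose d s := if s <= T then c s else gam (1 * s - T).
  have E1 s : s <= T -> d s = c s by rewrite /d => ->.
  have E2 s : T <= s -> d s = gam (1 * s - T).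
    rewrite le_eqVlt => /predU1P[<-|Ts]; last by rewrite /d leNgt Ts.
    by rewrite E1// mul1r subrr g0.
  exists (T + 1), d; split.
  - by rewrite addr_gt0.
  - apply: (@pws_cat _ _ _ 0 T); rewrite ?lerDl ?(ltW T0)//.
      by apply: pws_congr pc => s /andP[_ sT]; rewrite E1.
    apply: (@pws_congr _ _ _ _ _ (fun s => gam (1 * s - T))).
      by move=> s /andP[Ts _]; rewrite E2.
    apply: pws_affine => //; rewrite !mul1r subrr addrAC subrr add0r.
    exact: pws_smooth oJ sg _.
  - by rewrite E1// ltW.
  - by rewrite E2 ?lerDl// mul1r addrAC subrr add0r g1.
exists 1, (fun=> x); split=> //.
exact: pws_smooth openT (smooth_into_cst _ _) _.
Qed.

End connectedness.

Section submersion_curves.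
Context {R : realType} {k r : nat} {G : lieGroupType R k} {Q : manifoldType R r}.
Variables (b : metric_on G) (gQ : metric_on Q) (q : G -> Q) (H : set G).
Hypothesis bR : riemannian b.
Hypothesis bI : bi_invariant b.
Hypothesis hq : coset_projection H q.
Hypothesis qS : riemannian_submersion b gQ q.

Lemma coset_lift (gam : R -> Q) (g : G) : pws 0 1 gam -> q g = gam 0 ->
  exists al : R -> G, [/\ al 0 = g, pws 0 1 al,
    off_finite (fun x => speed b al x = speed gQ gam x) 0 1 &
    forall x, 0 <= x <= 1 -> q (al x) = gam x].
Proof.
move=> pg qg; have [qsurj qcoset _] := hq.
apply: (@pws_lift R r k Q G gam (fun x p => q p = gam x)
  (fun al x => speed b al x = speed gQ gam x) 0 1 ler01 pg _ _ g qg).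
  by move=> c d x cd; rewrite -(speed_near _ cd).
move=> U g' t0 oU Ut sg; have [a0 qa0] := qsurj (g' t0).
have [d d0 [al [sal bU al0 Hal]]] := riem_submersion_lift bR qS oU Ut sg qa0.
exists d => // s t as_ st tb sd td gE p qp.
have ob : open (ball t0 d) by exact: ball_open.
have inb x : s <= x <= t -> ball t0 d x.
  move=> /andP[sx xt]; apply/ballR.
  by rewrite ltr_distl (lt_le_trans sd sx) (le_lt_trans xt td).
have ss : s <= s <= t by rewrite lexx.
(* The local lift starts at an arbitrary point over the curve. It is moved to [p] by the right
   translation by [h], which lies in the subgroup because both points have the same image, so it
   changes neither the projection nor, by bi-invariance, the speed. *)
have Hh : H ((al s)^-1 * p)%g.
  by apply/qcoset; rewrite qp (Hal s (inb s ss)).1 gE.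
set h := ((al s)^-1 * p)%g in Hh.
have qh x : q (al x * h)%g = q (al x) by apply/esym/qcoset; rewrite mulKg.
exists (fun x => (al x * h)%g); split.
- by rewrite /h mulVKg.
- by apply: (pws_smooth ob _ inb); exact: smooth_map_comp sal (smooth_mulgr _) ob.
- apply: off_finite_all => x /andP[sx xt].
  have bx : ball t0 d x by apply: inb; rewrite !ltW.
  rewrite (@speed_near _ _ _ gQ gam g').
    rewrite /speed -(tdiff_velocity al x (smooth_mulgr h)).
    have tv := tangent_velocity sal ob bx.
    by rewrite (bi_invariant_mulgr bI h tv) (Hal x bx).2.
  have ost : open `]s, t[%classic by exact: itv_open.
  apply: filterS (open_nbhs_nbhs (conj ost _)); last by rewrite /= in_itv/= sx.
  by move=> y; rewrite /= in_itv/= => /andP[sy yt]; apply: gE; rewrite !ltW.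
- by move=> x xst; rewrite qh (Hal x (inb x xst)).1 gE.
Qed.

End submersion_curves.

(** * The two inequalities between the distances of P and of the coset space *)

Section holonomy_comparison.
Context {R : realType} {k m l r : nat} {G : lieGroupType R k}
  {M : manifoldType R m} {P : manifoldType R l} {Q : manifoldType R r}.
Variables (pi : P -> M) (act : P -> G -> P) (b : metric_on G) (gM : metric_on M)
  (theta : form_on G P) (u : P) (q : G -> Q) (gT : metric_on Q).
Hypothesis hP : principal_bundle pi act.
Hypothesis bR : riemannian b.
Hypothesis bI : bi_invariant b.
Hypothesis gMR : riemannian gM.
Hypothesis th : principal_connection act theta.
Hypothesis hq : coset_projection (Hol act theta u) q.
Hypothesis gTR : riemannian gT.
Hypothesis qS : riemannian_submersion b gT q.

Let gP := connection_metric pi gM b theta.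
Let spi : smooth_map pi. Proof. by case: hP => -[]. Qed.
Let sact : smooth_map2_on [set: P * G] act. Proof. by case: hP => -[]. Qed.
Let act1 p : act p 1%g = p. Proof. by case: hP => _ []. Qed.
Let actM p g h : act (act p g) h = act p (g * h)%g. Proof. by case: hP => _ []. Qed.
Let pi_act p g : pi (act p g) = pi p. Proof. by case: hP. Qed.
Let sq : smooth_map q. Proof. by case: qS => -[]. Qed.

Let Sb : smooth_speed b. Proof. by move=> U c oU sc; exact: metric_speed_smooth. Qed.
Let ST : smooth_speed gT. Proof. by move=> U c oU sc; exact: metric_speed_smooth. Qed.

Lemma connection_metricE (c : R -> P) s :
  gP (c s) (velocity c s) (velocity c s) =
  gM (pi (c s)) (velocity (fun x => pi (c x)) s) (velocity (fun x => pi (c x)) s) +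
  b 1%g (theta (c s) (velocity c s)) (theta (c s) (velocity c s)).
Proof. by rewrite /gP /connection_metric /pullback (tdiff_velocity _ _ spi). Qed.

(** The squared speed is that of the projected curve in M plus a quadratic form with constant
    coefficients in the components of theta(c') along a basis of the Lie algebra, which are
    smooth. *)
Lemma connection_metric_smooth_speed : smooth_speed gP.
Proof.
move=> U c oU sc.
have spc : smooth_into U (fun x => pi (c x)) by exact: smooth_map_comp sc spi oU.
have [phi aphi d1] := atlas_cover (1%g : G).
have [z [E [sz tE _ zE _]]] := tangent_basis aphi d1.
have sth i := connection_velocity_smooth th sc oU (sz i).
have H : smooth_on U (fun s =>
    gM (pi (c s)) (velocity (fun x => pi (c x)) s) (velocity (fun x => pi (c x)) s) +
    \sum_i theta (c s) (velocity c s) (z i) *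
      \sum_j theta (c s) (velocity c s) (z j) * b 1%g (E i) (E j)).
  apply: smooth_onD => //; first exact: metric_speed_smooth.
  apply: smooth_on_sum => // i _; apply: smooth_onM => //.
  apply: smooth_on_sum => // j _; apply: smooth_onM => //; exact: smooth_on_cst.
apply: smooth_on_congr H => // s Us.
rewrite connection_metricE; congr (_ + _).
have t1 := connection_tangent th (tangent_velocity sc oU Us).
move: (theta (c s) (velocity c s)) t1 => xi txi.
have -> : b 1%g xi xi = b 1%g (\sum_i xi (z i) *: E i) (\sum_i xi (z i) *: E i).
  by rewrite -(zE xi txi).
rewrite (riem_suml bR)//; last by apply: tangent_sum => j _; exact: tangentZ.
by apply: eq_bigr => i _; rewrite (riem_sumr bR).
Qed.

Let SP := connection_metric_smooth_speed.

Lemma theta_le_speed (c : R -> P) s : smooth_near c s ->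
  b 1%g (theta (c s) (velocity c s)) (theta (c s) (velocity c s)) <=
  gP (c s) (velocity c s) (velocity c s).
Proof.
move=> sn; rewrite connection_metricE lerDr.
exact: (riem_ge0 gMR (smooth_near_tangent (smooth_near_map spi sn))).
Qed.

(** Left invariance gives [e] the speed |theta(c')|. Inversion and right translation by [g] preserve
    it, [q] does not increase it, and |theta(c')|^2 is one of the two nonnegative summands of the
    squared speed of [c]. *)
Lemma projection_speed_le (c : R -> P) (e : R -> G) g s :
  smooth_near c s -> smooth_near e s ->
  velocity e s = tdiff (fun y => (e s * y)%g) (theta (c s) (velocity c s)) ->
  speed gT (fun x => q ((e x)^-1 * g)%g) s <= speed gP c s.
Proof.
move=> cn en ve; rewrite /speed ler_sqrt; last first.
  apply: le_trans (theta_le_speed cn).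
  by apply: (riem_ge0 bR); apply: (connection_tangent th); exact: smooth_near_tangent.
apply: le_trans (theta_le_speed cn).
have win := smooth_near_map (@lie_inv_smooth R k G) en.
have ti := smooth_near_tangent win.
have t2 := tdiff_tangent (smooth_mulgr g) ti.
have t3 := connection_tangent th (smooth_near_tangent cn).
rewrite -(tdiff_velocity (fun x => ((e x)^-1 * g)%g) s sq).
rewrite -(tdiff_velocity (fun x => (e x)^-1%g) s (smooth_mulgr g)).
apply: le_trans (riem_submersion_le bR qS t2) _.
rewrite (bi_invariant_mulgr bI g ti) (speed_inv bR bI en) ve.
by have := bi_invariant_mulg bI (e s) t3; rewrite mulg1 => ->.
Qed.

(* If [e] solves [e' = e theta(c')], then [c e^-1] is horizontal and [q (e^-1 g^-1)]
   is a curve in [Q] no longer than [c]. *)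
Lemma coset_dist_le y y' g g' : hol_bundle theta u y -> hol_bundle theta u y' ->
  (riem_dist gT (q g^-1%g) (q g'^-1%g) <= riem_dist gP (act y g) (act y' g'))%E.
Proof.
move=> uy uy'; apply: le_ereal_inf_tmp => _ [c [/piecewise_smoothP pc c0 c1] <-].
have [e [e0 pe oe hj]] := horizontal_projection hP th 1%g pc.
rewrite c0 c1 invg1 act1 actM in hj.
(* Translating by g^-1 the horizontal curve from y g to y' g' e(1)^-1 joins y to y' h, where h is
   the element considered. As y and y' both lie in the holonomy bundle, y' ~ y ~ y' h. *)
have Hh : Hol act theta u (g' * (e 1%R)^-1 * g^-1)%g.
  apply: (Hol_of_bundle hP th uy').
  have /(hjoined_act hP th g^-1%g) := hj.
  rewrite !actM mulgV act1; apply: (hjoined_trans th).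
  exact: (hjoined_trans th (hjoined_sym th uy') uy).
have [_ qcoset _] := hq.
have qE : q ((e 1%R)^-1 * g^-1)%g = q g'^-1%g.
  by apply/esym/qcoset; rewrite invgK mulgA.
pose d x := q ((e x)^-1 * g^-1)%g.
have pd : pws 0 1 d.
  apply: pws_map sq _; apply: pws_map (smooth_mulgr _) _.
  exact: pws_map (@lie_inv_smooth R k G) pe.
apply: (@le_trans _ _ (curve_length gT d)).
  apply: ereal_inf_lbound; exists d => //; split.
  - exact/piecewise_smoothP.
  - by rewrite /d e0 invg1 mul1g.
  - exact: qE.
apply: curve_length_le => //.
apply: off_finite_sub (off_finite_and oe (pws_off_finite pc)) => s _ [[en ve] cn].
exact: projection_speed_le.
Qed.

(** A path of [G] between representatives projects to the coset space. Finiteness is needed because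
    the distortion subtracts this distance from another extended real. *)
Lemma coset_dist_fin z z' : connected [set: G] -> (riem_dist gT z z' < +oo)%E.
Proof.
move=> cG; have [qsurj _ _] := hq; have [a qa] := qsurj z; have [a' qa'] := qsurj z'.
have [c [pc c0 c1]] := connected_pws a a' cG.
have pqc : pws 0 1 (fun x => q (c x)) by exact: pws_map sq pc.
apply: le_lt_trans (curve_length_fin ST pqc).
apply: ereal_inf_lbound; exists (fun x => q (c x)) => //; split.
- exact/piecewise_smoothP.
- by rewrite c0.
- by rewrite c1.
Qed.

(** The curve c a^-1 projects to the same curve of M as the horizontal curve c, and the norm of its
    connection component is the speed of a. Its squared speed is therefore A + B, and sqrt(A + B) <=
    sqrt A + sqrt B. *)
Lemma twist_speed_le (c : R -> P) (a : R -> G) s :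
  smooth_near c s -> smooth_near a s -> theta (c s) (velocity c s) = 0 ->
  speed gP (fun x => act (c x) (a x)^-1%g) s <= speed gP c s + speed b a s.
Proof.
move=> cn an hc.
have en := smooth_near_map (@lie_inv_smooth R k G) an.
have te := smooth_near_tangent en; have tc := smooth_near_tangent cn.
have A0 := riem_ge0 gMR (smooth_near_tangent (smooth_near_map spi cn)).
have B0 := riem_ge0 bR (smooth_near_tangent an).
rewrite /speed !connection_metricE hc (riem_0l bR (tangent0 _)) addr0.
rewrite (connection_act_velocity hP th cn en) hc /Ad tdiff0 add0r.
have := bi_invariant_mulg bI (((a s)^-1)^-1)%g te; rewrite mulVg => ->.
rewrite (speed_inv bR bI an).
have -> : (fun x => pi (act (c x) (a x)^-1%g)) = (fun x => pi (c x)).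
  by apply/funext => x; rewrite pi_act.
rewrite pi_act; move: A0 B0.
move: (gM _ _ _) (b _ _ _) => A B A0 B0.
rewrite -ler_sqr ?nnegrE ?addr_ge0 ?sqrtr_ge0// sqr_sqrtr ?addr_ge0//.
rewrite sqrrD !sqr_sqrtr// -addrA lerD2l lerDr.
by rewrite mulrn_wge0// mulr_ge0// sqrtr_ge0.
Qed.

Let D := diam (hol_bundle theta u) (cc_dist theta gP (hol_bundle theta u)).

(* If [al] lifts a curve of [Q] horizontally to [G] and [c] is horizontal in [P],
   then the squared speed of [c al^-1] is the sum of those of [c] and [al]. *)
Lemma total_dist_le y y' g g' : hol_bundle theta u y -> hol_bundle theta u y' ->
  (riem_dist gP (act y g) (act y' g') <= riem_dist gT (q g^-1%g) (q g'^-1%g) + D)%E.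
Proof.
move=> uy uy'.
have dQ0 : (0 <= riem_dist gT (q g^-1%g) (q g'^-1%g))%E.
  by apply: le_ereal_inf_tmp => _ [c _ <-]; exact: curve_length_ge0.
have uu : hol_bundle theta u u by exact: (hjoined_refl th).
have D0 : (0 <= D)%E.
  apply: (@le_trans _ _ (cc_dist theta gP (hol_bundle theta u) u u)).
    by apply: le_ereal_inf_tmp => _ [c _ <-]; exact: curve_length_ge0.
  by apply: ereal_sup_ubound; exists u => //; exists u.
(* If the diameter is infinite, the right-hand side is +oo since the other summand is nonnegative.
   Otherwise [D] and the length of [gam] are real and may be moved across inequalities, so as to
   reach the infima one at a time. *)
have [Dfin|] := boolP (D \is a fin_num); last first.
  rewrite ge0_fin_numE// -leNgt leye_eq => /eqP ->.
  by rewrite addey ?leey// gt_eqF// (lt_le_trans _ dQ0)// ltNy0.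
rewrite -leeBlDr//; apply: le_ereal_inf_tmp => _ [gam [/piecewise_smoothP pg g0 g1] <-].
have Lfin : curve_length gT gam \is a fin_num.
  by rewrite ge0_fin_numE ?curve_length_ge0// curve_length_fin.
rewrite leeBlDr// -leeBlDl//.
have [al [al0 pal oal qal]] := coset_lift bR bI hq qS pg (esym g0).
have [_ qcoset _] := hq.
have Hh : Hol act theta u (g' * al 1%R)%g.
  rewrite -[g']invgK; apply/qcoset; rewrite -g1; apply/esym/qal.
  by rewrite ler01 lexx.
(* The end point prescribed to the horizontal curve: dividing it by al(1) yields y' g', as dividing
   y by al(0) = g^-1 yields y g. *)
have uy2 : hol_bundle theta u (act y' (g' * al 1%R)%g) by exact: (Hol_act hP th).
apply: (@le_trans _ _ (cc_dist theta gP (hol_bundle theta u) y (act y' (g' * al 1%R)%g))); last first.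
  by apply: ereal_sup_ubound; exists y => //; exists (act y' (g' * al 1%R)%g).
apply: le_ereal_inf_tmp => _ [c [/horizontal_pws[pc oc] c0 c1 _] <-].
rewrite leeBlDl//.
pose z x := act (c x) (al x)^-1%g.
have pz : pws 0 1 z by exact: pws_map2 sact pc (pws_map (@lie_inv_smooth R k G) pal).
apply: (@le_trans _ _ (curve_length gP z)).
  apply: ereal_inf_lbound; exists z => //; split.
  - exact/piecewise_smoothP.
  - by rewrite /z c0 al0 invgK.
  - by rewrite /z c1 actM mulgK.
rewrite addeC; apply: curve_length_le_add => //.
have H := off_finite_and (off_finite_and oc oal)
  (off_finite_and (pws_off_finite pc) (pws_off_finite pal)).
apply: off_finite_sub H => s _ [[hc <-] [cn an]].
exact: twist_speed_le.
Qed.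

Lemma same_fiber x y : pi x = pi y -> exists g, x = act y g.
Proof.
move=> xy; have [_ _ _ _ loc] := hP.
have [U [tau [Psi [[_ Ux] _ PT TP TA]]]] := loc (pi x).
have Uy : U (pi y) by rewrite -xy.
exists ((tau y)^-1 * tau x)%g.
have -> : act y ((tau y)^-1 * tau x)%g = Psi (pi y) (tau x).
  by rewrite -[LHS]PT ?pi_act// TA// mulVKg.
by rewrite -xy PT.
Qed.

(** The projection of the holonomy bundle to M is preserved by moves along chart segments: such a
    segment lifts to P by a local section, and its development corrects the lift into a horizontal
    curve. *)
Lemma hol_bundle_surj x : connected [set: M] ->
  exists y g, hol_bundle theta u y /\ x = act y g.
Proof.
move=> cM.
suff [y uy xy] : exists2 y, hol_bundle theta u y & pi y = pi x.
  by have [g xg] := same_fiber (esym xy); exists y, g.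
apply: (@connected_induction R m M (fun p => exists2 y, hol_bundle theta u y & pi y = p) (pi u) cM); last first.
  by exists u => //; exact: (hjoined_refl th).
move=> p; have [_ _ _ _ loc] := hP.
have [U [tau [Psi [[oU Up] [_ sPsi] PT TP TA]]]] := loc p.
have [V [oV Vp HV]] := chart_segment oU Up.
exists V; split=> // z w Vz Vw [y uy yz].
have [J [gam [[oJ sg] J01 g0 g1 gU]]] := HV z w Vz Vw.
pose c t := Psi (gam t) 1%g.
have sc : smooth_into J c.
  apply: (smooth_map2_on_comp sg (smooth_into_cst J 1%g) sPsi) => //.
    by move=> t Jt; split=> //=; exact: gU.
  by apply: openX => //; exact: openT.
have pc : pws 0 1 c by exact: pws_smooth oJ sc _.
(* [c] is the image of the segment under the local section tau = 1. Starting the development at (tau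
   y)^-1 makes the corrected curve start at c(0) tau(y) = y. *)
have [e [e0 pe oe hj]] := horizontal_projection hP th (tau y)^-1%g pc.
have Uz : U z by rewrite -g0; apply: gU; apply: J01; rewrite lexx ler01.
have Uw : U w by rewrite -g1; apply: gU; apply: J01; rewrite lexx ler01.
have yE : act (c 0) (tau y) = y.
  rewrite /c g0; have [p1 t1] := TP z 1%g Uz.
  rewrite -[LHS]PT ?pi_act ?p1// TA ?p1// t1 mul1g -yz PT// yz//.
rewrite invgK yE in hj.
exists (act (c 1) (e 1%R)^-1%g); first exact: (hjoined_trans th uy hj).
by rewrite pi_act /c g1; have [] := TP w 1%g Uw.
Qed.

End holonomy_comparison.

(** The distortion of [C] is at most [D] because the differences of distances lie in [0, D]; half of
    it bounds the Gromov-Hausdorff distance. An infinite distance in X forces [D] to be infinite, in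
    which case there is nothing to prove. *)
Lemma gh_dist_le (R : realType) (X Y : Type) (dX : X -> X -> \bar R) (dY : Y -> Y -> \bar R)
    (C : set (X * Y)) (D : \bar R) : correspondence C ->
  (forall z z', C z -> C z' -> dY z.2 z'.2 \is a fin_num /\
     (dY z.2 z'.2 <= dX z.1 z'.1 <= dY z.2 z'.2 + D)%E) ->
  (gh_dist dX dY <= D * (2^-1)%:E)%E.
Proof.
move=> corr H; rewrite /gh_dist muleC; apply: lee_wpmul2r.
  by rewrite lee_fin invr_ge0.
apply: (@le_trans _ _ (distortion dX dY C)); first by apply: ereal_inf_lbound; exists C.
apply: ge_ereal_sup => _ [z Cz [z' Cz' <-]].
have [fY /andP[]] := H z z' Cz Cz'.
move: (dX _ _) (dY _ _) fY => x y; case: y => [y| |]// _.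
case: x => [x| |]//; case: D {H} => [d| |]//=; rewrite ?leey//.
rewrite !lee_fin => yx xyd; rewrite ger0_norm ?subr_ge0//; lra.
Qed.

Theorem corollary2 (R : realType) (k m l r : nat)
    (G : lieGroupType R k) (M : manifoldType R m) (P : manifoldType R l)
    (hGc : compact [set: G]) (hGconn : connected [set: G])
    (hMc : compact [set: M]) (hMconn : connected [set: M])
    (pi : P -> M) (act : P -> G -> P) (hP : principal_bundle pi act)
    (b : metric_on G) (hb : riemannian b) (hbinv : bi_invariant b)
    (gM : metric_on M) (hgM : riemannian gM)
    (theta : form_on G P) (htheta : principal_connection act theta)
    (u : P) (hclosed : closed (Hol act theta u))
    (Q : manifoldType R r) (q : G -> Q)
    (hq : coset_projection (Hol act theta u) q)
    (gT : metric_on Q) (hgT : riemannian gT) (hgTinv : left_invariant q gT)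
    (hsub : riemannian_submersion b gT q) :
  let gP := connection_metric pi gM b theta in
  (gh_dist (riem_dist gP) (riem_dist gT) <=
   diam (hol_bundle theta u)
        (cc_dist theta gP (hol_bundle theta u)) * (2^-1)%:E)%E.
Proof.
lazy zeta.
(* The inverse suits left cosets: writing y g as (y h)(h^-1 g) with h in the holonomy group replaces
   g^-1 by g^-1 h, which has the same image under [q]. *)
apply: (@gh_dist_le _ _ _ _ _ [set z | exists y g,
  [/\ hol_bundle theta u y, z.1 = act y g & z.2 = q g^-1%g]]).
  split=> [x|z].
    have [y [g [uy ->]]] := hol_bundle_surj u hP htheta x hMconn.
    by exists (q g^-1%g), y, g.
  have [qsurj _ _] := hq; have [a <-] := qsurj z.
  by exists (act u a^-1%g), u, a^-1%g; split=> //=; [exact: (hjoined_refl htheta)|rewrite invgK].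
move=> [_ _] [_ _] [y [g [uy /= -> ->]]] [y' [g' [uy' /= -> ->]]]; split.
  rewrite ge0_fin_numE; first exact: (coset_dist_fin hq hgT hsub).
  by apply: le_ereal_inf_tmp => _ [c _ <-]; exact: curve_length_ge0.
apply/andP; split.
  exact: (coset_dist_le hP hb hbinv hgM htheta hq hgT hsub).
exact: (total_dist_le hP hb hbinv hgM htheta hq hgT hsub).
Qed.
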